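(* Consider the control volume finite element (CVFE) scheme and its regularization $\mathcal{F}^{\epsilon,\eta}$ described in the context. Let $p^n=(p_g^n,p_w^n)\in V_{\mathcal T}^0\times V_{\mathcal T}^0$ be such that the associated saturations satisfy $0\le s^n_{\alpha,K}\le1$ for all $\alpha\in\{g,w\}$ and all vertices $K\in\mathcal V$, and let $\delta t>0$. Then for every $\epsilon>0$ and $\eta>0$ the regularized scheme $\mathcal{F}^{\epsilon,\eta}(p,p^n)=0$ has a solution $p=(p_g,p_w)\in V_{\mathcal T}^0\times V_{\mathcal T}^0$. Consequently, the (non-regularized) CVFE scheme $\mathcal{F}^{0,0}(p,p^n)=0$ has a solution $p=(p_g,p_w)\in V_{\mathcal T}^0\times V_{\mathcal T}^0$.
   Context: **Data.** $\Omega\subset\mathbb{R}^2$ is a bounded open polygonal domain, with $\partial\Omega=\Gamma_{Dir}\cup\Gamma_N$ and $|\Gamma_{Dir}|>0$. The phases are $\alpha\in\{g,w\}$, with $|g|=0$, $|w|=1$. - The capillary pressure $p_c:\mathbb{R}\to\mathbb{R}$ is an increasing homeomorphism, piecewise $C^1$ with bounded derivative, $p_c(0)=0$. - Saturations are given by $s_g=p_c^{-1}(p_g-p_w)$, $s_w=1-s_g$. - The mobilities $M_\alpha:\mathbb R\to[0,\infty)$ are continuous, increasing on $[0,1]$, with $M_\alpha(u)=0$ for $u\le0$ and $M_\alpha(u)=M_\alpha(1)$ for $u\ge1$. There is $m_0>0$ with $M_w(1-u)+M_g(u)\ge m_0$ for all $u$. Set $M_\alpha^\epsilon=\epsilon+M_\alpha$.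 - Porosity: $\phi\in L^\infty(\Omega)$, $0<\phi_0\le\phi\le\phi_1$ a.e. - $\Lambda(x)$ is a symmetric matrix with $\underline\Lambda|v|^2\le\Lambda(x)v\cdot v\le\overline\Lambda|v|^2$ for all $v$ and a.e. $x$, with $0<\underline\Lambda\le\overline\Lambda$. - Densities: $\rho_\alpha\in C^1(\mathbb{R})$ is increasing with $0<\rho_0\le\rho_\alpha\le\rho_1$. There are no gravity or source terms, and the Dirichlet conditions are $p_g=p_w=0$ on $\Gamma_{Dir}$. **CVFE mesh.** $\mathcal T$ is a conforming triangulation of $\Omega$ with vertex set $\mathcal V$; a vertex is written $x_K$ or simply $K$. $\mathcal V_{Dir}$ is the set of vertices on $\Gamma_{Dir}$ and $\mathcal V_{Dir}^c=\mathcal V\setminus\mathcal V_{Dir}$. $\mathcal T_K$ is the set of triangles having $x_K$ as a vertex, $\mathcal V_T$ the set of vertices of $T$, and $\mathcal V_{KT}=\mathcal V_T\setminus\{x_K\}$. The control volume $A_K$ is the union over $T\in\mathcal T_K$ of the polygons with vertices $x_K$, the barycenter of $T$, and the midpoints of the two edges of $T$ at $x_K$; $m_{A_K}$ is its area. $V_{\mathcal T}$ is the space of continuous piecewise affine ($\mathbb P_1$) functions on $\mathcal T$, with nodal basis $(\varphi_K)_{K\in\mathcal V}$, and $V^0_{\mathcal T}=\{f\in V_{\mathcal T}:f(x_K)=0\ \forall K\in\mathcal V_{Dir}\}$. As in the paper, $\|f\|_{V_{\mathcal T}}=(\int_\Omega|\nabla f|^2dx)^{1/2}$ is a norm on $V_{\mathcal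 T}^0$. For $f\in V_{\mathcal T}$ write $f_K=f(x_K)$. Write $\delta_{KL}u=u_L-u_K$. Let $$\Lambda^T_{KL}=-\int_T\Lambda(x)\nabla\varphi_K\cdot\nabla\varphi_L\,dx=\Lambda_{LK}^T,\qquad \mathcal V_{KT}^+=\{L\in\mathcal V_{KT}:\Lambda_{KL}^T\ge0\}.$$ **Discrete quantities.** For $K\in\mathcal V$: $s_{g,K}=p_c^{-1}(p_{g,K}-p_{w,K})$, $s_{w,K}=1-s_{g,K}$; $\phi_K$ is the mean of $\phi$ over $A_K$; $\mathcal Z(s)=\min(\max(s,0),1)$; $\delta_{KL}p_c=p_c(s_{g,L})-p_c(s_{g,K})=\delta_{KL}(p_g-p_w)$. $\frac1{\rho_{\alpha,KL}}=\frac{1}{p_{\alpha,L}-p_{\alpha,K}}\int_{p_{\alpha,K}}^{p_{\alpha,L}}\frac{dz}{\rho_\alpha(z)}$ if $p_{\alpha,K}\ne p_{\alpha,L}$, and $\frac1{\rho_\alpha(p_{\alpha,K})}$ otherwise. In a triangle $T$, the interface saturation $s_{\alpha,KL}$ (depending on $T$) is: if $\Lambda_{KL}^T\ge0$, $s_{\alpha,KL}=s_{\alpha,L}$ when $\delta_{KL}p_\alpha\ge0$ and $s_{\alpha,K}$ when $\delta_{KL}p_\alpha<0$; if $\Lambda^T_{KL}<0$, $s_{\alpha,KL}=\min_{J\in\mathcal V_T}s_{\alpha,J}$. **Scheme.** For $\epsilon,\eta\ge0$, $\alpha\in\{g,w\}$, $K\in\mathcal V_{Dir}^c$, the components of $\mathcal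 F^{\epsilon,\eta}(p,p^n)$ are $$\mathcal F^{\epsilon,\eta}_{\alpha,K}=m_{A_K}\phi_K\big(\rho_\alpha(p_{\alpha,K})\mathcal Z(s_{\alpha,K})-\rho_\alpha(p^n_{\alpha,K})s^n_{\alpha,K}\big)-\delta t\sum_{T\in\mathcal T_K}\sum_{L\in\mathcal V_{KT}}\rho_{\alpha,KL}M_\alpha^\epsilon(s_{\alpha,KL})\Lambda_{KL}^T\delta_{KL}p_\alpha-\delta t\,\eta(-1)^{|\alpha|}\sum_{T\in\mathcal T_K}\sum_{L\in\mathcal V_{KT}^+}\rho_{\alpha,KL}|\Lambda_{KL}^T|\delta_{KL}p_c .$$ The CVFE scheme is $\mathcal F^{0,0}(p,p^n)=0$. *)

(* Defs.v *)
(* MathComp / MathComp-Analysis; the plane is R * R with R : realType. *)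
From HB Require Import structures.
From mathcomp Require Import all_boot all_order all_algebra.
From mathcomp Require Import all_classical all_reals all_analysis.

Set Implicit Arguments.
Unset Strict Implicit.
Unset Printing Implicit Defensive.

Import Order.TTheory GRing.Theory Num.Theory.
Import numFieldTopology.Exports numFieldNormedType.Exports.

Local Open Scope classical_set_scope.
Local Open Scope ring_scope.

Section Plane.
Variable R : realType.

Definition plane : Type := (measurableTypeR R * measurableTypeR R)%type.

(* Two-dimensional Lebesgue measure, on the Borel sets. *)
Local Notation leb2 :=
  (@lebesgue_measure R \x @lebesgue_measure R)%E.

Definition area (A : set (R * R)) : R := fine (leb2 A).

Definition integral2 (A : set (R * R)) (f : R * R -> R) : R :=
  \int[leb2]_(x in (A : set plane)) f x.

Definition ae2 (A : set (R * R)) (P : R * R -> Prop) : Prop :=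
  {ae leb2, forall x : plane, A x -> P x}.

Definition measurable2 (A : set (R * R)) (f : R * R -> R) : Prop :=
  measurable_fun (A : set plane) (f : plane -> measurableTypeR R).

Definition conv_hull (A : set (R * R)) : set (R * R) :=
  [set x | exists (n : nat) (q : 'I_n -> R * R) (w : 'I_n -> R),
    [/\ forall i, A (q i), forall i, 0 <= w i, \sum_i w i = 1
      & x = \sum_i w i *: q i]].

Definition on_segment (s : (R * R) * (R * R)) (t : R) : R * R :=
  s.1 + t *: (s.2 - s.1).

Definition seg_length (s : (R * R) * (R * R)) : R :=
  Num.sqrt ((s.2.1 - s.1.1) ^+ 2 + (s.2.2 - s.1.2) ^+ 2).

Definition polygonal_domain (Omega : set (R * R))
    (sides : seq ((R * R) * (R * R))) : Prop :=
  [/\ open Omega, bounded_set Omega & connected Omega] /\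
  [/\ forall s, s \in sides -> s.1 != s.2,
      closure Omega `\` Omega =
        [set x | exists2 s, s \in sides &
                 exists2 t, 0 <= t <= 1 & x = on_segment s t]
    & forall i j : 'I_(size sides), i != j ->
        (on_segment (tnth (in_tuple sides) i) @` [set t | 0 < t < 1]) `&`
        (on_segment (tnth (in_tuple sides) j) @` [set t | 0 < t < 1]) = set0].

(* One-dimensional measure of a part Gamma of the polygonal boundary, computed
   side by side. *)
Definition boundary_length (sides : seq ((R * R) * (R * R)))
    (Gamma : set (R * R)) : \bar R :=
  (\sum_(s <- sides) (seg_length s)%:E *
     lebesgue_measure [set t : R | (0 <= t <= 1)%R /\ Gamma (on_segment s t)])%E.

Definition dot (u v : 'cV[R]_2) : R := (u^T *m v) ord0 ord0.

Definition grad (f : R * R -> R) (x : R * R) : 'cV[R]_2 :=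
  \col_(i < 2) 'D_(if i == ord0 then (1, 0) else (0, 1)) f x.

End Plane.

Section Mesh.
Variable R : realType.

Record mesh := Mesh {
  vertex : finType;
  vpos : vertex -> R * R;
  triangles : {set {set vertex}}
}.

Variables (Omega GammaD : set (R * R)) (m : mesh).
Implicit Types (T : {set vertex m}) (K L : vertex m).

Definition tri_hull T : set (R * R) :=
  conv_hull [set vpos K | K in [set K | K \in T]].

Definition cross (u v : R * R) : R := u.1 * v.2 - u.2 * v.1.

Definition nondegenerate T : Prop :=
  #|T| = 3%N /\
  forall K L J, K \in T -> L \in T -> J \in T ->
    K != L -> L != J -> J != K ->
    cross (vpos L - vpos K) (vpos J - vpos K) != 0.

Definition conforming_triangulation : Prop :=
  [/\ injective (@vpos m),
      forall T, T \in triangles m -> nondegenerate T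
    & forall K, exists2 T, T \in triangles m & K \in T] /\
  [/\ \bigcup_(T in [set T | T \in triangles m]) tri_hull T = closure Omega,
      forall T, T \in triangles m -> interior (tri_hull T) `<=` Omega
    & forall T T', T \in triangles m -> T' \in triangles m ->
        tri_hull T `&` tri_hull T' = tri_hull (T :&: T')].

(* A mesh compatible with GammaD has at least one such vertex.  Otherwise P1_0
   below would contain the constants, on which |grad f|_{L^2} vanishes. *)
Definition dirichlet K : Prop := GammaD (vpos K).

(* Only the restriction of f to the closure of Omega matters. *)
Definition P1 (f : R * R -> R) : Prop :=
  {within closure Omega, continuous f} /\
  forall T, T \in triangles m -> exists a b c : R,
    forall x, tri_hull T x -> f x = a * x.1 + b * x.2 + c.

Definition P1_0 (f : R * R -> R) : Prop :=
  P1 f /\ forall K, dirichlet K -> f (vpos K) = 0.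

Definition nodal_basis (hat : vertex m -> R * R -> R) : Prop :=
  forall K, P1 (hat K) /\ forall L, hat K (vpos L) = (K == L)%:R.

Definition barycenter T : R * R := 3%:R^-1 *: \sum_(K in T) vpos K.

Definition midpoint K L : R * R := 2%:R^-1 *: (vpos K + vpos L).

Definition control_volume K : set (R * R) :=
  \bigcup_(T in [set T | T \in triangles m /\ K \in T])
    conv_hull ([set vpos K; barycenter T] `|`
               [set midpoint K L | L in [set L | L \in T :\ K]]).

(* The porosity is only given on Omega; control_volume K may contain points of
   the boundary, which has measure zero. *)
Definition poro_mean (poro : R * R -> R) K : R :=
  (area (control_volume K))^-1 *
  integral2 (control_volume K `&` Omega) poro.

(* The integral is over the open triangle: the basis functions are not
   differentiable on the edges, which have measure zero. *)
Definition transmissibility (Lambda : R * R -> 'M[R]_2)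
    (hat : vertex m -> R * R -> R) T K L : R :=
  - integral2 (interior (tri_hull T))
      (fun x => dot (Lambda x *m grad (hat K) x) (grad (hat L) x)).

End Mesh.

Variant phase := gas | water.

Definition phase_idx (a : phase) : nat := if a is gas then 0%N else 1%N.

Section Model.
Variable R : realType.

(* cap_inv is the inverse of the capillary pressure cap; see is_capillary. *)
Record model := Model {
  cap : R -> R;
  cap_inv : R -> R;
  mob : phase -> R -> R;
  poro : R * R -> R;
  perm : R * R -> 'M[R]_2;
  rho : phase -> R -> R
}.

Definition piecewise_C1_bounded (f : R -> R) : Prop :=
  exists (s : seq R) (C : R), forall x, x \notin s ->
    [/\ derivable f x 1, {for x, continuous (derive1 f)} & `|derive1 f x| <= C].

Definition is_capillary (f g : R -> R) : Prop :=
  [/\ cancel f g, cancel g f, continuous f & continuous g] /\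
  [/\ {homo f : x y / x < y}, piecewise_C1_bounded f & f 0 = 0].

Definition is_mobility (M : R -> R) : Prop :=
  [/\ continuous M, forall u, 0 <= M u,
      forall u v, 0 <= u -> u <= v -> v <= 1 -> M u <= M v,
      forall u, u <= 0 -> M u = 0
    & forall u, 1 <= u -> M u = M 1].

Definition is_porosity (Omega : set (R * R)) (phi0 phi1 : R)
    (phi : R * R -> R) : Prop :=
  measurable2 Omega phi /\ ae2 Omega (fun x => phi0 <= phi x <= phi1).

Definition is_permeability (Omega : set (R * R)) (lam0 lam1 : R)
    (Lambda : R * R -> 'M[R]_2) : Prop :=
  (forall i j, measurable2 Omega (fun x => Lambda x i j)) /\
  ae2 Omega (fun x => (Lambda x)^T = Lambda x /\
    forall v : 'cV[R]_2,
      lam0 * dot v v <= dot (Lambda x *m v) v <= lam1 * dot v v).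

Definition is_density (r0 r1 : R) (r : R -> R) : Prop :=
  [/\ forall x, derivable r x 1, continuous (derive1 r),
      {homo r : x y / x <= y} & forall x, r0 <= r x <= r1].

(* The oriented integral of f from a to b. *)
Definition oriented_integral (f : R -> R) (a b : R) : R :=
  if a <= b then \int[lebesgue_measure]_(z in `[a, b]) f z
  else - \int[lebesgue_measure]_(z in `[b, a]) f z.

Definition rho_mean (r : R -> R) (a b : R) : R :=
  if a == b then r a
  else ((b - a)^-1 * oriented_integral (fun z => (r z)^-1) a b)^-1.

Definition clip (s : R) : R := Num.min (Num.max s 0) 1.

End Model.

Section Scheme.
Variables (R : realType) (d : model R) (Omega : set (R * R)) (m : mesh R).
Variable hat : vertex m -> R * R -> R.
Implicit Types (T : {set vertex m}) (K L : vertex m) (a : phase).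
Implicit Types (p pn : phase -> R * R -> R).

Definition sat p a K : R :=
  let sg := cap_inv d (p gas (vpos K) - p water (vpos K)) in
  if a is gas then sg else 1 - sg.

Definition dlt p a K L : R := p a (vpos L) - p a (vpos K).

Definition dlt_cap p K L : R := cap d (sat p gas L) - cap d (sat p gas K).

Definition rho_edge p a K L : R :=
  rho_mean (rho d a) (p a (vpos K)) (p a (vpos L)).

Let lam := transmissibility (perm d) hat.

(* In the last case K is a vertex of T, so the default value is harmless. *)
Definition sat_edge p a T K L : R :=
  if 0 <= lam T K L
  then (if 0 <= dlt p a K L then sat p a L else sat p a K)
  else \big[Num.min/sat p a K]_(J in T) sat p a J.

Definition residual (eps eta dt : R) p pn a K : R :=
  area (control_volume K) * poro_mean Omega (poro d) K *
    (rho d a (p a (vpos K)) * clip (sat p a K)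
     - rho d a (pn a (vpos K)) * sat pn a K)
  - dt * (\sum_(T in triangles m | K \in T) \sum_(L in T :\ K)
      rho_edge p a K L * (eps + mob d a (sat_edge p a T K L)) *
      lam T K L * dlt p a K L)
  - dt * eta * (-1) ^+ phase_idx a *
    (\sum_(T in triangles m | K \in T) \sum_(L in T :\ K | 0 <= lam T K L)
      rho_edge p a K L * `|lam T K L| * dlt_cap p K L).

Definition scheme_solution (GammaD : set (R * R)) (eps eta dt : R) pn p : Prop :=
  (forall a, P1_0 Omega GammaD m (p a)) /\
  forall a K, ~ dirichlet GammaD K -> residual eps eta dt p pn a K = 0.

End Scheme.

(* Main.v *)
(** For [eps > 0], testing the equation of phase [a] with [g_a(p_a)], where
    [g_a' = 1 / rho_a], turns the mean densities into plain pressure differences.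
    The minimum rule on edges of negative transmissibility bounds the flux part
    of each triangle below by its smallest mobility times a positive definite
    form, and concavity of [g_a] bounds the storage part below by a constant that
    does not depend on [eps], [eta] and [p].  The scheme is therefore coercive,
    and a coercive continuous map has a zero by a Brouwer-type theorem, which is
    obtained from the combinatorial lemma of Petri and Voorneveld: for finitely
    many linear orders on a finite coloured set, the doors of a house match its
    rooms so that an odd number of rooms is rainbow coloured.

    In the limit [eps -> 0] with [eta] fixed, the energy bounds [max(p_g, p_w)]
    along the edges of positive transmissibility, uniformly in [eps] and [eta],
    and the [eta]-term bounds [p_g - p_w].  For [eps = 0] and [eta > 0] a maximum
    principle gives [0 <= s_a <= 1], so [p_g - p_w] lies in [[0, p_c(1)]]
    independently of [eta], and [eta -> 0] is possible as well. *)
Require Import Defs.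
From HB Require Import structures.
From mathcomp Require Import all_boot zify.

Set Implicit Arguments.
Unset Strict Implicit.
Unset Printing Implicit Defensive.

(** * Rooms and doors *)

(** The order of the two limits is forced. The maximum principle needs [eps = 0]: at a negative
    saturation the mobility vanishes, but a remaining [eps] would let the phase flow out of that
    vertex. Without [eps], however, the energy controls only the larger pressure; the pressure of an
    immobile phase could tend to minus infinity, and for fixed [eta] the capillary term excludes
    this. Its bound on [p_g - p_w] blows up as [eta] tends to 0, so the maximum principle has to
    replace it before [eta] is sent to 0. All pressure estimates propagate along edges of positive
    transmissibility, which already connect the mesh, so no angle condition on the triangles enters.
    For the zeros of coercive maps, the grid points of a simplex are ordered by each coordinate in
    turn, and rooms take the place of the cells of a triangulation: dominance alone makes them
    small. A rainbow room, in the limit of fine grids, solves a variational inequality on the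
    simplex, and coercivity moves that solution to the interior, where the inequality becomes an
    equation. *)

Section Removal.
Variables (A B : finType) (f : A -> B).

(** By counting, one fibre of [f] on [D] has two points and all others have one; the redundant
    points are those of the double fibre. Applied below both to the colouring and to the map from
    indices to lowest points. *)
Lemma card_redundant (D : {set A}) : #|D| = #|f @: D|.+1 ->
  #|[set x in D | f @: (D :\ x) == f @: D]| = 2.
Proof.
move=> cD.
pose fib b := [set x in D | f x == b].
have fib_gt0 b : b \in f @: D -> 0 < #|fib b|.
  by case/imsetP=> x xD ->; apply/card_gt0P; exists x; rewrite inE xD eqxx.
have cDs : #|D| = \sum_(b in f @: D) #|fib b|.
  rewrite -sum1_card (partition_big f (mem (f @: D))) /=; last first.
    by move=> x xD; exact: imset_f.
  by apply: eq_bigr => b _; rewrite -sum1_card; apply: eq_bigl => x; rewrite !inE.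
have [b bD cb] : exists2 b, b \in f @: D & 1 < #|fib b|.
  apply/exists_inP; rewrite -[X in is_true X]negbK negb_exists_in.
  apply/negP=> /forall_inP h; have : #|D| <= #|f @: D|.
    rewrite cDs -[leqRHS]sum1_card; apply: leq_sum => b bD.
    by rewrite leqNgt; exact: h.
  by rewrite cD ltnn.
have [cb2 others] : #|fib b| = 2 /\ forall b', b' \in f @: D -> b' != b -> #|fib b'| = 1.
  have E : \sum_(b' in f @: D | b' != b) #|fib b'|
         = \sum_(b' in f @: D | b' != b) (#|fib b'|.-1) + \sum_(b' in f @: D | b' != b) 1.
    rewrite -big_split; apply: eq_bigr => b' /andP[/fib_gt0 b'D _] /=.
    by rewrite addn1 prednK.
  have cB : #|f @: D| = (\sum_(b' in f @: D | b' != b) 1).+1.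
    by rewrite -sum1_card (bigD1 b).
  move: cD; rewrite cDs (bigD1 b) //= E cB.
  set S := \sum_(_ in _ | _) _.-1; set N := \sum_(_ in _ | _) 1.
  have -> : #|fib b| = (#|fib b|.-2).+2 by case: #|fib b| cb => [|[]].
  rewrite addnA -[X in _ = X]addn2 [in X in X = _]addnC => /addnI.
  rewrite !addSn => -[] /eqP; rewrite addn_eq0 => /andP[/eqP -> /eqP S0].
  split=> // b' b'D b'b; move: S0 => /eqP.
  rewrite sum_nat_eq0 => /forallP /(_ b'); rewrite b'D b'b /= => /eqP.
  by have := fib_gt0 _ b'D; case: #|fib b'| => [|[]].
rewrite -cb2; apply: eq_card => x; rewrite !inE; case: (boolP (x \in D)) => //= xD.
have eqf : (f @: (D :\ x) == f @: D) = (f x \in f @: (D :\ x)).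
  apply/eqP/idP => [-> | fx]; first exact: imset_f.
  apply/eqP; rewrite eqEsubset imsetS ?subD1set //=; apply/subsetP => _ /imsetP[y yD ->].
  by have [->//|yx] := eqVneq y x; apply: imset_f; rewrite !inE yx.
rewrite eqf; have [fxb|fxb] := eqVneq (f x) b.
  apply/imsetP; have : x \in fib b by rewrite !inE xD fxb eqxx.
  move=> xF; move: cb; rewrite (cardD1 x) xF ltnS => /card_gt0P[y].
  rewrite !inE => /and3P[yx yD /eqP fy]; exists y; last by rewrite fy.
  by rewrite !inE yx.
apply/negP=> /imsetP[y]; rewrite !inE => /andP[yx yD] fxy.
have /eqP/cards1P[z fz] := others _ (imset_f f xD) fxb.
have : x \in fib (f x) by rewrite !inE xD eqxx.
have : y \in fib (f x) by rewrite !inE yD fxy eqxx.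
by rewrite fz !inE => /eqP yz /eqP xz; rewrite yz xz eqxx in yx.
Qed.

(** Pairs of sets that differ by one point, indexed by the larger or by the smaller set. This is the
    double counting of rooms and doors. *)
Lemma sum_setD1 (F : {set A} -> {set A} -> nat) :
  \sum_(D : {set A}) \sum_(x in D) F (D :\ x) D =
  \sum_(D : {set A}) \sum_(x | x \notin D) F D (x |: D).
Proof.
rewrite (exchange_big_dep xpredT) //= [RHS](exchange_big_dep xpredT) //=.
apply: eq_bigr => x _.
rewrite (reindex_onto (fun D => x |: D) (fun D => D :\ x)) /=; last first.
  by move=> D xD; exact: setD1K.
apply: eq_big => D; last by move=> /andP[_ /eqP ->].
rewrite setU11 /=; apply/eqP/idP => [<-|]; first by rewrite !inE eqxx.
by move/setU1K.
Qed.

Lemma sum_mem_card (P : pred A) (D : {set A}) :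
  \sum_(x in D) (P x : nat) = #|[set x in D | P x]|.
Proof.
by rewrite -sum1_card big_mkcond [RHS]big_mkcond; apply: eq_bigr => x _; rewrite inE;
  case: (x \in D); case: (P x).
Qed.

End Removal.

Section Rooms.
Variables (I X : finType) (key : I -> X -> nat).
Hypothesis key_inj : forall i, injective (key i).
Implicit Types (D : {set X}) (C : {set I}).

Definition below i x D := [forall d in D, key i x <= key i d].

(** No point of [X] lies above the lowest point of [D] in every order of [C]. For empty [D] and
    inhabited [X] this says that [C] is nonempty, which starts the parity argument. *)
Definition dominant D C := [forall x, exists i in C, below i x D].

Definition room D C := dominant D C && (#|D| == #|C|).

Lemma dominantP D C :
  reflect (forall x, exists2 i, i \in C & below i x D) (dominant D C).
Proof. by apply: (iffP forallP) => h x; apply/exists_inP. Qed.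

Lemma below_setU1 i x y D : below i x (y |: D) = (key i x <= key i y) && below i x D.
Proof.
apply/forall_inP/andP => [h|[xy /forall_inP h] d].
  by split; [apply: h; rewrite setU11 | apply/forall_inP => d dD; apply: h; rewrite setU1r].
by case/setU1P => [->//|/h].
Qed.

Lemma dominantD1 D C x : dominant D C -> dominant (D :\ x) C.
Proof.
move=> /dominantP h; apply/dominantP => y; have [i iC /forall_inP b] := h y.
by exists i => //; apply/forall_inP => d /setD1P[_]; exact: b.
Qed.

Lemma dominantU1 D C i : dominant D C -> dominant D (i |: C).
Proof.
move=> /dominantP h; apply/dominantP => y; have [j jC b] := h y.
by exists j => //; rewrite setU1r.
Qed.

Lemma below_inj i x y D : x \in D -> y \in D -> below i x D -> below i y D -> x = y.
Proof.
move=> xD yD /forall_inP hx /forall_inP hy; apply: (@key_inj i).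
by apply/eqP; rewrite eqn_leq hx ?hy.
Qed.

Definition lowest x0 D i := [arg min_(d < x0 in D) key i d].

Lemma lowestP x0 D i : x0 \in D -> (lowest x0 D i \in D) /\ below i (lowest x0 D i) D.
Proof.
by move=> x0D; rewrite /lowest; case: arg_minnP => // d dD h; split=> //; apply/forall_inP.
Qed.

Lemma lowestE x0 D i x : x0 \in D -> x \in D -> below i x D -> lowest x0 D i = x.
Proof. by move=> x0D xD b; have [] := lowestP i x0D; move=> lD lb; exact: below_inj lb b. Qed.

(** Dominance applied to the points of [D] themselves: each is lowest for some index of [C]. Hence
    indices and points of a room correspond one to one, and if [C] has one element more than [D],
    exactly one point is lowest twice. *)
Lemma lowest_imset x0 D C : x0 \in D -> dominant D C -> lowest x0 D @: C = D.
Proof.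
move=> x0D /dominantP h; apply/setP => x; apply/imsetP/idP => [[i _ ->]|xD].
  by have [] := lowestP i x0D.
by have [i iC b] := h x; exists i => //; rewrite (lowestE x0D xD b).
Qed.

Lemma room_lowest_inj D C x k l : room D C -> x \in D -> k \in C -> l \in C ->
  below k x D -> below l x D -> k = l.
Proof.
move=> /andP[dom /eqP card] xD kC lC bk bl.
have /imset_injP inj : #|lowest x D @: C| == #|C| by rewrite lowest_imset // card.
by apply: inj => //; rewrite (lowestE xD xD bk) (lowestE xD xD bl).
Qed.

(* The door (D, C) with index k opens onto (D, C \ k) if that pair is dominant,
   and otherwise onto (x + D, C) for the k-largest point x witnessing that it is
   not; neither happens unless k is redundant for the lowest points of D. *)
Lemma rooms_through_index D C k x0 : x0 \in D -> dominant D C -> #|C| = #|D|.+1 -> k \in C ->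
  dominant D (C :\ k) +
  #|[set x | [&& x \notin D, dominant (x |: D) C & below k x D]]| =
  (lowest x0 D @: (C :\ k) == D).
Proof.
move=> x0D dom card kC; set S := [set x | _].
have roomU x : x \in S -> room (x |: D) C.
  by rewrite inE => /and3P[xD d b]; rewrite /room d cardsU1 xD card add1n eqxx.
have uniq_below x l : x \in S -> l \in C -> below l x D -> l = k.
  move=> xS lC b; have rm := roomU _ xS; move: xS; rewrite inE => /and3P[xD d bk].
  by apply: (room_lowest_inj (x := x) rm) => //; rewrite ?setU11 // below_setU1 leqnn.
have [red|nred] := eqVneq; last first.
  (* A point [d] that is lowest for [k] alone blocks both alternatives: dominance without [k] fails
     at [d], and a new point [x] that is [k]-below [d] leaves [d] lowest for no index at all. *)
  have /exists_inP[d dD /forall_inP hd] :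
      [exists d in D, [forall l in C :\ k, ~~ below l d D]].
    move: nred; apply: contraNT.
    rewrite negb_exists_in => /forall_inP h; rewrite eqEsubset; apply/andP; split.
      by apply/subsetP => _ /imsetP[i _ ->]; have [] := lowestP i x0D.
    apply/subsetP => d dD; have := h d dD; rewrite negb_forall => /existsP[l].
    rewrite negb_imply negbK => /andP[lC b].
    by apply/imsetP; exists l => //; rewrite (lowestE x0D dD b).
  have -> /= : dominant D (C :\ k) = false.
    by apply/negP => /dominantP /(_ d)[l lC b]; have := hd _ lC; rewrite b.
  rewrite add0n; apply/eqP; rewrite cards_eq0; apply/eqP/setP => x; rewrite [RHS]inE.
  apply/negP; rewrite inE => /and3P[xD /dominantP /(_ d)[l lC]].
  rewrite below_setU1 => /andP[dx b] bk.
  have lk : l != k.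
    apply/negP => /eqP lk; move: bk => /forall_inP/(_ d dD); rewrite -lk => xd.
    have /(@key_inj l) E : key l x = key l d by apply/eqP; rewrite eqn_leq xd.
    by rewrite E dD in xD.
  by have := hd l; rewrite !inE lk lC b => /(_ isT).
case: (boolP (dominant D (C :\ k))) => [dk|ndk].
  suff -> : S = set0 by rewrite cards0.
  apply/setP => x; rewrite [RHS]inE; apply/negP => xS.
  have /dominantP/(_ x)[l] := dk; rewrite !inE => /andP[lk lC] b.
  by rewrite (uniq_below x l) ?eqxx in lk.
pose B := [set x | [forall l in C :\ k, ~~ below l x D]].
have [y yB] : exists y, y \in B.
  move: ndk; rewrite negb_forall => /existsP[y]; rewrite negb_exists_in => h.
  by exists y; rewrite inE.
have notB x l : x \in B -> l \in C -> below l x D -> l = k.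
  rewrite inE => /forall_inP h lC b; apply/eqP; apply: contraTT b => lk.
  by apply: h; rewrite !inE lk.
pose x := [arg max_(z > y in B) key k z].
have [xB xmax] : x \in B /\ forall z, z \in B -> key k z <= key k x.
  by rewrite /x; case: arg_maxnP.
have xD : x \notin D.
  apply/negP => xD; move: (xD); rewrite -red => /imsetP[l lC xl].
  have [_] := lowestP l x0D; rewrite -xl; move: lC; rewrite !inE => /andP[lk lC] b.
  by rewrite (notB _ _ xB lC b) eqxx in lk.
have bx : below k x D.
  by have /dominantP/(_ x)[l lC b] := dom; rewrite -(notB _ _ xB lC b).
have xS : x \in S.
  rewrite inE xD bx andbT /=; apply/dominantP => z; case: (boolP (z \in B)) => zB.
    exists k => //; rewrite below_setU1 xmax //=; apply/forall_inP => d dD.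
    by rewrite (leq_trans (xmax _ zB)) //; move/forall_inP: bx; exact.
  move: zB; rewrite inE negb_forall => /existsP[l]; rewrite negb_imply negbK.
  rewrite !inE => /andP[/andP[lk lC] b]; exists l => //; rewrite below_setU1 b andbT.
  have : ~~ below l x D by move: xB; rewrite inE => /forall_inP; apply; rewrite !inE lk.
  rewrite negb_forall => /existsP[d]; rewrite negb_imply -ltnNge => /andP[dD dx].
  by rewrite (leq_trans _ (ltnW dx)) //; move/forall_inP: b; exact.
suff -> : S = [set x] by rewrite cards1.
apply/setP => z; rewrite [RHS]inE; apply/idP/eqP => [zS|->//].
have zB : z \in B.
  rewrite inE; apply/forall_inP => l; rewrite !inE => /andP[lk lC].
  by apply: contra lk => b; rewrite (uniq_below z l).
apply: (@key_inj k); apply/eqP; rewrite eqn_leq xmax //=.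
move: (zS); rewrite inE => /and3P[_ /dominantP/(_ x)[l lC]]; rewrite below_setU1.
by case/andP=> xz b _; rewrite -(notB _ _ xB lC b).
Qed.

(** Sum [rooms_through_index] over [C]: by [card_redundant] two indices are redundant for the lowest
    points of a nonempty [D], so the door has two rooms. For empty [D] and a single index, the only
    room is the greatest point of that order. *)
Lemma odd_rooms_of_door (x1 : X) D C : dominant D C -> #|C| = #|D|.+1 ->
  odd (\sum_(x | x \notin D) room (x |: D) C + \sum_(k in C) room D (C :\ k)) =
  (D == set0).
Proof.
move=> dom card.
have E1 : \sum_(k in C) room D (C :\ k) = \sum_(k in C) dominant D (C :\ k).
  apply: eq_bigr => k kC; rewrite /room; congr nat_of_bool.
  rewrite [#|C :\ k|](_ : _ = #|D|) ?eqxx ?andbT //.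
  by move: (cardsD1 k C); rewrite kC card => -[].
have E2 : \sum_(x | x \notin D) room (x |: D) C =
          \sum_(x | x \notin D) dominant (x |: D) C.
  by apply: eq_bigr => x xD; rewrite /room cardsU1 xD card eqxx andbT.
rewrite {}E1 {}E2.
have [D0|/set0Pn[x0 x0D]] := eqVneq D set0.
  move: card; rewrite {}D0 cards0 => /eqP/cards1P[k ->]; rewrite big_set1 setDv.
  have -> : dominant set0 (set0 : {set I}) = false.
    by apply/negP => /dominantP /(_ x1)[i]; rewrite inE.
  rewrite addn0; pose m := [arg max_(z > x1) key k z].
  have mmax z : key k z <= key k m by rewrite /m; case: arg_maxnP => // i _; exact.
  rewrite (bigD1 m) ?inE //= big1 => [|z /andP[_ zm]].
    rewrite addn0 (_ : dominant _ _) //; apply/dominantP => z; exists k; rewrite ?inE //.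
    by apply/forall_inP => d; rewrite !inE orbF => /eqP ->.
  apply/eqP; rewrite eqb0; apply/negP => /dominantP/(_ m)[i]; rewrite inE => /eqP ->.
  move=> /forall_inP/(_ z); rewrite !inE eqxx => /(_ isT) mz.
  by case/eqP: zm; apply: (@key_inj k); apply/eqP; rewrite eqn_leq mmax.
(* Each room [x |: D] is counted once on the right, at the unique index for which [x] is lowest. *)
have -> : \sum_(x | x \notin D) dominant (x |: D) C =
    \sum_(k in C) #|[set x | [&& x \notin D, dominant (x |: D) C & below k x D]]|.
  under [RHS]eq_bigr => k kC do rewrite -sum1_card.
  rewrite (exchange_big_dep (fun x => x \notin D)) /=; last first.
    by move=> k x _; rewrite inE => /and3P[].
  apply: eq_bigr => x xD; case: (boolP (dominant _ _)) => dx; last first.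
    by rewrite big1 // => i; rewrite inE xD (negbTE dx) /= andbF.
  have /dominantP/(_ x)[k kC] := dx; rewrite below_setU1 leqnn /= => bk.
  rewrite (bigD1 k) /=; last by rewrite kC inE xD dx.
  rewrite big1 // => l /andP[/andP[lC]]; rewrite inE => /and3P[_ _ bl] /eqP[].
  have rm : room (x |: D) C by rewrite /room dx cardsU1 xD card eqxx.
  by apply: (room_lowest_inj (x := x) rm) => //; rewrite ?setU11 // below_setU1 leqnn.
rewrite addnC -big_split /=.
under eq_bigr => k kC do rewrite (rooms_through_index x0D dom card kC).
have := @card_redundant _ _ (lowest x0 D) C.
by rewrite sum_mem_card lowest_imset // => ->.
Qed.

Variables (c : X -> I) (i0 : I).

(** Only the colour condition of a door; dominance and [#|C| = #|D|.+1] are inherited from the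
    adjacent rooms. *)
Definition door D C := (i0 \in C) && (c @: D == C :\ i0).

(** Put [E := C :\ i0] with [i0] in [C]. If [c] is injective on [D] with image [k0 |: E], removing
    the preimage of [k0] gives one door, and adding [k0] to [C] gives a second one unless [k0 = i0],
    the rainbow case. If the image is [E], [card_redundant] gives two removals; if it misses part of
    [E], there is no door. For [i0] outside [C], only adding [i0] can give a door, and it does so
    exactly in the rainbow case. *)
Lemma odd_doors_of_room D C : #|D| = #|C| ->
  odd (\sum_(x in D) door (D :\ x) C + \sum_(k | k \notin C) door D (k |: C)) =
  (c @: D == C).
Proof.
move=> card; case: (boolP (i0 \in C)) => iC; last first.
  rewrite big1 => [|x xD]; last by rewrite /door (negbTE iC).
  rewrite add0n (bigD1 i0) //= big1 => [|k /andP[kC ki]].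
    by rewrite /door setU11 setU1K // addn0 oddb.
  by rewrite /door !inE eq_sym (negbTE ki) (negbTE iC).
rewrite /door iC /=; set E := C :\ i0.
have cE : #|C| = #|E|.+1 by rewrite (cardsD1 i0) iC.
have iE : i0 \notin E by rewrite !inE eqxx.
have EC : i0 |: E = C by rewrite setD1K.
have -> : \sum_(k | k \notin C) ((i0 \in k |: C) && (c @: D == (k |: C) :\ i0)) =
          \sum_(k | k \notin C) (c @: D == k |: E).
  apply: eq_bigr => k kC; rewrite setU1r //=; congr (nat_of_bool (_ == _)).
  apply/setP => j; rewrite !inE; have [->|] := eqVneq j k => //=.
  by rewrite andbT; apply: contraNneq kC => ->.
case: (boolP (E \subset c @: D)) => [sE|nsE]; last first.
  rewrite !big1; first by apply/esym/negbTE; apply: contraNneq nsE => ->; rewrite subD1set.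
  - by move=> k _; apply/eqP; rewrite eqb0; apply: contraNneq nsE => ->; rewrite subsetUr.
  - move=> x _; apply/eqP; rewrite eqb0; apply: contraNneq nsE => <-.
    by rewrite imsetS ?subD1set.
have := leq_imset_card c D; rewrite card cE leq_eqVlt ltnS => /orP[/eqP full|le].
  have /imset_injP inj : #|c @: D| == #|D| by rewrite full card cE.
  have [k0 k0D] : exists k0, k0 \in c @: D :\: E.
    apply/set0Pn; rewrite setD_eq0; apply/negP => /subset_leq_card.
    by rewrite full ltnn.
  have kE : k0 \notin E by move: k0D; rewrite inE => /andP[].
  have cDE : c @: D = k0 |: E.
    apply/esym/eqP; rewrite eqEcard cardsU1 kE full leqnn andbT subUset sE andbT sub1set.
    by move: k0D; rewrite inE => /andP[].
  have kD : k0 \in c @: D by rewrite cDE setU11.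
  have E1 : \sum_(x in D) (c @: (D :\ x) == E) = 1.
    have /imsetP[y yD ky] := kD.
    have img : c @: (D :\ y) = E.
      apply/setP => j; apply/imsetP/idP => [[x]|jE].
        rewrite !inE => /andP[xy xD] ->; have := imset_f c xD; rewrite cDE !inE.
        case/orP=> // /eqP; rewrite ky => /inj; rewrite xD yD => /(_ isT isT) E'.
        by rewrite E' eqxx in xy.
      have /imsetP[x xD jx] : j \in c @: D by rewrite cDE setU1r.
      exists x => //; rewrite !inE xD andbT; apply: contraNneq kE => xy.
      by rewrite ky -xy -jx.
    rewrite (bigD1 y) //= img eqxx big1 // => x /andP[xD xy].
    apply/eqP; rewrite eqb0; apply/negP => /eqP h; move/negP: kE; apply; rewrite -h ky.
    by apply: imset_f; rewrite !inE eq_sym xy.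
  rewrite E1 cDE -EC; have [k0i|k0i] := eqVneq k0 i0.
    rewrite k0i eqxx big1 // => k; rewrite EC => kC; apply/eqP; rewrite eqb0; apply/eqP => h.
    by move/negP: kC; apply; rewrite h setU11.
  have kC : k0 \notin C by rewrite -EC in_setU1 (negbTE k0i) (negbTE kE).
  rewrite (bigD1 k0) ?EC //= eqxx big1 => [|k /andP[kC' kk]].
    by apply/esym/negbTE; apply: contraNneq kC => <-; rewrite setU11.
  apply/eqP; rewrite eqb0; apply: contraNneq kk => h.
  have : k \in k0 |: E by rewrite h setU11.
  have : k \notin E by apply: contra kC' => kE'; rewrite -EC setU1r.
  by rewrite in_setU1 => /negbTE ->; rewrite orbF.
have cDE : c @: D = E by apply/esym/eqP; rewrite eqEcard sE.
have -> : \sum_(k | k \notin C) (c @: D == k |: E) = 0.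
  rewrite big1 // => k kC; apply/eqP; rewrite eqb0 cDE; apply/negP => /eqP h.
  move/negP: kC; apply; have : k \in E by rewrite h setU11.
  by rewrite !inE => /andP[].
have := @card_redundant _ _ c D; rewrite cDE card cE => /(_ erefl) c2.
rewrite addn0 sum_mem_card c2; apply/esym/negbTE/eqP => /esym CE.
by move: iE; rewrite -CE iC.
Qed.

Lemma odd_sum (J : finType) (F G : J -> nat) : (forall j, odd (F j) = odd (G j)) ->
  odd (\sum_j F j) = odd (\sum_j G j).
Proof. by move=> FG; rewrite !(big_morph odd oddD erefl); apply: eq_bigr => j _. Qed.

(** Count incidences of rooms and doors modulo two. By rooms, the count has the parity of the number
    [N] of rainbow rooms. By doors, those with nonempty [D] contribute evenly, and the only one with
    empty [D] is [C = [set i0]]. So [N] is odd. The point [x1] rules out the empty room. *)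
Theorem rainbow_room (x1 : X) : exists D C, [/\ room D C, c @: D = C & D != set0].
Proof.
pose N := \sum_(D : {set X}) \sum_(C : {set I}) room D C * (c @: D == C).
suff : odd N.
  have [/existsP[D /existsP[C /andP[rm /eqP cD]]] _|no] :=
    boolP [exists D : {set X}, exists C, room D C && (c @: D == C)].
    exists D, C; split=> //; apply/negP => /eqP D0.
    move: rm; rewrite -cD D0 imset0 => /andP[/dominantP/(_ x1)[i]].
    by rewrite inE.
  rewrite (_ : N = 0) // /N big1 // => D _; rewrite big1 // => C _.
  apply/eqP; rewrite mulnb eqb0; apply: contra no => h.
  by apply/existsP; exists D; apply/existsP; exists C.
pose S := \sum_(D : {set X}) \sum_(C : {set I}) room D C *
  (\sum_(x in D) door (D :\ x) C + \sum_(k | k \notin C) door D (k |: C)).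
have -> : odd N = odd S.
  apply: odd_sum => D; apply: odd_sum => C; rewrite !oddM.
  case: (boolP (room D C)) => //= /andP[_ /eqP card].
  by rewrite odd_doors_of_room // oddb.
have -> : S = \sum_(D : {set X}) \sum_(C : {set I}) door D C *
  (\sum_(x | x \notin D) room (x |: D) C + \sum_(k in C) room D (C :\ k)).
  rewrite /S; under eq_bigr => D _ do under eq_bigr => C _ do rewrite mulnDr.
  under [RHS]eq_bigr => D _ do under eq_bigr => C _ do rewrite mulnDr.
  under eq_bigr => D _ do rewrite big_split; under [RHS]eq_bigr => D _ do rewrite big_split.
  rewrite !big_split; congr (_ + _).
    rewrite exchange_big [RHS]exchange_big /=; apply: eq_bigr => C _.
    under eq_bigr => D _ do rewrite big_distrr.
    rewrite (sum_setD1 (fun D D' => room D' C * door D C)).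
    by apply: eq_bigr => D _; rewrite big_distrr; apply: eq_bigr => x _; rewrite mulnC.
  apply: eq_bigr => D _.
  under eq_bigr => C _ do rewrite big_distrr.
  rewrite -(sum_setD1 (fun C C' => room D C * door D C')).
  by apply: eq_bigr => C _; rewrite big_distrr; apply: eq_bigr => k _; rewrite mulnC.
pose P D C := [&& door D C, dominant D C & #|C| == #|D|.+1].
have -> : odd (\sum_(D : {set X}) \sum_(C : {set I}) door D C *
    (\sum_(x | x \notin D) room (x |: D) C + \sum_(k in C) room D (C :\ k))) =
  odd (\sum_(D : {set X}) \sum_(C : {set I}) (P D C && (D == set0))).
  apply: odd_sum => D; apply: odd_sum => C; rewrite oddM !oddb /P.
  case: (boolP (door D C)) => //= _; case: (boolP (dominant D C && _)) => [/andP[dom /eqP cd]|h].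
    by rewrite -(odd_rooms_of_door x1 dom cd).
  rewrite !big1 // => [k kC|x xD]; apply/eqP; rewrite eqb0; apply: contra h => /andP[dom /eqP cd].
    by rewrite -[C](setD1K kC) dominantU1 //= cardsU1 !inE eqxx cd /=.
  by rewrite -[D](setU1K xD) dominantD1 //= setU1K // -cd cardsU1 xD.
rewrite (bigD1 set0) //= [X in _ + X]big1 => [|D /negbTE D0]; last first.
  by rewrite big1 // => C _; rewrite D0 andbF.
rewrite addn0 (bigD1 [set i0]) //= big1 => [|C /negbTE Ci].
  rewrite addn0 eqxx andbT /P /door set11 setDv imset0 eqxx cards1 cards0 eqxx andbT /=.
  rewrite oddb andbT; apply/dominantP => x; exists i0; rewrite ?set11 //.
  by apply/forall_inP => d; rewrite inE.
rewrite eqxx andbT /P /door imset0.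
case: (boolP (i0 \in C)) => //= iC; case: eqP => //= /esym/eqP.
by rewrite setD_eq0 subset1 Ci /= => /eqP C0; rewrite C0 inE in iC.
Qed.

End Rooms.

(** * Rainbow rooms of the grid points of a simplex *)

Lemma ltn_radix (q a b r s : nat) : r < q -> a < b -> a * q + r < b * q + s.
Proof. by move=> rq ab; have := leq_mul ab (leqnn q); rewrite mulSn; lia. Qed.

(** [m] collects the lowest coordinates of a rainbow room. By dominance the sum of [(m k).+1] over
    [C] exceeds [n], whereas the coordinates of each point sum to [n]. So a point of the room
    exceeds [m] by less than [#|C|] in total, coordinates outside [C] included. *)
Lemma small_rainbow (I : finType) (i0 : I) (n : nat) (c : {ffun I -> 'I_n.+1} -> I) :
  exists (C : {set I}) (m : I -> nat) (x : I -> {ffun I -> 'I_n.+1}),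
    [/\ forall k, k \notin C -> m k = 0, forall i, i \in C -> c (x i) = i,
        forall i, \sum_k x i k = n & forall i k, m k <= x i k < m k + #|I|].
Proof.
pose X : finType := {x : {ffun I -> 'I_n.+1} | \sum_k x k == n}.
(* Coordinate [k] decides first and the enumeration rank breaks ties, so the order is injective. *)
pose key (k : I) (x : X) := val x k * #|X| + enum_rank x.
have key_lt k (x y : X) : val x k < val y k -> key k x < key k y.
  by move=> xy; apply: ltn_radix.
have key_inj k : injective (key k).
  move=> x y xy; have xyk : val x k = val y k :> nat.
    by apply/eqP; case: ltngtP => // /key_lt; rewrite xy ltnn.
  by apply/enum_rank_inj/val_inj; move: xy; rewrite /key xyk => /addnI.
have x1 : X.
  exists [ffun k => if k == i0 then ord_max else ord0]; apply/eqP.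
  by rewrite (bigD1 i0) //= ffunE eqxx big1 ?addn0 // => k /negbTE ki; rewrite ffunE ki.
have [D [C [rm cD /set0Pn[d0 d0D]]]] := rainbow_room key_inj (c \o val) i0 x1.
have /andP[dom /eqP card] := rm.
pose m k := val (lowest key d0 D k) k : nat.
have mD d k : d \in D -> m k <= val d k.
  move=> dD; rewrite leqNgt; apply/negP => /key_lt.
  by have [_ /forall_inP/(_ d dD)] := lowestP key k d0D; rewrite leqNgt => /negP.
(* Otherwise some grid point exceeds every lowest coordinate m k, k in C. *)
have mn : n < \sum_(k in C) (m k).+1.
  rewrite ltnNge; apply/negP => le.
  have [k0 k0C] : exists k0, k0 \in C.
    by have /dominantP/(_ x1)[k kC _] := dom; exists k.
  pose f k := if k == k0 then n - \sum_(k in C | k != k0) (m k).+1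
              else if k \in C then (m k).+1 else 0.
  have fn : \sum_k f k = n.
    rewrite (bigD1 k0) //= {1}/f eqxx.
    have -> : \sum_(k | k != k0) f k = \sum_(k in C | k != k0) (m k).+1.
      rewrite big_mkcond [RHS]big_mkcond; apply: eq_bigr => k _; rewrite /f.
      by case: eqVneq; case: (k \in C).
    by rewrite subnK //; move: le; rewrite (bigD1 k0) //=; lia.
  have fS k : k \in C -> m k < f k.
    move=> kC; rewrite /f kC; case: eqVneq => // ->.
    by move: le; rewrite (bigD1 k0) //=; lia.
  have fle k : f k < n.+1 by rewrite ltnS -fn (bigD1 k) //= leq_addr.
  pose y0 : {ffun I -> 'I_n.+1} := [ffun k => Ordinal (fle k)].
  have yP : \sum_k y0 k == n.
    by apply/eqP; rewrite -[RHS]fn; apply: eq_bigr => k _; rewrite ffunE.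
  pose y : X := Sub y0 yP.
  have /dominantP/(_ y)[k kC /forall_inP b] := dom.
  have [lD _] := lowestP key k d0D; have := b _ lD; rewrite leqNgt => /negP; apply.
  by apply: key_lt; rewrite SubK ffunE; exact: fS.
have bound d k : d \in D -> (if k \in C then m k else 0) <= val d k <
    (if k \in C then m k else 0) + #|I|.
  move=> dD; have dn := eqP (valP d); apply/andP; split.
    by case: ifP => // _; exact: mD.
  have CI : #|C| <= #|I| := max_card (mem C).
  have sp : \sum_(k in C) (val d k - m k) + \sum_(k in C) m k +
      \sum_(k | k \notin C) val d k = n.
    rewrite -[RHS]dn [RHS](bigID (mem C)) -big_split /=; congr (_ + _).
    by apply: eq_bigr => j jC; rewrite subnK // mD.
  move: mn; under eq_bigr => j _ do rewrite -addn1.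
  rewrite big_split sum1_card /= => mn.
  case: ifPn => kC.
    have : val d k - m k <= \sum_(k in C) (val d k - m k) by rewrite (bigD1 k) //= leq_addr.
    move: (mD d k dD) mn CI sp; move: (\sum_(k in C) (val d k - m k)) => a.
    move: (\sum_(k in C) m k) (\sum_(k | k \notin C) val d k) => b e.
    by move: (m k) (val d k : nat) #|C| #|I| => p q r s; lia.
  have : val d k <= \sum_(k | k \notin C) val d k by rewrite (bigD1 k) //= leq_addr.
  move: mn CI sp; move: (\sum_(k in C) (val d k - m k)) => a.
  move: (\sum_(k in C) m k) (\sum_(k | k \notin C) val d k) => b e.
  by move: (val d k : nat) #|C| #|I| => q r s; lia.
(* For [i] outside [C] the value is the arbitrary point [d0]: it still lies in the room, so the size
   bounds hold for all [i]. *)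
pose pt i : X := odflt d0 [pick d in D | c (val d) == i].
have ptD i : pt i \in D by rewrite /pt; case: pickP => [d /andP[]|].
exists C, (fun k => if k \in C then m k else 0), (fun i => val (pt i)); split.
- by move=> k /negbTE ->.
- move=> i; rewrite -cD => /imsetP[d dD id]; rewrite /pt.
  by case: pickP => [d' /andP[_ /eqP]|/(_ d)] //=; rewrite dD id eqxx.
- by move=> i; exact: eqP (valP (pt i)).
- by move=> i k; exact: bound.
Qed.

From mathcomp Require Import all_boot all_order all_algebra.
From mathcomp Require Import all_classical all_reals all_analysis.
From mathcomp Require Import measurable_realfun.
From mathcomp Require Import lra ring.

Import Order.TTheory GRing.Theory Num.Theory.
Import numFieldTopology.Exports numFieldNormedType.Exports.

Local Open Scope classical_set_scope.
Local Open Scope ring_scope.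

(** * Zeros of coercive maps *)

Section Compact.
Variable R : realType.

Lemma continuous_sum (T : topologicalType) (J : finType) (P : pred J) (F : J -> T -> R) :
  (forall j, P j -> continuous (F j)) -> continuous (fun x => \sum_(j | P j) F j x).
Proof. by move=> cF; apply: continuous_big => //; exact: add_continuous. Qed.

Lemma continuous_coord (J : eqType) (j : J) : continuous (fun x : {ptws J -> R} => x j).
Proof. exact: (@proj_continuous J (fun=> R) j). Qed.

Lemma continuous_ptws (T : topologicalType) (J : eqType) (f : T -> {ptws J -> R}) :
  (forall j, continuous (fun x => f x j)) -> continuous f.
Proof.
move=> cf x; apply/cvg_sup => j; apply/cvg_image.
  by apply/seteqP; split=> // y _; exists (fun=> y).
move=> A /cf nA; exists [set g : J -> R | A (g j)] => //.
apply/seteqP; split=> [_ [g ? <-]//|y Ay].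
by exists (fun=> y).
Qed.

Lemma box_compact (J : eqType) (B : R) :
  compact [set x : {ptws J -> R} | forall j, `|x j| <= B].
Proof.
have := @tychonoff J (fun=> R) (fun=> [set` `[- B, B]]) (fun=> @segment_compact R _ _).
congr compact; apply/seteqP; split=> x /= h j; have := h j; by rewrite /= in_itv /= ler_norml.
Qed.

(** The sum of the [|h j|] attains its minimum on [A], and approximate zeros push this minimum below
    every positive number. Grid refinement and both limits in [eps] and [eta] go through this
    lemma. *)
Lemma compact_common_zero (T : topologicalType) (J : finType) (A : set T) (h : J -> T -> R) :
  compact A -> (forall j, continuous (h j)) ->
  (forall e, 0 < e -> exists2 x, A x & forall j, `|h j x| <= e) ->
  exists2 x, A x & forall j, h j x = 0.
Proof.
move=> cA ch approx; pose f x := \sum_j `|h j x|.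
have cf : continuous f.
  apply: continuous_sum => j _ x; apply: continuous_comp; first exact: ch.
  exact: norm_continuous.
have A0 : A !=set0 by have [x Ax _] := approx 1 ltr01; exists x.
have [x /set_mem Ax xmin] := compact_EVT_min A0 cA (continuous_subspaceT cf).
have f0 : f x = 0.
  apply/eqP; rewrite eq_le sumr_ge0 ?andbT => [|j _]; last exact: normr_ge0.
  rewrite leNgt; apply/negP => fx.
  (* One more than [#|J|], so that the total of the bounds stays strictly below the minimum. *)
  have e0 : 0 < f x / (#|J|.+1)%:R by rewrite divr_gt0 ?ltr0n.
  have [y Ay hy] := approx _ e0; have := xmin y (mem_set Ay); rewrite leNgt => /negP; apply.
  have : f y <= \sum_(j in J) f x / (#|J|.+1)%:R by exact: ler_sum.
  move=> /le_lt_trans; apply; rewrite sumr_const -[X in X < _]mulr_natr mulrAC.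
  by rewrite ltr_pdivrMr ?ltr0n // ltr_pM2l // ltr_nat.
exists x => // j; apply/eqP; rewrite -normr_eq0; move/eqP: f0.
rewrite psumr_eq0 => [|i _]; last exact: normr_ge0.
by move=> /allP/(_ j (mem_index_enum j)).
Qed.

Lemma continuous_comp_ptws (T : topologicalType) (J : eqType) (G : {ptws J -> R} -> R)
    (f : T -> {ptws J -> R}) :
  continuous G -> (forall j, continuous (fun x => f x j)) -> continuous (G \o f).
Proof. by move=> cG cf x; apply: continuous_comp; [exact: continuous_ptws | exact: cG]. Qed.

Lemma continuous_norm_comp (T : topologicalType) (f : T -> R) :
  continuous f -> continuous (fun x => `|f x|).
Proof. by move=> cf x; apply: continuous_comp; [exact: cf | exact: norm_continuous]. Qed.

Section Arithmetic.
Variables (T : topologicalType) (f g : T -> R).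
Hypotheses (cf : continuous f) (cg : continuous g).

Lemma continuous_funD : continuous (fun x => f x + g x).
Proof. by move=> x; apply: continuousD; [exact: cf|exact: cg]. Qed.

Lemma continuous_funN : continuous (fun x => - f x).
Proof. by move=> x; apply: continuousN; exact: cf. Qed.

Lemma continuous_funM : continuous (fun x => f x * g x).
Proof. by move=> x; apply: continuousM; [exact: cf|exact: cg]. Qed.

Lemma continuous_funV : (forall x, f x != 0) -> continuous (fun x => (f x)^-1).
Proof. by move=> f0 x; apply: continuousV; [exact: f0|exact: cf]. Qed.

Lemma continuous_funmax : continuous (fun x => Num.max (f x) (g x)).
Proof. by move=> x; apply: (@continuous_max R T f g); [exact: cf|exact: cg]. Qed.

Lemma continuous_funmin : continuous (fun x => Num.min (f x) (g x)).
Proof. by move=> x; apply: (@continuous_min R T f g); [exact: cf|exact: cg]. Qed.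

End Arithmetic.

Lemma continuous_funcst (T : topologicalType) (r : R) : continuous (fun _ : T => r).
Proof. by move=> x; exact: cst_continuous. Qed.

(** * Variational inequality on the standard simplex *)

Section VariationalInequality.
Variables (I : finType) (i0 : I) (G : I -> {ptws I -> R} -> R).
Hypothesis cG : forall i, continuous (G i).

Let approx (C : {set I}) (e : R) := exists W : I -> I -> R,
  [/\ forall i k, 0 <= W i k, forall i, \sum_k W i k = 1,
      forall i j k, `|W i k - W j k| <= e, forall i k, k \notin C -> W i k <= e
    & forall i j, i \in C -> G i (W i) <= G j (W i)].

Let approx_grid (n : nat) : exists C, approx C (#|I|%:R / n.+1%:R).
Proof.
(* The grid has mesh [1 / n.+1], never a division by zero. A point gets as colour an index
   minimizing [G] there. *)
pose pt (x : {ffun I -> 'I_n.+2}) : {ptws I -> R} := fun k => (x k)%:R / n.+1%:R.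
pose c x := [arg min_(i < i0) G i (pt x)]%O.
have [C [m [x [mC cx sx bx]]]] := small_rainbow i0 c.
have n0 : 0 < n.+1%:R :> R by rewrite ltr0n.
exists C, (fun i => pt (x i)); split.
- by move=> i k; rewrite divr_ge0.
- by move=> i; rewrite -mulr_suml -natr_sum sx divff // gt_eqF.
- move=> i j k; rewrite /pt /= -mulrBl normrM [X in _ * X]ger0_norm ?invr_ge0 ?ler0n //.
  rewrite ler_pM2r ?invr_gt0 //; have /andP[a1 a2] := bx i k; have /andP[b1 b2] := bx j k.
  rewrite ler_norml; move: a1 a2 b1 b2; rewrite -!(ltr_nat R) -!(ler_nat R) !natrD.
  by move=> *; apply/andP; split; lra.
- move=> i k kC; rewrite /pt /= ler_pM2r ?invr_gt0 // ler_nat ltnW //.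
  by have /andP[_] := bx i k; rewrite mC.
- move=> i j iC; rewrite -{1}(cx i iC) /c; case: (@Order.TotalTheory.arg_minP) => // k _; exact.
Qed.

(** There are finitely many sets [C]: if each failed at some [N C], a grid finer than all of these
    would contradict [approx_grid], as [approx] is monotone in the tolerance. *)
Let approx_fixed : exists C, forall n, approx C (#|I|%:R / n.+1%:R).
Proof.
apply: contrapT => /forallNP no.
have {no} /choice[N hN] : forall C, exists n, ~ approx C (#|I|%:R / n.+1%:R).
  by move=> C; apply/existsNP; exact: no.
have [C aC] := approx_grid (\max_C N C)%N.
apply: (hN C); have [W [W0 W1 W2 W3 W4]] := aC.
have le : #|I|%:R / (\max_C N C)%N.+1%:R <= #|I|%:R / (N C).+1%:R :> R.
  rewrite ler_wpM2l // lef_pV2 ?posrE ?ltr0n // ler_nat ltnS.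
  exact: leq_bigmax.
exists W; split=> // [i j k|i k kC]; first exact: le_trans le.
by apply: le_trans le; exact: W3.
Qed.

(** Complementarity form of the Hartman-Stampacchia inequality: [w] puts mass only on indices
    minimizing [G]. In the limit all points of the rainbow room coincide; each index of [C] is a
    minimizer at its own point, and no mass is left outside [C]. *)
Lemma simplex_variational_inequality : exists w : {ptws I -> R},
  [/\ forall i, 0 <= w i, \sum_i w i = 1 & forall i j, w i != 0 -> G i w <= G j w].
Proof.
have [C aC] := approx_fixed.
pose row (W : {ptws I * I -> R}) i : {ptws I -> R} := fun k => W (i, k).
(* Each summand is the nonnegative defect of one limit condition: equal rows, minimality on [C], no
   mass outside [C], total mass one, nonnegative weights. *)
pose h (t : I * I * I) (W : {ptws I * I -> R}) : R :=
  `|row W t.1.1 t.2 - row W t.1.2 t.2|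
  + (t.1.1 \in C)%:R * Num.max (G t.1.1 (row W t.1.1) - G t.1.2 (row W t.1.1)) 0
  + (t.2 \notin C)%:R * `|row W t.1.1 t.2| + `|\sum_k row W t.1.1 k - 1|
  + Num.max (- row W t.1.1 t.2) 0.
have crow i k : continuous (fun W : {ptws I * I -> R} => row W i k) := @continuous_coord _ (i, k).
have cGrow i j : continuous (fun W : {ptws I * I -> R} => G i (row W j)).
  exact: (continuous_comp_ptws (@cG i) (crow j)).
have ch t : continuous (h t).
  have c0 := @continuous_funcst {ptws I * I -> R}.
  apply: continuous_funD; last by apply: continuous_funmax => //; apply: continuous_funN; exact: crow.
  apply: continuous_funD; last first.
    apply: continuous_norm_comp; apply: continuous_funD => //.
    by apply: continuous_sum => k _; exact: crow.
  apply: continuous_funD; last first.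
    by apply: continuous_funM => //; apply: continuous_norm_comp; exact: crow.
  apply: continuous_funD.
    apply: continuous_norm_comp; apply: continuous_funD; first exact: crow.
    by apply: continuous_funN; exact: crow.
  apply: continuous_funM => //; apply: continuous_funmax => //.
  by apply: continuous_funD; [exact: cGrow|apply: continuous_funN; exact: cGrow].
have app e : 0 < e -> exists2 W : {ptws I * I -> R},
    (forall p, `|W p| <= 1) & forall t, `|h t W| <= e.
  move=> e0; have N0 : 0 <= #|I|%:R :> R by [].
  have [n hn] : exists n, #|I|%:R / n.+1%:R <= e / 2 :> R.
    exists (Num.truncn (#|I|%:R / (e / 2))).
    rewrite ler_pdivrMr ?ltr0n // mulrC -ler_pdivrMr ?divr_gt0 //.
    by apply: ltW; exact: truncnS_gt.
  have [W [W0 W1 W2 W3 W4]] := aC n.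
  exists (fun p => W p.1 p.2) => [[i k]/=|[[i j] k]].
    rewrite ger0_norm // -(W1 i) (bigD1 k) //= lerDl; exact: sumr_ge0.
  rewrite /h /row /= W1 subrr normr0 addr0.
  have -> : Num.max (- W i k) 0 = 0 by apply/max_idPr; rewrite oppr_le0.
  have -> : (i \in C)%:R * Num.max (G i (W i) - G j (W i)) 0 = 0.
    case: (boolP (i \in C)) => iC; last by rewrite mul0r.
    by rewrite mul1r; apply/max_idPr; rewrite subr_le0 W4.
  rewrite !addr0 ger0_norm ?addr_ge0 ?mulr_ge0 //.
  have a1 := le_trans (W2 i j k) hn.
  suff a2 : (k \notin C)%:R * `|W i k| <= e / 2 by lra.
  case: (boolP (k \in C)) => kC; first by rewrite mul0r divr_ge0 ?ltW.
  by rewrite mul1r ger0_norm //; exact: le_trans (W3 _ _ kC) hn.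
have [W _ hW] := compact_common_zero (@box_compact _ 1) ch app.
have z1 (a b : R) : 0 <= a -> 0 <= b -> a + b = 0 -> a = 0 /\ b = 0 by move=> *; split; lra.
have facts i j k : [/\ row W i k = row W j k,
    i \in C -> G i (row W i) <= G j (row W i), k \notin C -> row W i k = 0,
    \sum_k row W i k = 1 & 0 <= row W i k].
  have := hW (i, j, k); rewrite /h /=.
  set a := `|_|; set b := _ * _; set c := _ * _; set d := `|_|; set e := Num.max _ _.
  have a0 : 0 <= a by rewrite /a.
  have b0 : 0 <= b by rewrite mulr_ge0 // le_max lexx orbT.
  have c0 : 0 <= c by rewrite mulr_ge0.
  have d0 : 0 <= d by rewrite /d.
  have e0 : 0 <= e by rewrite /e le_max lexx orbT.
  move=> H; have az : a = 0 by lra. have bz : b = 0 by lra. have cz : c = 0 by lra.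
  have dz : d = 0 by lra. have ez : e = 0 by lra.
  split.
  - by apply/eqP; rewrite -subr_eq0; apply/eqP/normr0_eq0.
  - move=> iC; move: bz; rewrite /b iC mul1r => bz.
    by rewrite -subr_le0 -bz le_max lexx.
  - by move=> kC; move: cz; rewrite /c kC mul1r => /normr0_eq0.
  - by apply/eqP; rewrite -subr_eq0; apply/eqP/normr0_eq0.
  - by rewrite -oppr_le0 -ez le_max lexx.
exists (row W i0); split.
- by move=> i; have [] := facts i0 i0 i.
- by have [] := facts i0 i0 i0.
- move=> i j wi; have iC : i \in C.
    by apply: contraNT wi => iC; have [_ _ /(_ iC) ->] := facts i0 i0 i.
  have <- : row W i = row W i0 by apply/funext => k; have [] := facts i i0 k.
  by have [_ /(_ iC)] := facts i j i0.
Qed.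

End VariationalInequality.

Theorem coercive_zero (I : finType) (F : I -> {ptws I -> R} -> R) (B : R) :
  0 < B -> (forall i, continuous (F i)) ->
  (forall x, \sum_i F i x * x i <= 0 -> forall i, `|x i| < B) ->
  exists x, forall i, F i x = 0.
Proof.
move=> B0 cF coer.
(* X maps the standard simplex onto a simplex of R^I containing the cube of
   radius B; the inequality tested at the preimage y of 0 gives the hypothesis
   of coercivity, so that the solution is an interior point. *)
pose L := (#|I|%:R *+ 2 + 1) * B.
have L0 : 0 < L by rewrite mulr_gt0 // ltr_wpDl // mulrn_wge0.
pose X (w : {ptws option I -> R}) : {ptws I -> R} := fun i => L * w (Some i) - B.
pose G j : {ptws option I -> R} -> R := if j is Some i then F i \o X else cst 0.
have cG j : continuous (G j).
  case: j => [i|]; last exact: cst_continuous.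
  apply: continuous_comp_ptws => // k; apply: continuous_funD; last exact: continuous_funcst.
  by apply: continuous_funM; [exact: continuous_funcst | exact: continuous_coord].
have [w [w0 w1 wG]] := simplex_variational_inequality None cG.
have sOpt (f : option I -> R) : \sum_j f j = f None + \sum_i f (Some i).
  rewrite (bigD1 None) //=; congr (_ + _).
  rewrite (reindex_omap (@Some I) id) //=; first by apply: eq_bigl => i; rewrite /= eqxx.
  by case.
pose y (j : option I) := if j is Some _ then B / L else 1 - #|I|%:R * (B / L).
have BL : 0 < B / L by rewrite divr_gt0.
have y0 j : 0 <= y j.
  case: j => [_|] /=; first exact: ltW.
  rewrite subr_ge0 mulrA ler_pdivrMr // mul1r /L ler_pM2r // mulr2n.
  by have : 0 <= #|I|%:R :> R by []; lra.
have y1 : \sum_j y j = 1.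
  rewrite sOpt /= sumr_const -[X in _ + X = _]mulr_natl; exact: subrK.
have VI : \sum_j w j * G j w <= \sum_j y j * G j w.
  have -> : \sum_j w j * G j w = \sum_j \sum_k w j * y k * G j w.
    by apply: eq_bigr => j _; rewrite -mulr_suml -mulr_sumr y1 mulr1.
  have -> : \sum_j y j * G j w = \sum_j \sum_k w j * y k * G k w.
    by rewrite exchange_big; apply: eq_bigr => k _ /=; rewrite -mulr_suml -mulr_suml w1 mul1r.
  apply: ler_sum => j _; apply: ler_sum => k _.
  have [->|wj] := eqVneq (w j) 0; first by rewrite !mul0r.
  by rewrite ler_wpM2l ?mulr_ge0 // wG.
have sm : \sum_i F i (X w) * X w i <= 0.
  move: VI; rewrite !sOpt /= !mulr0 !add0r -subr_le0 -sumrB -(pmulr_rle0 _ L0) mulr_sumr.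
  move=> h; rewrite (le_trans _ h) // le_eqVlt; apply/orP; left; apply/eqP.
  apply: eq_bigr => i _; rewrite {2}/X.
  by field; rewrite gt_eqF.
have Xb := coer _ sm.
have wS i : 0 < w (Some i) < B *+ 2 / L.
  have := Xb i; rewrite /X ltr_norml => /andP[h1 h2].
  rewrite -(pmulr_rgt0 _ L0) ltr_pdivlMr // mulrC mulr2n.
  by apply/andP; split; lra.
(* The choice of [L]: weights below [2 B / L] on all of [I] leave more than [B / L] for the slack
   vertex [None]. *)
have wN : 0 < w None.
  move: w1; rewrite sOpt => w1'; rewrite -(addrK (\sum_i w (Some i)) (w None)) w1'.
  rewrite subr_gt0; apply: (@le_lt_trans _ _ (\sum_(i in I) (B *+ 2 / L))).
    by apply: ler_sum => i _; have /andP[_ /ltW] := wS i.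
  rewrite sumr_const -[X in X < _]mulr_natl mulrA ltr_pdivrMr // mul1r /L.
  by rewrite -subr_gt0 (_ : _ - _ = B) //; ring.
(* Both [Some i] and [None] carry mass, and [G None] is 0, so comparing them in both directions
   gives both signs. *)
exists (X w) => i; apply/eqP; rewrite eq_le; have /andP[wi _] := wS i.
apply/andP; split; first by apply: (wG (Some i) None); rewrite gt_eqF.
by apply: (wG None (Some i)); rewrite gt_eqF.
Qed.

End Compact.

(** * Mean densities *)

Section Density.
Variables (R : realType) (r : R -> R) (r0 r1 : R).
Hypotheses (hr0 : 0 < r0) (hr : is_density r0 r1 r).

Lemma density_gt0 x : 0 < r x.
Proof. by have [_ _ _ /(_ x)/andP[h _]] := hr; exact: lt_le_trans h. Qed.

Lemma density_neq0 x : r x != 0.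
Proof. by rewrite gt_eqF // density_gt0. Qed.

Lemma density_continuous : continuous r.
Proof.
have [dr _ _ _] := hr => x.
by apply: differentiable_continuous; apply/derivable1_diffP; exact: dr.
Qed.

Lemma densityV_continuous : continuous (fun z => (r z)^-1).
Proof. exact: continuous_funV density_continuous density_neq0. Qed.

Local Notation J := (oriented_integral (fun z => (r z)^-1)).

Local Notation mu := lebesgue_measure.

Let integrableV a b : mu.-integrable `[a, b] (EFin \o (fun z => (r z)^-1)).
Proof.
apply: continuous_compact_integrable; first exact: segment_compact.
exact/continuous_subspaceT/densityV_continuous.
Qed.

Let J_le a b : a <= b -> (b - a) / r b <= J a b <= (b - a) / r a.
Proof.
move=> ab; rewrite /oriented_integral ab.
have [_ _ mr _] := hr.
have cstE k : (b - a) / k = \int[mu]_(z in `[a, b]) k^-1.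
  rewrite Rintegral_cst // mulrC; congr (_ * _); apply/esym.
  have -> : b - a = fine (@lebesgue_measure R `[a, b]%classic); last by [].
  by rewrite lebesgue_measure_itv /= lte_fin; case: ltgtP ab => //= -> _; rewrite subrr.
have icst k : mu.-integrable `[a, b] (EFin \o (fun=> k)).
  apply: continuous_compact_integrable; first exact: segment_compact.
  exact/continuous_subspaceT/cst_continuous.
rewrite !cstE; apply/andP; split; apply: le_Rintegral => // z /=; rewrite in_itv /= => /andP[az zb].
  by rewrite lef_pV2 ?posrE ?density_gt0 // mr.
by rewrite lef_pV2 ?posrE ?density_gt0 // mr.
Qed.

Let Jaa a : J a a = 0.
Proof. by rewrite /oriented_integral lexx set_itv1 Rintegral_set1. Qed.

Let JN a b : J b a = - J a b.
Proof.
rewrite /oriented_integral; case: (ltgtP a b) => [_|_|->]; rewrite ?opprK //.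
by rewrite set_itv1 Rintegral_set1 oppr0.
Qed.

Let J_sorted a b c : a <= b -> b <= c -> J a c = J a b + J b c.
Proof.
move=> ab bc; rewrite /oriented_integral ab bc (le_trans ab bc).
apply/eqP; rewrite addrC -subr_eq; apply/eqP.
rewrite (@Rintegral_itvB _ _ (BLeft a) (BRight c) b) ?bnd_simp //.
rewrite Rintegral_itv_obnd_cbnd //; apply: integrableS (integrableV b c) => //.
by apply: subset_itvr; rewrite bnd_simp.
Qed.

Let J_chain a b c : J a c = J a b + J b c.
Proof.
case: (leP a b) => ab; case: (leP b c) => bc; case: (leP a c) => ac.
- exact: J_sorted.
- by have := le_trans ab bc; rewrite leNgt ac.
- by rewrite (JN c b) (@J_sorted a c b) // ?ltW // addrK.
- by rewrite (JN c a) (JN c b) (@J_sorted c a b) // ?ltW // opprD addrCA subrr addr0.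
- by rewrite (@J_sorted b a c) // ?ltW // (JN b a) addKr.
- by rewrite (JN c a) (JN b a) (@J_sorted b c a) // ?ltW // opprD addrAC addNr add0r.
- by have := lt_trans bc ab; rewrite ltNge ac.
- by rewrite (JN c a) (@J_sorted c b a) // ?ltW // (JN b a) (JN c b) opprD addrC.
Qed.

(* The function g of the energy estimate, g' = 1 / r. *)
Definition pressure_transform x : R := J 0 x.
Local Notation g := pressure_transform.

Lemma pressure_transform0 : g 0 = 0. Proof. exact: Jaa. Qed.

Let JE a b : J a b = g b - g a.
Proof. by rewrite /g (J_chain 0 a b) addrC addKr. Qed.

Lemma rho_mean_sym a b : rho_mean r a b = rho_mean r b a.
Proof.
rewrite /rho_mean eq_sym; case: eqP => [->//|_].
by rewrite (JN b a) -[b - a]opprB invrN mulrNN.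
Qed.

Lemma rho_mean_bounds a b : a <= b -> r a <= rho_mean r a b <= r b.
Proof.
rewrite le_eqVlt => /orP[/eqP ->|ab]; first by rewrite /rho_mean eqxx lexx.
rewrite /rho_mean lt_eqF //; have /andP[h1 h2] := J_le (ltW ab).
have ba : 0 < b - a by rewrite subr_gt0.
have J0 : 0 < J a b by apply: lt_le_trans h1; rewrite divr_gt0 ?density_gt0.
rewrite invfM invrK ler_pdivlMr // ler_pdivrMr //; apply/andP; split.
  by move: h2; rewrite ler_pdivlMr ?density_gt0 // mulrC.
by move: h1; rewrite ler_pdivrMr ?density_gt0 // mulrC.
Qed.

Lemma rho_mean_bounds_minmax a b :
  r (Num.min a b) <= rho_mean r a b <= r (Num.max a b).
Proof.
case: (leP a b) => ab; first exact: rho_mean_bounds.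
by rewrite rho_mean_sym; exact/rho_mean_bounds/ltW.
Qed.

Lemma rho_mean_gt0 a b : 0 < rho_mean r a b.
Proof. by have /andP[h _] := rho_mean_bounds_minmax a b; exact: lt_le_trans (density_gt0 _) h. Qed.

Lemma pressure_transformB a b : (b - a) / rho_mean r a b = g b - g a.
Proof.
rewrite -JE /rho_mean; case: eqP => [->|/eqP ab]; first by rewrite subrr mul0r Jaa.
by rewrite invrK mulrA divff ?mul1r // subr_eq0 eq_sym.
Qed.

Lemma pressure_transformE x : g x = x / rho_mean r 0 x.
Proof. by have := pressure_transformB 0 x; rewrite !subr0 pressure_transform0 subr0. Qed.

(** The tangent inequality of [g] at [a]: its difference quotient is the inverse of a mean of [r]
    between [a] and [b], and [r] is increasing. *)
Lemma pressure_transform_concave a b : r a * (g b - g a) <= b - a.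
Proof.
rewrite -pressure_transformB mulrA ler_pdivrMr ?rho_mean_gt0 // [X in X <= _]mulrC.
case: (leP a b) => ab.
  by rewrite ler_wpM2l ?subr_ge0 //; have /andP[] := rho_mean_bounds ab.
rewrite ler_wnM2l ?subr_le0 ?(ltW ab) // rho_mean_sym.
by have /andP[] := rho_mean_bounds (ltW ab).
Qed.

Lemma pressure_transform_continuous : continuous g.
Proof.
move=> a; apply/cvgrPdist_le => e e0; near=> x.
rewrite -pressure_transformB normrM [X in _ * X]ger0_norm; last first.
  by rewrite invr_ge0 ltW // rho_mean_gt0.
rewrite ler_pdivrMr ?rho_mean_gt0 //; apply: (@le_trans _ _ (e * r0)).
  near: x; have /cvgrPdist_le : x @[x --> a] --> a by exact: cvg_id.
  by apply; rewrite mulr_gt0.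
rewrite ler_pM2l //; have /andP[h _] := rho_mean_bounds_minmax x a.
by apply: le_trans h; have [_ _ _ /(_ (Num.min x a))/andP[]] := hr.
Unshelve. all: by end_near. Qed.

(** Off the diagonal the mean is a quotient of continuous differences; on the diagonal it is
    squeezed between [r] of the minimum and [r] of the maximum. *)
Lemma continuous_rho_mean (T : topologicalType) (f1 f2 : T -> R) :
  continuous f1 -> continuous f2 -> continuous (fun x => rho_mean r (f1 x) (f2 x)).
Proof.
move=> c1 c2 x; have [eq12|neq12] := eqVneq (f1 x) (f2 x).
  apply: (@squeeze_cvgr _ _ _ _ (fun y => r (Num.min (f1 y) (f2 y)))
    (fun y => r (Num.max (f1 y) (f2 y)))).
  - by apply: nearW => y; exact: rho_mean_bounds_minmax.
  - have -> : rho_mean r (f1 x) (f2 x) = r (Num.min (f1 x) (f2 x)).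
      by rewrite /rho_mean eq12 eqxx minxx.
    apply: (@continuous_comp _ _ _ (fun y => Num.min (f1 y) (f2 y)) r).
      exact: continuous_funmin.
    exact: density_continuous.
  - have -> : rho_mean r (f1 x) (f2 x) = r (Num.max (f1 x) (f2 x)).
      by rewrite /rho_mean eq12 eqxx maxxx.
    apply: (@continuous_comp _ _ _ (fun y => Num.max (f1 y) (f2 y)) r).
      exact: continuous_funmax.
    exact: density_continuous.
have gE a b : a != b -> rho_mean r a b = (b - a) / (g b - g a).
  move=> ab; rewrite -pressure_transformB invfM invrK mulrA divff ?mul1r //.
  by rewrite subr_eq0 eq_sym.
have cg (f : T -> R) : continuous f -> continuous (fun y => g (f y)).
  move=> cf y; apply: (@continuous_comp _ _ _ f g); [exact: cf|].
  exact: pressure_transform_continuous.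
have cB (f f' : T -> R) : continuous f -> continuous f' -> continuous (fun y => f y - f' y).
  by move=> cf cf'; apply: continuous_funD => //; exact: continuous_funN.
rewrite /continuous_at gE //; apply: (@cvg_trans _ ((f2 y - f1 y) / (g (f2 y) - g (f1 y)) @[y --> x])).
  apply: near_eq_cvg; near=> y; rewrite gE // eq_sym -subr_eq0; near: y.
  by apply: cvgr_neq0; [exact: cB|rewrite subr_eq0 eq_sym].
apply: cvgM; first exact: cB.
apply: cvgV; last by apply: cB; exact: cg.
rewrite -pressure_transformB mulf_neq0 ?invr_eq0 ?subr_eq0 1?eq_sym //.
by rewrite eq_sym gt_eqF // rho_mean_gt0.
Unshelve. all: by end_near. Qed.

Lemma rho_mean_le a b : rho_mean r a b <= r1.
Proof.
have /andP[_ h] := rho_mean_bounds_minmax a b; apply: le_trans h _.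
by have [_ _ _ /(_ (Num.max a b))/andP[]] := hr.
Qed.

End Density.

(** * Geometry of the mesh *)

Lemma dotE (R : realType) (u v : 'cV[R]_2) :
  dot u v = u ord0 ord0 * v ord0 ord0 + u ord_max ord0 * v ord_max ord0.
Proof.
rewrite /dot mxE big_ord_recl big_ord_recl big_ord0 addr0 !mxE.
by congr (_ + u _ _ * v _ _); apply: val_inj.
Qed.

Lemma dot_mulmxE (R : realType) (A : 'M[R]_2) (u v : 'cV[R]_2) :
  dot (A *m u) v =
    A ord0 ord0 * (u ord0 ord0 * v ord0 ord0) + A ord0 ord_max * (u ord_max ord0 * v ord0 ord0)
    + A ord_max ord0 * (u ord0 ord0 * v ord_max ord0)
    + A ord_max ord_max * (u ord_max ord0 * v ord_max ord0).
Proof.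
have E i : (A *m u) i ord0 = A i ord0 * u ord0 ord0 + A i ord_max * u ord_max ord0.
  rewrite mxE big_ord_recl big_ord_recl big_ord0 addr0.
  by congr (_ + A _ _ * u _ _); apply: val_inj.
by rewrite dotE !E; ring.
Qed.

(** * Integrals of matrix fields and their quadratic forms *)

Section IntegralForm.
Import HBNNSimple.
Context d (T : measurableType d) (R : realType) (mu : {measure set T -> \bar R}).

(** Stated for arbitrary [D] and [f], so it applies directly to control volumes. A simple function
    below the negative part of [f] is supported in a null set, hence has integral zero. *)
Lemma fine_integral_ge0 (D : set T) (f : T -> R) :
  {ae mu, forall x, D x -> 0 <= f x} -> 0 <= \int[mu]_(x in D) f x.
Proof.
move=> [N [mN N0 sub]]; rewrite /Rintegral fine_ge0 // /integral.
apply: adde_ge0.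
  apply: ereal_sup_ubound; exists (cst_nnsfun T (NngNum (lexx 0))); last exact: sintegral0.
  move=> x; rewrite funeposE le_max; apply/orP; right.
  by change (0%:E <= 0 :> \bar R)%E.
rewrite oppe_ge0; apply: ge_ereal_sup => _ [h hle <-].
rewrite sintegralE fsbig1 // => y _; have [->|y0] := eqVneq y 0; first by rewrite mul0e.
rewrite (_ : mu _ = 0%E) ?mule0 //; apply: (subset_measure0 _ mN _ N0).
  exact: measurable_funPTI.
move=> x /= hx; apply: sub => /= fx; have := hle x; rewrite hx.
have y_ge0 : 0 <= y by rewrite -hx; exact: fun_ge0.
rewrite funenegE /patch; have -> : (maxe (- (if x \in D then (f x)%:E else 0)) 0 = 0)%E.
  by apply/max_idPr; rewrite oppe_le0; case: ifPn => // /set_mem Dx; rewrite lee_fin fx.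
by rewrite lee_fin; apply/negP; rewrite -ltNge lt_def y0.
Qed.

Variables (U : set T) (L : T -> 'M[R]_2) (lam0 lam1 : R).
Hypotheses (mU : measurable U) (finU : (mu U < +oo)%E).
Hypothesis mL : forall i j, measurable_fun U (fun x => L x i j).
Hypothesis aeL : {ae mu, forall x, U x -> (L x)^T = L x /\
  forall v : 'cV[R]_2, lam0 * dot v v <= dot (L x *m v) v <= lam1 * dot v v}.
Hypothesis lam0_ge0 : 0 <= lam0.

(** P1 gradients are constant on a triangle, so only the entrywise integral [A] of the field
    matters. Off the exceptional null set [N] the entries are bounded, hence integrable, and the
    lower bound can be integrated. *)
Lemma integral_form : exists A : 'M[R]_2,
  [/\ forall v w : 'cV[R]_2, \int[mu]_(x in U) dot (L x *m v) w = dot (A *m v) w,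
      A^T = A & forall v, lam0 * fine (mu U) * dot v v <= dot (A *m v) v].
Proof.
have [N [mN N0 sub]] := aeL.
have good x : U x -> ~ N x -> (L x)^T = L x /\
    forall v : 'cV[R]_2, lam0 * dot v v <= dot (L x *m v) v <= lam1 * dot v v.
  by move=> Ux Nx; apply: contrapT => h; apply: Nx; apply: sub => /= h'; exact: h (h' Ux).
pose D := U `\` N.
have mD : measurable D by exact: measurableD.
have finD : (mu D < +oo)%E.
  by apply: le_lt_trans finU; apply: le_measure; rewrite ?inE //; exact: subDsetl.
have sym x : D x -> L x ord_max ord0 = L x ord0 ord_max.
  by move=> [Ux /(good x Ux)[e _]]; rewrite -{1}e mxE.
(* The form at the two basis vectors bounds the diagonal, and at their sum the off-diagonal
   entry. *)
have bnd i j x : D x -> `|L x i j| <= lam1.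
  move=> Dx; have [Ux Nx] := Dx; have [_ q] := good x Ux Nx.
  have := q (\col_k (k == ord0)%:R); have := q (\col_k (k == ord_max)%:R).
  have := q (\col_k 1); rewrite !dot_mulmxE !dotE !mxE /= (sym x Dx).
  rewrite !(mulr1, mulr0, addr0, add0r) => /andP[s1 s2] /andP[s3 s4] /andP[s5 s6].
  have ord01 (k : 'I_2) : k = ord0 \/ k = ord_max.
    by case: k => -[|[|//]] h; [left|right]; apply: val_inj.
  move: s1 s2 s3 s4 s5 s6.
  rewrite ler_norml; case: (ord01 i) (ord01 j) => -> [] ->; rewrite ?(sym x Dx);
    move: (L x ord0 ord0) (L x ord0 ord_max) (L x ord_max ord_max) lam0_ge0;
    by clear=> *; apply/andP; split; lra.
have mLD i j : measurable_fun D (fun x => L x i j).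
  by apply: measurable_funS (mL i j) => //; exact: subDsetl.
have intD i j : mu.-integrable D (EFin \o (fun x => L x i j)).
  apply: measurable_bounded_integrable => //; exists lam1; split; first exact: num_real.
  by move=> y ly x Dx; apply: le_trans (ltW ly); exact: bnd.
have toD (f : T -> R) : measurable_fun U f -> mu.-integrable D (EFin \o f) ->
    \int[mu]_(x in U) f x = \int[mu]_(x in D) f x.
  move=> mf iD; rewrite /Rintegral (negligible_integral mN mU) //.
  by apply/(negligible_integrable mN mU) => //; exact/measurable_EFinP.
pose A : 'M[R]_2 := \matrix_(i, j) \int[mu]_(x in D) L x i j.
have iM i j k : mu.-integrable D (EFin \o (fun x => L x i j * k)).
  have -> : EFin \o (fun x => L x i j * k) = (fun x => k%:E * (EFin \o (fun x => L x i j)) x)%E.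
    by apply/funext => x /=; rewrite mulrC.
  exact: integrableZl.
have iD (f g : T -> R) : mu.-integrable D (EFin \o f) -> mu.-integrable D (EFin \o g) ->
    mu.-integrable D (EFin \o (fun x => f x + g x)).
  by move=> hf hg; have := integrableD mD hf hg.
have mf v w : measurable_fun U (fun x => dot (L x *m v) w).
  under [X in measurable_fun _ X]funext => x do rewrite dot_mulmxE.
  do 3 (apply: measurable_funD; last by apply: measurable_funM => //; exact: measurable_cst).
  by apply: measurable_funM => //; exact: measurable_cst.
have intf v w : mu.-integrable D (EFin \o (fun x => dot (L x *m v) w)).
  under [X in integrable _ _ (_ \o X)]funext => x do rewrite dot_mulmxE.
  by do 3 apply: (iD) => //.
have AE v w : \int[mu]_(x in D) dot (L x *m v) w = dot (A *m v) w.
  under eq_Rintegral => x _ do rewrite dot_mulmxE.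
  rewrite RintegralD //; [|by do 2 apply: (iD) => //].
  rewrite RintegralD //; [|by apply: (iD) => //].
  rewrite RintegralD //; rewrite !RintegralZr // dot_mulmxE !mxE //.
exists A; split.
- by move=> v w; rewrite toD.
- apply/matrixP => i j; rewrite !mxE; apply: eq_Rintegral => x; rewrite inE => -[Ux Nx].
  by have [e _] := good x Ux Nx; rewrite -{2}e mxE.
- move=> v; rewrite -AE; have -> : lam0 * fine (mu U) * dot v v = \int[mu]_(x in D) (lam0 * dot v v).
    rewrite Rintegral_cst // mulrAC; congr (_ * fine _).
    have UN : mu (U `&` N) = 0%E.
      by apply: (subset_measure0 _ mN _ N0); [exact: measurableI|exact: subIsetr].
    have -> : mu U = (mu D + 0)%E by rewrite -UN; exact: (measureDI mu mU mN).
    by rewrite adde0.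
  apply: le_Rintegral => //; last by move=> x [Ux Nx]; have [_ /(_ v)/andP[]] := good x Ux Nx.
  apply: measurable_bounded_integrable => //; exists (lam0 * dot v v); split; first exact: num_real.
  move=> y ly x Dx /=; rewrite ger0_norm; first exact: ltW.
  by rewrite mulr_ge0 // dotE -!expr2 addr_ge0 // sqr_ge0.
Qed.

End IntegralForm.

(** * Open sets of the plane and their area *)

Section Plane.
Variable R : realType.
Implicit Type U : set (R * R).

(** The product sigma-algebra contains rectangles, so [U] is exhausted by the countably many open
    rectangles with rational corners that it contains. *)
Lemma open_plane_measurable U : open U -> measurable (U : set (plane R)).
Proof.
move=> oU.
pose F (q : rat * rat * (rat * rat)) : set (R * R) :=
  `]ratr q.1.1, ratr q.1.2[%classic `*` `]ratr q.2.1, ratr q.2.2[%classic.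
pose G q : set (R * R) := if `[< F q `<=` U >] then F q else set0.
have -> : U = \bigcup_q G q.
  apply/seteqP; split=> [[x y] Uxy|z [q _]]; last first.
    by rewrite /G; case: asboolP => // FU; exact: FU.
  have /nbhs_ballP[e /= e0 be] : nbhs (x, y) U by exact: open_nbhs_nbhs.
  have lo (t : R) : t - e < t by rewrite ltrBlDr ltrDl.
  have hi (t : R) : t < t + e by rewrite ltrDl.
  have [q1] := rat_in_itvoo (lo x); have [q2] := rat_in_itvoo (hi x).
  have [q3] := rat_in_itvoo (lo y); have [q4] := rat_in_itvoo (hi y).
  rewrite !in_itv /= => /andP[h4 h4'] /andP[h3 h3'] /andP[h2 h2'] /andP[h1 h1'].
  exists ((q1, q2), (q3, q4)) => //; rewrite /G asboolT.
    by split; rewrite /= in_itv /= ?h1' ?h2 ?h3' ?h4.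
  move=> [a b] [/=]; rewrite !in_itv /= => /andP[a1 a2] /andP[b1 b2].
  by apply: be; split; rewrite /= /ball /= ltr_norml; apply/andP; split; lra.
apply: countable_bigcupT_measurable => // q; rewrite /G; case: asboolP => // _.
by apply: measurableX; exact: measurable_itv.
Qed.

Local Notation leb2 := (@lebesgue_measure R \x @lebesgue_measure R)%E.

Lemma lebesgue_measure_itvoo (a b : R) : a <= b ->
  lebesgue_measure `]a, b[%classic = (b - a)%:E.
Proof.
by move=> ab; rewrite lebesgue_measure_itv /= lte_fin; case: ltgtP ab => // -> _; rewrite subrr.
Qed.

Lemma leb2_rectangle (a b c e : R) : a <= b -> c <= e ->
  leb2 (`]a, b[%classic `*` `]c, e[%classic) = ((b - a) * (e - c))%:E.
Proof.
move=> ab ce; rewrite product_measure1E; try exact: measurable_itv.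
rewrite EFinM -(lebesgue_measure_itvoo ab) -(lebesgue_measure_itvoo ce).
by [].
Qed.

Lemma open_leb2_gt0 U x : open U -> U x -> (0 < leb2 U)%E.
Proof.
move=> oU Ux; have /nbhs_ballP[e /= e0 be] : nbhs x U by exact: open_nbhs_nbhs.
case: x Ux be => x y Uxy be.
pose Q : set (R * R) := `]x - e, x + e[%classic `*` `]y - e, y + e[%classic.
have sub : Q `<=` U.
  move=> [a b] [/=]; rewrite !in_itv /= => /andP[a1 a2] /andP[b1 b2].
  by apply: be; split; rewrite /= /ball /= ltr_norml; apply/andP; split; lra.
have le : (leb2 Q <= leb2 U)%E.
  apply: le_measure => //; rewrite inE; last exact: open_plane_measurable.
  by apply: measurableX; exact: measurable_itv.
apply: lt_le_trans le; rewrite leb2_rectangle ?lte_fin; [|lra|lra].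
by apply: mulr_gt0; lra.
Qed.

Lemma bounded_leb2_fin U : open U -> bounded_set U -> (leb2 U < +oo)%E.
Proof.
move=> oU /ex_strict_bound_gt0[M M0 bU].
pose Q : set (R * R) := `]- M, M[%classic `*` `]- M, M[%classic.
have sub : U `<=` Q.
  move=> [a b] /bU; rewrite /= prod_normE /= gt_max !ltr_norml => /andP[h1 h2].
  by split; rewrite /= in_itv /=.
have le : (leb2 U <= leb2 Q)%E.
  apply: le_measure => //; rewrite inE; first exact: open_plane_measurable.
  by apply: measurableX; exact: measurable_itv.
by apply: le_lt_trans le _; rewrite leb2_rectangle ?ltry //; lra.
Qed.

End Plane.

Section ConvexHull.
Variable R : realType.
Implicit Types (A : set (R * R)) (x : R * R).

Definition affine (a b c : R) x := a * x.1 + b * x.2 + c.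

Lemma affine_sum (J : finType) (P : pred J) (a b c w : J -> R) x :
  \sum_(j | P j) w j * affine (a j) (b j) (c j) x =
  affine (\sum_(j | P j) w j * a j) (\sum_(j | P j) w j * b j) (\sum_(j | P j) w j * c j) x.
Proof.
rewrite /affine !mulr_suml -!big_split; apply: eq_bigr => j _ /=; ring.
Qed.

Lemma conv_hull_mem A x : A x -> conv_hull A x.
Proof.
move=> Ax; exists 1%N, (fun=> x), (fun=> 1); split => //.
  by rewrite big_ord_recl big_ord0 addr0.
by rewrite big_ord_recl big_ord0 addr0 scale1r.
Qed.

Lemma fst_sum n (q : 'I_n -> R * R) : (\sum_i q i).1 = \sum_i (q i).1.
Proof. by apply: (big_morph (fun p : R * R => p.1)). Qed.

Lemma snd_sum n (q : 'I_n -> R * R) : (\sum_i q i).2 = \sum_i (q i).2.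
Proof. by apply: (big_morph (fun p : R * R => p.2)). Qed.

Lemma conv_hull_affine A (a b c k : R) x :
  (forall q, A q -> affine a b c q = k) -> conv_hull A x -> affine a b c x = k.
Proof.
move=> Ak [n [q [w [Aq w0 w1 ->]]]].
have -> : k = \sum_i w i * affine a b c (q i).
  by under eq_bigr => i _ do rewrite Ak //; rewrite -mulr_suml w1 mul1r.
rewrite /affine fst_sum snd_sum /= -[c in LHS]mulr1 -[X in _ + c * X = _]w1.
rewrite !mulr_sumr -!big_split /=.
by apply: eq_bigr => i _; rewrite /GRing.scale /=; ring.
Qed.

End ConvexHull.

Section Mesh.
Variables (R : realType) (Omega : set (R * R)) (m : mesh R).
Hypothesis hmesh : conforming_triangulation Omega m.
Variable hat : vertex m -> R * R -> R.
Hypothesis hhat : nodal_basis Omega hat.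
Implicit Types (T : {set vertex m}) (K L : vertex m).

Lemma tri_vertex T K : K \in T -> tri_hull T (vpos K).
Proof. by move=> KT; apply: conv_hull_mem; exists K. Qed.

Lemma tri_hull_closure T x : T \in triangles m -> tri_hull T x -> closure Omega x.
Proof. by have [_ [<- _ _]] := hmesh => Tm Tx; exists T. Qed.

Lemma vertex_closure K : closure Omega (vpos K).
Proof.
have [[_ _ /(_ K)[T Tm KT]] _] := hmesh.
exact: tri_hull_closure Tm (tri_vertex KT).
Qed.

Lemma tri_hull_affine T (a b c k : R) x :
  (forall K, K \in T -> affine a b c (vpos K) = k) -> tri_hull T x -> affine a b c x = k.
Proof. by move=> Tk; apply: conv_hull_affine => _ [K KT <-]; exact: Tk. Qed.

Lemma hat_affine T : T \in triangles m -> exists a b c : vertex m -> R,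
  forall K x, tri_hull T x -> hat K x = affine (a K) (b K) (c K) x.
Proof.
move=> Tm; have h K : exists f : R * R * R, forall x, tri_hull T x ->
    hat K x = affine f.1.1 f.1.2 f.2 x.
  have [[_ /(_ T Tm)[a [b [c E]]]] _] := hhat K.
  by exists (a, b, c).
have [f fE] := choice h.
by exists (fun K => (f K).1.1), (fun K => (f K).1.2), (fun K => (f K).2).
Qed.

Lemma hat_node K L : hat K (vpos L) = (K == L)%:R.
Proof. by have [_] := hhat K. Qed.

Section Interpolant.
Variable u : vertex m -> R.

Definition interpolant x := \sum_K u K * hat K x.

Lemma interpolant_node K : interpolant (vpos K) = u K.
Proof.
rewrite /interpolant (bigD1 K) //= hat_node eqxx mulr1 big1 ?addr0 // => L /negbTE LK.
by rewrite hat_node LK mulr0.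
Qed.

Lemma interpolant_P1 : P1 Omega m interpolant.
Proof.
split.
  apply: (@continuous_sum R (subspace (closure Omega)) _ xpredT (fun K x => u K * hat K x)).
  move=> K _; apply: continuous_funM; first exact: continuous_funcst.
  by have [[]] := hhat K.
move=> T Tm; have [a [b [c E]]] := hat_affine Tm.
exists (\sum_K u K * a K), (\sum_K u K * b K), (\sum_K u K * c K) => x Tx.
rewrite -[RHS](affine_sum xpredT a b c u x).
by apply: eq_bigr => K _; rewrite E.
Qed.

End Interpolant.

Lemma mesh_connected (hO : connected Omega) (S : {set vertex m}) K0 : K0 \in S ->
  (forall T K L, T \in triangles m -> K \in T -> L \in T -> K \in S -> L \in S) ->
  forall K, K \in S.
Proof.
move=> K0S cl K1; apply: contraT => K1S.
(* The P1 function equal to 1 on S and to 0 elsewhere is constant on triangles. *)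
pose f := interpolant (fun K => (K \in S)%:R).
have [cf fT] := interpolant_P1 (fun K => (K \in S)%:R).
have fv K : f (vpos K) = (K \in S)%:R by exact: interpolant_node.
have : is_interval (f @` closure Omega).
  apply/connected_intervalP; apply: connected_continuous_connected => //.
  exact: connected_closure.
have im K : (f @` closure Omega) (K \in S)%:R.
  by exists (vpos K) => //; exact: vertex_closure.
(* The interval contains 0 and 1, so [f] takes the value 1/2 in some triangle, where it is
   constantly 0 or 1. *)
move=> /(_ 0 1)/(_ _ _ (2^-1)).
have i0 := im K1; have i1 := im K0; rewrite (negbTE K1S) K0S in i0 i1.
case=> //; first by apply/andP; split; lra.
move=> x Ox fx; have [_ [cov _ _]] := hmesh.
have [T Tm Tx] : (\bigcup_(T in [set T | T \in triangles m]) tri_hull T) x by rewrite cov.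
have [a [b [c E]]] := fT T Tm.
have [K KT] : exists K, K \in T.
  have [[_ /(_ T Tm)[cT _] _] _] := hmesh; apply/card_gt0P; by rewrite cT.
have : affine a b c x = (K \in S)%:R.
  apply: tri_hull_affine Tx => L LT; rewrite /affine -(E _ (tri_vertex LT)) interpolant_node.
  suff -> : (L \in S) = (K \in S) by [].
  by apply/idP/idP => h; [exact: (cl T L K)|exact: (cl T K L)].
rewrite /affine -(E _ Tx) -[LHS]/(f x) fx; case: (K \in S) => /=; lra.
Qed.

Section Triangle.
Variables (T : {set vertex m}) (Tm : T \in triangles m).

(** Cramer's rule: [a] and [b] times the cross product of two edges are combinations of the nodal
    values. *)
Lemma affine_zero (a b c : R) : (forall K, K \in T -> affine a b c (vpos K) = 0) ->
  [/\ a = 0, b = 0 & c = 0].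
Proof.
move=> h; have [[_ /(_ T Tm)[cT nd] _] _] := hmesh.
have [K KT] : exists K, K \in T by apply/card_gt0P; rewrite cT.
have : #|T :\ K| == 2%N by move: cT; rewrite (cardsD1 K) KT add1n => -[] /eqP.
move=> /cards2P[L [J [LJ TE]]].
have LT : L \in T :\ K by rewrite TE set21.
have JT : J \in T :\ K by rewrite TE set22.
move: LT JT; rewrite !inE => /andP[LK LT] /andP[JK JT].
have := nd K L J KT LT JT; rewrite eq_sym => /(_ LK LJ JK).
have := h _ KT; have := h _ LT; have := h _ JT; rewrite /affine /cross /=.
move: (vpos K) (vpos L) (vpos J) => [x0 y0] [x1 y1] [x2 y2] /= e2 e1 e0 nz.
set D := _ - _ in nz.
have aD : a * D = 0.
  have -> : a * D = (a * x1 + b * y1 + c - (a * x0 + b * y0 + c)) * (y2 - y0)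
     - (a * x2 + b * y2 + c - (a * x0 + b * y0 + c)) * (y1 - y0) by rewrite /D; ring.
  by rewrite e0 e1 e2 subrr !mul0r subrr.
have bD : b * D = 0.
  have -> : b * D = (a * x2 + b * y2 + c - (a * x0 + b * y0 + c)) * (x1 - x0)
     - (a * x1 + b * y1 + c - (a * x0 + b * y0 + c)) * (x2 - x0) by rewrite /D; ring.
  by rewrite e0 e1 e2 subrr !mul0r subrr.
have a0 : a = 0 by apply/eqP; move/eqP: aD; rewrite mulf_eq0 (negbTE nz) orbF.
have b0 : b = 0 by apply/eqP; move/eqP: bD; rewrite mulf_eq0 (negbTE nz) orbF.
by split=> //; move: e0; rewrite a0 b0 !mul0r !add0r.
Qed.

Variables (a b c : vertex m -> R).
Hypothesis hatE : forall K x, tri_hull T x -> hat K x = affine (a K) (b K) (c K) x.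

Lemma affine_node K L : L \in T -> affine (a K) (b K) (c K) (vpos L) = (K == L)%:R.
Proof. by move=> LT; rewrite -hatE ?hat_node //; exact: tri_vertex. Qed.

Lemma affine_combination (w : vertex m -> R) L : L \in T ->
  \sum_(K in T) w K * affine (a K) (b K) (c K) (vpos L) = w L.
Proof.
move=> LT; rewrite (bigD1 L) //= affine_node // eqxx mulr1 big1 ?addr0 // => K /andP[_ /negbTE KL].
by rewrite affine_node // KL mulr0.
Qed.

(** P1 interpolation is exact on affine functions, read off on coefficients; the difference vanishes
    at the nodes, so [affine_zero] applies. *)
Lemma affine_reproduce (p q r : R) :
  [/\ \sum_(K in T) affine p q r (vpos K) * a K = p,
      \sum_(K in T) affine p q r (vpos K) * b K = q
    & \sum_(K in T) affine p q r (vpos K) * c K = r].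
Proof.
set w := fun K => affine p q r (vpos K).
have [|h1 h2 h3] := @affine_zero (\sum_(K in T) w K * a K - p)
    (\sum_(K in T) w K * b K - q) (\sum_(K in T) w K * c K - r).
  move=> L LT; have := affine_combination w LT; rewrite affine_sum => h.
  transitivity (affine (\sum_(K in T) w K * a K) (\sum_(K in T) w K * b K)
    (\sum_(K in T) w K * c K) (vpos L) - w L); last by rewrite h subrr.
  by rewrite /w /affine; ring.
by split; apply/eqP; rewrite -subr_eq0; apply/eqP.
Qed.

Lemma sum_hat_gradient : \sum_(K in T) a K = 0 /\ \sum_(K in T) b K = 0.
Proof.
have [h1 h2 _] := affine_reproduce 0 0 1.
split; [rewrite -[RHS]h1|rewrite -[RHS]h2]; apply: eq_bigr => K _; by rewrite /affine; ring.
Qed.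

(** The local affine functions are barycentric coordinates: reproducing 1, [x.1] and [x.2] shows
    that they sum to one and represent [x]. *)
Lemma tri_hull_barycentric x : (forall K, K \in T -> 0 <= affine (a K) (b K) (c K) x) -> tri_hull T x.
Proof.
move=> pos; pose l K := affine (a K) (b K) (c K) x.
have sumE p q r : \sum_(K in T) affine p q r (vpos K) * l K = affine p q r x.
  by have [h1 h2 h3] := affine_reproduce p q r; rewrite affine_sum h1 h2 h3.
exists #|T|, (fun i => vpos (enum_val i)), (fun i => l (enum_val i)); split.
- by move=> i; exists (enum_val i) => //; exact: enum_valP.
- by move=> i; apply: pos; exact: enum_valP.
- have := sumE 0 0 1; rewrite /affine !mul0r !add0r => <-.
  rewrite -(big_enum_val l) /=; apply: eq_bigr => K _; by rewrite !mul0r !add0r mul1r.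
- rewrite [RHS]surjective_pairing fst_sum snd_sum [LHS]surjective_pairing /=; congr pair.
    have := sumE 1 0 0; rewrite /affine !mul0r mul1r !addr0 => <-.
    rewrite -(big_enum_val (fun K => l K * (vpos K).1)) /=.
    by apply: eq_bigr => K _; rewrite mul0r mul1r !addr0 mulrC.
  have := sumE 0 1 0; rewrite /affine !mul0r mul1r !addr0 add0r => <-.
  rewrite -(big_enum_val (fun K => l K * (vpos K).2)) /=.
  by apply: eq_bigr => K _; rewrite mul0r mul1r !addr0 add0r mulrC.
Qed.

Lemma interior_tri_hull_nonempty : interior (tri_hull T) !=set0.
Proof.
have [[_ /(_ T Tm)[cT _] _] _] := hmesh.
pose x0 := barycenter T; exists x0.
have pos K : K \in T -> 0 < affine (a K) (b K) (c K) x0.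
  move=> KT; have -> : affine (a K) (b K) (c K) x0 =
      3^-1 * \sum_(L in T) affine (a K) (b K) (c K) (vpos L).
    rewrite /x0 /barycenter /affine /=.
    have -> : (\sum_(L in T) vpos L).1 = \sum_(L in T) (vpos L).1.
      by apply: (big_morph (fun p : R * R => p.1)).
    have -> : (\sum_(L in T) vpos L).2 = \sum_(L in T) (vpos L).2.
      by apply: (big_morph (fun p : R * R => p.2)).
    by rewrite !big_split /= -!mulr_sumr sumr_const cT /GRing.scale /=; field.
  rewrite (bigD1 K) //= affine_node // eqxx big1 ?addr0 ?mulr1 ?invr_gt0 // => L /andP[LT /negbTE].
  by rewrite eq_sym affine_node // => ->.
rewrite /interior /=.
have : \forall x \near x0, forall K, K \in T -> 0 < affine (a K) (b K) (c K) x.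
  apply: (@filter_forall _ _ (fun K => [set x | K \in T -> 0 < affine (a K) (b K) (c K) x]) _ (nbhs_filter x0)) => K.
  case: (boolP (K \in T)) => KT; last by apply: nearW.
  have cts : continuous (affine (a K) (b K) (c K)).
    apply: continuous_funD; last exact: continuous_funcst.
    apply: continuous_funD; (apply: continuous_funM; first exact: continuous_funcst).
      by move=> z; exact: cvg_fst.
    by move=> z; exact: cvg_snd.
  by have := cts x0 _ (lt_nbhsr (pos K KT)); apply: (@filterS _ _ (nbhs_filter x0)) => x h _.
by apply: filterS => x h; apply: tri_hull_barycentric => K /h /ltW.
Qed.

Lemma hat_gradient K x : interior (tri_hull T) x ->
  grad (hat K) x = \col_i (if i == ord0 then a K else b K).
Proof.
move=> Tx; apply/colP => i; rewrite !mxE.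
have D (v : R * R) : 'D_v (hat K) x = a K * v.1 + b K * v.2.
  have near_hull : \forall h \near (0 : R)^', tri_hull T (h *: v + x).
    have : (h *: v + x) @[h --> (0 : R)] --> 0 *: v + x.
      by apply: cvgD; [apply: cvgZ; [exact: cvg_id|exact: cvg_cst]|exact: cvg_cst].
    rewrite scale0r add0r => cv.
    have cw : (h *: v + x) @[h --> (0 : R)^'] --> x.
      by apply: cvg_trans cv; apply: cvg_app; exact: cvg_within.
    exact: cw _ Tx.
  apply: cvg_lim; first exact: Rhausdorff.
  apply: (@cvg_trans _ (cst (a K * v.1 + b K * v.2) @ 0^')); last exact: cvg_cst.
  apply: near_eq_cvg; near=> h.
  have h0 : h != 0 by near: h; exact: nbhs_dnbhs_neq.
  have hx : tri_hull T (h *: v + x) by near: h.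
  rewrite /= hatE // hatE; last exact: interior_subset.
  rewrite /affine /= /GRing.scale /=; by field.
rewrite D; case: ifP => _ /=; by rewrite mulr1 mulr0 ?addr0 ?add0r.
Unshelve. all: by end_near. Qed.

End Triangle.
End Mesh.

(** The pure squares drop out since [x] and [y] sum to zero. For components of the hat gradients,
    this turns the sum over ordered edges into twice the Dirichlet form of the interpolant. *)
Lemma sum_edge_form (R : realType) (V : finType) (T : {set V}) (x y u : V -> R) :
  \sum_(K in T) x K = 0 -> \sum_(K in T) y K = 0 ->
  \sum_(K in T) \sum_(L in T) x K * y L * (u L - u K) ^+ 2 =
  - ((\sum_(K in T) u K * x K) * (\sum_(K in T) u K * y K)) *+ 2.
Proof.
move=> x0 y0.
transitivity (\sum_(K in T) \sum_(L in T) (x K * (y L * u L ^+ 2) + x K * u K ^+ 2 * y L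
    - (u K * x K) * (u L * y L) *+ 2)).
  by apply: eq_bigr => K _; apply: eq_bigr => L _; ring.
under eq_bigr => K _ do rewrite !(big_split, sumrN, sumrMnl) /= -!mulr_sumr y0 mulr0 addr0.
by rewrite !(big_split, sumrN, sumrMnl) /= -!mulr_suml x0 mul0r add0r mulNrn.
Qed.

(** * Symmetry and coercivity of the transmissibilities *)

Section Transmissibility.
Variables (R : realType) (Omega : set (R * R)) (m : mesh R).
Hypotheses (hmesh : conforming_triangulation Omega m).
Hypotheses (oO : open Omega) (bO : bounded_set Omega).
Variable hat : vertex m -> R * R -> R.
Hypothesis hhat : nodal_basis Omega hat.
Variables (Lambda : R * R -> 'M[R]_2) (lam0 lam1 : R).
Hypotheses (lam0_gt0 : 0 < lam0) (hL : is_permeability Omega lam0 lam1 Lambda).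
Implicit Types (T : {set vertex m}) (K L : vertex m).

Local Notation lam := (transmissibility Lambda hat).
Local Notation leb2 := (@lebesgue_measure R \x @lebesgue_measure R)%E.

Lemma triangle_form T : T \in triangles m -> exists (A : 'M[R]_2) (area_T : R),
  [/\ 0 < area_T, A^T = A, forall v, lam0 * area_T * dot v v <= dot (A *m v) v
    & forall v w, integral2 (interior (tri_hull T)) (fun x => dot (Lambda x *m v) w)
        = dot (A *m v) w].
Proof.
move=> Tm; have [a [b [c hatE]]] := hat_affine hhat Tm.
pose U := interior (tri_hull T).
have oU : open U by exact: open_interior.
have UO : U `<=` Omega by have [_ [_ /(_ T Tm) h _]] := hmesh.
have bU : bounded_set U by case: bO => M [Mr h]; exists M; split=> // y My z /UO; exact: h.
have [x Ux] := interior_tri_hull_nonempty hmesh hhat Tm hatE.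
have mU := open_plane_measurable oU.
have finU := bounded_leb2_fin oU bU.
have posU := open_leb2_gt0 oU Ux.
have [mL aeL] := hL.
have [||A [h1 h2 h3]] := @integral_form _ _ R leb2 (U : set (plane R)) Lambda lam0 lam1 mU finU _ _ (ltW lam0_gt0).
- move=> i j; apply: measurable_funS (mL i j) => //; exact: open_plane_measurable.
- have [N [mN N0 sub]] := aeL; exists N; split => //; apply: subset_trans sub.
  by apply: subsetC => y hy Uy; apply: hy; exact: UO.
exists A, (fine (leb2 U)); split => //.
by rewrite fine_gt0 // posU finU.
Qed.

(** Single transmissibilities may be negative, but their edge sum is twice the integral of [Lambda]
    against the gradient of the interpolant. A nodal difference is this gradient dotted with an
    edge, so Cauchy-Schwarz bounds it by the form. *)
Lemma transmissibility_spec T : T \in triangles m ->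
  (forall K L, lam T K L = lam T L K) /\
  exists2 c, 0 < c & forall (u : vertex m -> R) K L, K \in T -> L \in T ->
    c * (u L - u K) ^+ 2 <= \sum_(K in T) \sum_(L in T) lam T K L * (u L - u K) ^+ 2.
Proof.
move=> Tm; have [a [b [c hatE]]] := hat_affine hhat Tm.
have [A [ar [ar0 As Alow AE]]] := triangle_form Tm.
pose g K : 'cV[R]_2 := \col_i (if i == ord0 then a K else b K).
have lamE K L : lam T K L = - dot (A *m g K) (g L).
  rewrite /transmissibility -AE; congr (- _); apply: eq_Rintegral => x; rewrite inE => Ux.
  by rewrite (hat_gradient hatE K Ux) (hat_gradient hatE L Ux).
have As01 : A ord_max ord0 = A ord0 ord_max by rewrite -{1}As mxE.
have sym K L : lam T K L = lam T L K by rewrite !lamE !dot_mulmxE As01; ring.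
split=> //.
have [a0 b0] := sum_hat_gradient hmesh hhat Tm hatE.
(* Dominates every squared edge length; the 1 makes it positive outright. *)
pose Dm := 1 + \sum_(K in T) \sum_(L in T)
  (((vpos L).1 - (vpos K).1) ^+ 2 + ((vpos L).2 - (vpos K).2) ^+ 2).
have Dm_ge0 K L : 0 <= ((vpos L).1 - (vpos K).1) ^+ 2 + ((vpos L).2 - (vpos K).2) ^+ 2.
  by rewrite addr_ge0 // sqr_ge0.
have Dm0 : 0 < Dm.
  by rewrite /Dm ltr_wpDr //; apply: sumr_ge0 => K _; apply: sumr_ge0.
exists (lam0 * ar *+ 2 / Dm); first by rewrite divr_gt0 // pmulrn_lgt0 // mulr_gt0.
move=> u K L KT LT.
pose G1 := \sum_(K in T) u K * a K; pose G2 := \sum_(K in T) u K * b K.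
have formE : \sum_(K in T) \sum_(L in T) lam T K L * (u L - u K) ^+ 2 =
    dot (A *m \col_i (if i == ord0 then G1 else G2)) (\col_i (if i == ord0 then G1 else G2)) *+ 2.
  transitivity (- (A ord0 ord0 * (\sum_(K in T) \sum_(L in T) a K * a L * (u L - u K) ^+ 2)
    + A ord0 ord_max * (\sum_(K in T) \sum_(L in T) b K * a L * (u L - u K) ^+ 2)
    + A ord_max ord0 * (\sum_(K in T) \sum_(L in T) a K * b L * (u L - u K) ^+ 2)
    + A ord_max ord_max * (\sum_(K in T) \sum_(L in T) b K * b L * (u L - u K) ^+ 2))).
    rewrite !mulr_sumr -!big_split -sumrN; apply: eq_bigr => k _ /=.
    rewrite !mulr_sumr -!big_split -sumrN; apply: eq_bigr => l _ /=.
    by rewrite lamE dot_mulmxE !mxE /=; ring.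
  by rewrite !sum_edge_form // dot_mulmxE !mxE /= -/G1 -/G2; ring.
rewrite formE.
have := Alow (\col_i (if i == ord0 then G1 else G2)); rewrite [dot (\col_i _) _]dotE !mxE /= => low.
have nodal M : M \in T -> u M = G1 * (vpos M).1 + G2 * (vpos M).2 + \sum_(K in T) u K * c K.
  move=> MT; rewrite -(affine_combination hhat hatE u MT) affine_sum /affine -/G1 -/G2.
  by congr (_ + _).
have uLK : u L - u K = G1 * ((vpos L).1 - (vpos K).1) + G2 * ((vpos L).2 - (vpos K).2).
  by rewrite (nodal _ LT) (nodal _ KT); ring.
apply: (@le_trans _ _ (lam0 * ar * (G1 * G1 + G2 * G2) *+ 2)); last by rewrite ler_pMn2r.
rewrite -[leLHS]mulrA -[leRHS]mulrnAl; apply: ler_wpM2l; first by rewrite mulrn_wge0 // mulr_ge0 // ltW.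
rewrite mulrC ler_pdivrMr //.
set dx := (vpos L).1 - (vpos K).1 in uLK *; set dy := (vpos L).2 - (vpos K).2 in uLK *.
apply: (@le_trans _ _ ((G1 * G1 + G2 * G2) * (dx ^+ 2 + dy ^+ 2))).
  rewrite uLK -subr_ge0; have -> : (G1 * G1 + G2 * G2) * (dx ^+ 2 + dy ^+ 2)
    - (G1 * dx + G2 * dy) ^+ 2 = (G1 * dy - G2 * dx) ^+ 2 by ring.
  exact: sqr_ge0.
apply: ler_wpM2l; first by rewrite -!expr2 addr_ge0 // sqr_ge0.
pose q K L := ((vpos L).1 - (vpos K).1) ^+ 2 + ((vpos L).2 - (vpos K).2) ^+ 2.
have q1 : q K L <= \sum_(L in T) q K L by rewrite (bigD1 L) //= lerDl sumr_ge0 // => l _; exact: Dm_ge0.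
have q2 : \sum_(L in T) q K L <= \sum_(K in T) \sum_(L in T) q K L.
  by rewrite [leRHS](bigD1 K) //= lerDl sumr_ge0 // => k _; apply: sumr_ge0 => l _; exact: Dm_ge0.
by apply: (le_trans q1 (le_trans q2 _)); rewrite /Dm lerDr ler01.
Qed.

Lemma time_weight_ge0 (phi0 phi1 : R) (phi : R * R -> R) (D : set (R * R)) :
  0 < phi0 -> is_porosity Omega phi0 phi1 phi ->
  0 <= area D * ((area D)^-1 * integral2 (D `&` Omega) phi).
Proof.
move=> p0 [_ ae]; have a0 : 0 <= area D by rewrite /area fine_ge0.
rewrite !mulr_ge0 ?invr_ge0 //; apply: fine_integral_ge0.
have [N [mN N0 sub]] := ae; exists N; split => //; apply: subset_trans sub.
apply: subsetC => x hx [_ Ox]; have /andP[h _] := hx Ox.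
by rewrite (le_trans _ h) // ltW.
Qed.

End Transmissibility.

(** * Energy balance of the scheme *)

Section Finite.
Variable R : realType.

Lemma uniform_positive (J : finType) (P : pred J) (Q : J -> R -> Prop) :
  (forall j c c', c' <= c -> Q j c -> Q j c') ->
  (forall j, P j -> exists2 c, 0 < c & Q j c) ->
  exists2 c, 0 < c & forall j, P j -> Q j c.
Proof.
move=> anti ex.
have h j : exists c, 0 < c /\ (P j -> Q j c).
  by have [/ex[c c0 Qc]|_] := boolP (P j); [exists c|exists 1; rewrite ltr01].
have [f fP] := choice h.
exists (\big[Num.min/1]_j f j).
  by elim/big_ind: _ => // [x y x0 y0|j _]; [rewrite lt_min x0|have [] := fP j].
move=> j Pj; apply: (anti j (f j)); last by have [_] := fP j; exact.
exact: bigmin_le.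
Qed.

(** Replaces square roots in the a priori bounds; this is the origin of the summand 1 in their
    constants. *)
Lemma abs_le_of_sqr (t s : R) : t ^+ 2 <= s -> `|t| <= 1 + s.
Proof.
move=> ts; apply: (@le_trans _ _ (1 + t ^+ 2)); last by rewrite lerD2l.
rewrite -(real_normK (num_real t)); move: (`|t|) => a.
by have := sqr_ge0 (a - 2^-1); rewrite -subr_ge0; nra.
Qed.

(** Discrete integration by parts; the factor 1/2 appears because each edge is met in both
    directions. *)
Lemma antisymmetric_sum (V : finType) (T : {set V}) (q : V -> V -> R) (g : V -> R) :
  (forall K L, K \in T -> L \in T -> q L K = - q K L) ->
  \sum_(K in T) \sum_(L in T) q K L * g K =
  - (\sum_(K in T) \sum_(L in T) q K L * (g L - g K)) / 2.
Proof.
move=> anti; set S := LHS.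
have E : \sum_(K in T) \sum_(L in T) q K L * g L = - S.
  rewrite exchange_big /= /S -sumrN; apply: eq_bigr => K KT; rewrite -sumrN.
  by apply: eq_bigr => L LT; rewrite anti // mulNr.
have -> : \sum_(K in T) \sum_(L in T) q K L * (g L - g K) = - S - S.
  rewrite -{1}E /S -sumrB; apply: eq_bigr => K _; rewrite -sumrB.
  by apply: eq_bigr => L _; rewrite mulrBr.
by field.
Qed.

Lemma path_bound (V : finType) (e : rel V) (f : V -> R) (B : R) K0 K :
  (forall K L, e K L -> `|f L - f K| <= B) -> 0 <= B -> connect e K0 K ->
  `|f K - f K0| <= B * #|V|%:R.
Proof.
move=> edge B0 /connectP[p pth ->]; case: (shortenP pth) => q qth uq _.
have : `|f (last K0 q) - f K0| <= B * (size q)%:R.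
  move: qth {uq pth p}; elim: q K0 => [|L q IH] K0 /=; first by rewrite subrr normr0 mulr0.
  move=> /andP[KL /IH h].
  have -> : f (last L q) - f K0 = (f (last L q) - f L) + (f L - f K0) by rewrite addrA subrK.
  apply: le_trans (ler_normD _ _) _; rewrite -[(size q).+1]addn1 natrD mulrDr mulr1.
  by rewrite lerD // edge.
move=> /le_trans; apply; rewrite ler_wpM2l // ler_nat.
have := card_uniqP uq; have := max_card (mem (K0 :: q)).
by move=> h1 h2; rewrite h2 /= in h1; exact: ltnW.
Qed.

Lemma ler_term_sum (J : finType) (P : pred J) (F : J -> R) j :
  (forall i, P i -> 0 <= F i) -> P j -> F j <= \sum_(i | P i) F i.
Proof.
by move=> F0 Pj; rewrite (bigD1 j) //= lerDl; apply: sumr_ge0 => i /andP[Pi _]; exact: F0.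
Qed.

Lemma continuous_bigmin (X : topologicalType) (J : Type) (s : seq J) (P : pred J)
    (f0 : X -> R) (f : J -> X -> R) : continuous f0 -> (forall j, continuous (f j)) ->
  continuous (fun x => \big[Num.min/f0 x]_(j <- s | P j) f j x).
Proof.
move=> c0 cf; elim: s => [|j s IH].
  by under [X in continuous X]funext => x do rewrite big_nil.
under [X in continuous X]funext => x do rewrite big_cons.
by case: (P j) => //; exact: continuous_funmin.
Qed.

Lemma bigmin_same (V : finType) (T : {set V}) (f : V -> R) K L : K \in T -> L \in T ->
  \big[Num.min/f K]_(J in T) f J = \big[Num.min/f L]_(J in T) f J.
Proof.
suff le K' L' : K' \in T -> L' \in T ->
    \big[Num.min/f K']_(J in T) f J <= \big[Num.min/f L']_(J in T) f J.
  by move=> KT LT; apply/eqP; rewrite eq_le !le.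
move=> KT LT; elim/big_ind: (X in _ <= X) => [|x y hx hy|J JT].
- exact: bigmin_le_cond.
- by rewrite le_min hx.
- exact: bigmin_le_cond.
Qed.

End Finite.

Section Energy.
Variables (R : realType) (d : model R) (Omega : set (R * R)) (m : mesh R).
Variables (hat : vertex m -> R * R -> R) (rho0 rho1 : R).
Hypotheses (hcap : is_capillary (cap d) (cap_inv d)) (hmob : forall a, is_mobility (mob d a)).
Hypotheses (hrho0 : 0 < rho0) (hrho : forall a, is_density rho0 rho1 (rho d a)).
Implicit Types (T : {set vertex m}) (K L : vertex m) (a : phase).
Implicit Types (p pn : phase -> R * R -> R).

Local Notation lam := (transmissibility (perm d) hat).
Local Notation weight K := (area (control_volume K) * poro_mean Omega (poro d) K).
Local Notation g := (fun a => pressure_transform (rho d a)).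

Lemma cap_lt x y : (cap d x < cap d y) = (x < y).
Proof. by have [_ [mc _ _]] := hcap; apply: (leW_mono (le_mono mc)). Qed.

Lemma cap_le x y : (cap d x <= cap d y) = (x <= y).
Proof. by have [_ [mc _ _]] := hcap; apply: (le_mono mc). Qed.

Lemma cap0 : cap d 0 = 0. Proof. by have [_ []] := hcap. Qed.

Lemma cap1_gt0 : 0 < cap d 1. Proof. by rewrite -cap0 cap_lt. Qed.

Lemma cap_sat p K : cap d (sat d p gas K) = p gas (vpos K) - p water (vpos K).
Proof. by have [[_ cK _ _] _] := hcap; rewrite /sat cK. Qed.

Lemma sat_water p K : sat d p water K = 1 - sat d p gas K.
Proof. by []. Qed.

Lemma dlt_capE p K L : dlt_cap d p K L = dlt p gas K L - dlt p water K L.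
Proof. by rewrite /dlt_cap !cap_sat /dlt; ring. Qed.

Lemma mob_ge0 a s : 0 <= mob d a s.
Proof. by have [_ h _ _ _] := hmob a. Qed.

Lemma mob_mono a : {homo mob d a : s t / s <= t}.
Proof.
have [_ h0 h1 h2 h3] := hmob a => s t st.
case: (leP s 0) => s0; first by rewrite (h2 _ s0).
case: (leP 1 t) => t1; last by rewrite h1 // ltW.
rewrite (h3 _ t1); case: (leP 1 s) => s1; first by rewrite (h3 _ s1).
by rewrite h1 // ltW.
Qed.

Lemma clip_le0 (s : R) : s <= 0 -> clip s = 0.
Proof. by move=> s0; rewrite /clip (max_idPr s0) (min_idPl ler01). Qed.

Lemma clip_ge1 (s : R) : 1 <= s -> clip s = 1.
Proof. by move=> s1; rewrite /clip (max_idPl (le_trans ler01 s1)) (min_idPr s1). Qed.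

Lemma clip_id (s : R) : 0 <= s -> s <= 1 -> clip s = s.
Proof. by move=> s0 s1; rewrite /clip (max_idPl s0) (min_idPl s1). Qed.

Lemma clip_compl (s : R) : clip (1 - s) = 1 - clip s.
Proof.
case: (leP s 0) => s0; first by rewrite (clip_le0 s0) clip_ge1 ?subr0 // lerDl oppr_ge0.
case: (leP 1 s) => s1; first by rewrite (clip_ge1 s1) clip_le0 ?subrr // subr_le0.
by rewrite !clip_id //; lra.
Qed.

Definition edge_mob eps p a T K L := eps + mob d a (sat_edge d hat p a T K L).

Definition phase_dissipation eps p a T :=
  \sum_(K in T) \sum_(L in T) edge_mob eps p a T K L * lam T K L * dlt p a K L ^+ 2.

Definition capillary_dissipation p T :=
  \sum_(K in T) \sum_(L in T | 0 <= lam T K L) `|lam T K L| * dlt_cap d p K L ^+ 2.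

Definition storage_power pn p a K :=
  (rho d a (p a (vpos K)) * clip (sat d p a K)
   - rho d a (pn a (vpos K)) * sat d pn a K) * g a (p a (vpos K)).

Hypothesis lam_sym : forall T K L, T \in triangles m -> lam T K L = lam T L K.

Lemma dltN p a K L : dlt p a L K = - dlt p a K L.
Proof. by rewrite /dlt opprB. Qed.

(** The mobility alone is not symmetric: at zero pressure drop the upwind rule picks the second
    endpoint in either direction. Multiplied by the drop, the ambiguity disappears. *)
Lemma edge_mob_sym eps p a T K L : T \in triangles m -> K \in T -> L \in T ->
  edge_mob eps p a T L K * dlt p a L K = - (edge_mob eps p a T K L * dlt p a K L).
Proof.
move=> Tm KT LT; rewrite dltN mulrN; congr (- _); rewrite /edge_mob /sat_edge (lam_sym _ _ Tm) dltN.
case: ifP => _; last by rewrite (bigmin_same (sat d p a) LT KT).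
by rewrite oppr_ge0; case: (ltgtP (dlt p a K L) 0) => // ->; rewrite !mulr0.
Qed.

Lemma rho_edge_gt0 p a K L : 0 < rho_edge d p a K L.
Proof. exact: rho_mean_gt0 hrho0 (hrho a) _ _. Qed.

Lemma rho_edge_sym p a K L : rho_edge d p a L K = rho_edge d p a K L.
Proof. exact: rho_mean_sym. Qed.

Lemma rho_edge_g p a K L :
  rho_edge d p a K L * (g a (p a (vpos L)) - g a (p a (vpos K))) = dlt p a K L.
Proof.
rewrite -(pressure_transformB hrho0 (hrho a)) mulrC divfK //.
by rewrite gt_eqF //; exact: rho_edge_gt0.
Qed.

(** Regroups vertex sums by triangles, where antisymmetry applies. The diagonal term, absent from
    the scheme, vanishes by antisymmetry and may be added. *)
Lemma flux_summation (q : {set vertex m} -> vertex m -> vertex m -> R) (f : vertex m -> R) :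
  (forall T K L, T \in triangles m -> K \in T -> L \in T -> q T L K = - q T K L) ->
  \sum_K (\sum_(T in triangles m | K \in T) \sum_(L in T :\ K) q T K L) * f K =
  - (\sum_(T in triangles m) \sum_(K in T) \sum_(L in T) q T K L * (f L - f K)) / 2.
Proof.
move=> anti.
transitivity (\sum_(T in triangles m) \sum_(K in T) \sum_(L in T) q T K L * f K).
  under eq_bigr => K _ do rewrite mulr_suml.
  rewrite (exchange_big_dep (mem (triangles m))) /=; last by move=> K T _ /andP[].
  apply: eq_bigr => T Tm; apply: eq_big => [K|K]; first by rewrite Tm.
  move=> /andP[_ KT]; rewrite mulr_suml [RHS](big_setD1 K) //=.
  have -> : q T K K = 0 by have := anti T K K Tm KT KT => h; lra.
  by rewrite mul0r add0r.
under eq_bigr => T Tm do rewrite (antisymmetric_sum f (fun K L => anti T K L Tm)).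
by rewrite -mulr_suml sumrN.
Qed.

Lemma phase_balance eps eta dt p pn a :
  \sum_K residual d Omega hat eps eta dt p pn a K * g a (p a (vpos K)) =
  \sum_K weight K * storage_power pn p a K
  + dt / 2 * \sum_(T in triangles m) phase_dissipation eps p a T
  + dt * eta / 2 * \sum_(T in triangles m) \sum_(K in T) \sum_(L in T | 0 <= lam T K L)
      `|lam T K L| * dlt_cap d p K L * ((-1) ^+ phase_idx a * dlt p a K L).
Proof.
pose q T K L := rho_edge d p a K L * edge_mob eps p a T K L * lam T K L * dlt p a K L.
(* The restriction to nonnegative transmissibilities becomes a factor 0 or 1, so that
   [flux_summation] covers the capillary term too. *)
pose r T K L : R := (0 <= lam T K L)%R%:R * (rho_edge d p a K L * `|lam T K L| * dlt_cap d p K L).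
have rE T K : T \in triangles m -> K \in T ->
    \sum_(L in T :\ K | 0 <= lam T K L) rho_edge d p a K L * `|lam T K L| * dlt_cap d p K L =
    \sum_(L in T :\ K) r T K L.
  move=> Tm KT; rewrite [LHS]big_mkcondr; apply: eq_bigr => L _; rewrite /r.
  by case: ifP; rewrite ?mul1r ?mul0r.
pose gK K := g a (p a (vpos K)).
have -> : \sum_K residual d Omega hat eps eta dt p pn a K * g a (p a (vpos K)) =
   \sum_K weight K * storage_power pn p a K
   - dt * \sum_K (\sum_(T in triangles m | K \in T) \sum_(L in T :\ K) q T K L) * gK K
   - dt * eta * (-1) ^+ phase_idx a *
     \sum_K (\sum_(T in triangles m | K \in T) \sum_(L in T :\ K) r T K L) * gK K.
  rewrite !mulr_sumr -!sumrB; apply: eq_bigr => K _; rewrite /residual.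
  under [X in _ - _ * X]eq_bigr => T /andP[Tm KT] do rewrite rE //.
  rewrite /storage_power -/(gK K) /q /edge_mob; ring.
rewrite !flux_summation; first last.
- move=> T K L Tm KT LT; rewrite /r rho_edge_sym (lam_sym _ _ Tm) !dlt_capE !(dltN p _ K L); ring.
- move=> T K L Tm KT LT; rewrite /q rho_edge_sym.
  transitivity (rho_edge d p a K L * lam T L K * (edge_mob eps p a T L K * dlt p a L K)); first by ring.
  by rewrite edge_mob_sym // (lam_sym _ _ Tm); ring.
have -> : \sum_(T in triangles m) \sum_(K in T) \sum_(L in T) q T K L * (gK L - gK K) =
    \sum_(T in triangles m) phase_dissipation eps p a T.
  apply: eq_bigr => T _; apply: eq_bigr => K _; apply: eq_bigr => L _.
  rewrite expr2 mulrA -{2}(rho_edge_g p a K L) /q -/(gK L) -/(gK K); ring.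
have -> : \sum_(T in triangles m) \sum_(K in T) \sum_(L in T) r T K L * (gK L - gK K) =
    \sum_(T in triangles m) \sum_(K in T) \sum_(L in T | 0 <= lam T K L)
      `|lam T K L| * dlt_cap d p K L * dlt p a K L.
  apply: eq_bigr => T _; apply: eq_bigr => K _; rewrite [RHS]big_mkcondr.
  apply: eq_bigr => L _; rewrite /r; case: ifP => _; last by rewrite !mul0r.
  by rewrite mulr1n mul1r -(rho_edge_g p a K L) -/(gK L) -/(gK K); ring.
have -> : \sum_(T in triangles m) \sum_(K in T) \sum_(L in T | 0 <= lam T K L)
      `|lam T K L| * dlt_cap d p K L * ((-1) ^+ phase_idx a * dlt p a K L) =
    (-1) ^+ phase_idx a * \sum_(T in triangles m) \sum_(K in T) \sum_(L in T | 0 <= lam T K L)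
      `|lam T K L| * dlt_cap d p K L * dlt p a K L.
  rewrite mulr_sumr; apply: eq_bigr => T _; rewrite mulr_sumr; apply: eq_bigr => K _.
  by rewrite mulr_sumr; apply: eq_bigr => L _; ring.
by field.
Qed.

(** The opposite signs of the [eta]-terms are what makes them dissipative: the two drops combine to
    [dlt_cap], which gives its square. *)
Lemma power_balance eps eta dt p pn :
  \sum_K residual d Omega hat eps eta dt p pn gas K * g gas (p gas (vpos K)) +
  \sum_K residual d Omega hat eps eta dt p pn water K * g water (p water (vpos K)) =
  \sum_K weight K * (storage_power pn p gas K + storage_power pn p water K)
  + dt / 2 * (\sum_(T in triangles m) phase_dissipation eps p gas T
              + \sum_(T in triangles m) phase_dissipation eps p water T)
  + dt * eta / 2 * \sum_(T in triangles m) capillary_dissipation p T.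
Proof.
rewrite !phase_balance.
have -> : \sum_(T in triangles m) capillary_dissipation p T =
   \sum_(T in triangles m) \sum_(K in T) \sum_(L in T | 0 <= lam T K L)
      `|lam T K L| * dlt_cap d p K L * ((-1) ^+ phase_idx gas * dlt p gas K L)
   + \sum_(T in triangles m) \sum_(K in T) \sum_(L in T | 0 <= lam T K L)
      `|lam T K L| * dlt_cap d p K L * ((-1) ^+ phase_idx water * dlt p water K L).
  rewrite -big_split; apply: eq_bigr => T _; rewrite -big_split; apply: eq_bigr => K _.
  rewrite -big_split; apply: eq_bigr => L _ /=; rewrite expr2 {2}dlt_capE expr0 expr1; ring.
have -> : \sum_K weight K * (storage_power pn p gas K + storage_power pn p water K) =
   \sum_K weight K * storage_power pn p gas K + \sum_K weight K * storage_power pn p water K.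
  by rewrite -big_split; apply: eq_bigr => K _; rewrite mulrDr.
ring.
Qed.

(* Concavity of g bounds the power of the old content by s^n (p - p^n); summed
   over the phases, the remaining terms are (s_g - s_g^n) p_c(s_g). *)
Lemma storage_power_ge pn p K : (forall a, 0 <= sat d pn a K <= 1) ->
  - (cap d 1 + \sum_(a <- [:: gas; water])
       sat d pn a K * (rho d a (pn a (vpos K)) * g a (pn a (vpos K)) - pn a (vpos K)))
  <= storage_power pn p gas K + storage_power pn p water K.
Proof.
move=> sn; rewrite big_cons big_seq1.
have clip01 (s : R) : 0 <= clip s <= 1.
  by rewrite /clip le_min ge_min ler01 lexx le_max lexx !orbT.
have phase_ge a : (clip (sat d p a K) - sat d pn a K) * p a (vpos K)
    - sat d pn a K * (rho d a (pn a (vpos K)) * g a (pn a (vpos K)) - pn a (vpos K))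
    <= storage_power pn p a K.
  rewrite /storage_power; set x := p a (vpos K); set xn := pn a (vpos K).
  have h1 := pressure_transform_concave hrho0 (hrho a) x 0.
  have h2 := pressure_transform_concave hrho0 (hrho a) xn x.
  rewrite pressure_transform0 !sub0r mulrN lerN2 in h1.
  have /andP[c0 c1] := clip01 (sat d p a K); have /andP[s0 s1] := sn a.
  have h1' := ler_wpM2l c0 h1; have h2' := ler_wpM2l s0 h2.
  rewrite -subr_ge0; move: h1' h2'; rewrite -subr_ge0 -[X in _ -> is_true X -> _]subr_ge0.
  move: (clip _) (sat d pn a K) (rho d a x) (rho d a xn) (g a x) (g a xn) => c s r rn gx gxn.
  by move=> e1 e2; rewrite -[X in _ <= X](_ : (c * (r * gx) - c * x) + (s * (x - xn) - s * (rn * (gx - gxn))) = _);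
    [exact: addr_ge0|ring].
have := phase_ge gas; have := phase_ge water; rewrite (sat_water p) clip_compl.
have := cap_sat p K; have := sn gas; have := sat_water pn K.
have /andP[c0 c1] := clip01 (sat d p gas K).
move: (sat d p gas K) c0 c1 => s c0 c1.
move: (sat d pn gas K) (sat d pn water K) => sng snw -> /andP[sg0 sg1] capE.
(* For [s] outside [[0, 1]] the product is nonnegative; inside, [cap d s] lies between 0 and
   [cap d 1] and the other factor is at least -1. *)
suff : - cap d 1 <= (clip s - sng) * cap d s.
  rewrite capE; move: (storage_power _ _ _ _) (storage_power _ _ _ _) => a b.
  move: (p gas _) (p water _) (_ * _ - _) (_ * _ - _) (clip s) => x y u v c h1 h2 h3.
  nra.
have c10 := cap1_gt0.
case: (leP s 0) => s0.
  have : cap d s <= 0 by rewrite -cap0 cap_le.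
  rewrite clip_le0 //; nra.
have cs0 : 0 <= cap d s by rewrite -cap0 cap_le ltW.
case: (leP 1 s) => s1; first by rewrite clip_ge1 //; nra.
have : cap d s <= cap d 1 by rewrite cap_le ltW.
nra.
Qed.

End Energy.

(** * A priori bounds *)

Section Bounds.
Variables (R : realType) (d : model R) (Omega : set (R * R)) (m : mesh R).
Variables (hat : vertex m -> R * R -> R) (rho0 rho1 : R).
Hypotheses (hcap : is_capillary (cap d) (cap_inv d)) (hmob : forall a, is_mobility (mob d a)).
Hypotheses (hrho0 : 0 < rho0) (hrho : forall a, is_density rho0 rho1 (rho d a)).
Implicit Types (T : {set vertex m}) (K L : vertex m) (a : phase).
Implicit Types (p pn : phase -> R * R -> R).

Local Notation lam := (transmissibility (perm d) hat).
Local Notation weight K := (area (control_volume K) * poro_mean Omega (poro d) K).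
Local Notation g := (fun a => pressure_transform (rho d a)).

Hypothesis lam_sym : forall T K L, T \in triangles m -> lam T K L = lam T L K.
Variables (c l : R).
Hypotheses (c_gt0 : 0 < c) (l_gt0 : 0 < l).
Hypothesis coercive : forall T (u : vertex m -> R) K L, T \in triangles m -> K \in T -> L \in T ->
  c * (u L - u K) ^+ 2 <= \sum_(K in T) \sum_(L in T) lam T K L * (u L - u K) ^+ 2.
Hypothesis lam_ge : forall T K L, 0 < lam T K L -> l <= lam T K L.
Hypothesis weight_ge0 : forall K, 0 <= weight K.
Hypothesis connected_mesh : forall (S : {set vertex m}) K0, K0 \in S ->
  (forall T K L, T \in triangles m -> K \in T -> L \in T -> K \in S -> L \in S) ->
  forall K, K \in S.
Variables (m0 dt : R) (pn : phase -> R * R -> R).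
Hypotheses (m0_gt0 : 0 < m0) (dt_gt0 : 0 < dt).
Hypothesis mob_sum : forall u : R, m0 <= mob d water (1 - u) + mob d gas u.
Hypothesis sat_pn : forall a K, 0 <= sat d pn a K <= 1.
Variable K0 : vertex m.

Definition edge : rel (vertex m) := fun K L =>
  [exists T in triangles m, [&& K \in T, L \in T & 0 < lam T K L]].

Lemma edgeP K L : reflect (exists T, [/\ T \in triangles m, K \in T, L \in T & 0 < lam T K L])
  (edge K L).
Proof.
apply: (iffP exists_inP) => [[T Tm /and3P[]]|[T [Tm KT LT h]]]; first by exists T.
by exists T => //; apply/and3P.
Qed.

(* If no positive edge of T leaves S, the form on T is nonpositive at the
   indicator of S, so the indicator is constant on T. *)
Lemma edge_closed_total (S : {set vertex m}) K1 : K1 \in S ->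
  (forall K L, edge K L -> K \in S -> L \in S) -> forall K, K \in S.
Proof.
move=> K1S cl; apply: connected_mesh K1S _ => T K L Tm KT LT KS; apply: contraT => LS.
have := coercive (fun K => (K \in S)%:R) Tm KT LT.
rewrite KS (negbTE LS) sub0r sqrrN expr1n mulr1 leNgt => /negP[]; apply: le_lt_trans c_gt0.
apply: sumr_le0 => I IT; apply: sumr_le0 => J JT.
case: (boolP (I \in S)) => IS; case: (boolP (J \in S)) => JS; rewrite ?subrr ?expr0n ?mulr0 //=.
  rewrite sub0r sqrrN expr1n mulr1 leNgt; apply: contra JS => h; apply: (cl I) => //.
  by apply/edgeP; exists T.
rewrite subr0 expr1n mulr1 leNgt; apply: contra IS => h; apply: (cl J) => //.
by apply/edgeP; exists T; rewrite lam_sym.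
Qed.

Lemma edge_jump_bound (f : vertex m -> R) (B : R) K : 0 <= B -> f K0 = 0 ->
  (forall K L, edge K L -> `|f L - f K| <= B) -> `|f K| <= B * #|vertex m|%:R.
Proof.
move=> B0 f0 jump; have -> : f K = f K - f K0 by rewrite f0 subr0.
apply: (path_bound jump B0).
have : K \in finset (connect edge K0).
  apply: (@edge_closed_total _ K0); first by rewrite inE.
  by move=> I J IJ; rewrite !inE => h; apply: connect_trans h (connect1 IJ).
by rewrite inE.
Qed.

Lemma edge_jump_sym (f : vertex m -> R) (B : R) :
  (forall K L, edge K L -> f L - f K <= B) -> forall K L, edge K L -> `|f L - f K| <= B.
Proof.
move=> jump K L KL; rewrite ler_norml jump // andbT lerNl opprB; apply: jump.
by move/edgeP: KL => [T [Tm KT LT h]]; apply/edgeP; exists T; rewrite lam_sym.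
Qed.

Section Dissipation.
Variables (eps : R) (p : phase -> R * R -> R) (a : phase) (T : {set vertex m}).
Hypotheses (eps_ge0 : 0 <= eps) (Tm : T \in triangles m).
Variables (K L : vertex m).
Hypotheses (KT : K \in T) (LT : L \in T).

Let low := eps + mob d a (\big[Num.min/sat d p a K]_(J in T) sat d p a J).

Let low_ge0 : 0 <= low. Proof. by rewrite addr_ge0 // mob_ge0. Qed.

Let low_le I J : I \in T -> J \in T -> low <= edge_mob d hat eps p a T I J.
Proof.
move=> IT JT; rewrite lerD2l; apply: mob_mono => //; rewrite /sat_edge.
case: ifP => _; last by rewrite (bigmin_same (sat d p a) KT IT).
by case: ifP => _; apply: bigmin_le_cond.
Qed.

Let low_eq I J : I \in T -> lam T I J < 0 -> edge_mob d hat eps p a T I J = low.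
Proof.
by move=> IT neg; rewrite /edge_mob /sat_edge leNgt neg /= -(bigmin_same (sat d p a) KT IT).
Qed.

(** Nonnegative on each edge, since the mobility differs from [low] only where the transmissibility
    is nonnegative. Keeping it recovers the upwind mobility of a single edge in
    [dissipation_ge_edge]. *)
Let excess I J := (edge_mob d hat eps p a T I J - low) * lam T I J * dlt p a I J ^+ 2.

Let excess_ge0 I J : I \in T -> J \in T -> 0 <= excess I J.
Proof.
move=> IT JT; case: (leP 0 (lam T I J)) => h.
  by apply: mulr_ge0; [apply: mulr_ge0; [rewrite subr_ge0 low_le|]|exact: sqr_ge0].
by rewrite /excess low_eq // subrr !mul0r.
Qed.

Let dissipation_split : phase_dissipation d hat eps p a T =
  low * (\sum_(K in T) \sum_(L in T) lam T K L * dlt p a K L ^+ 2)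
  + \sum_(K in T) \sum_(L in T) excess K L.
Proof.
rewrite mulr_sumr -big_split; apply: eq_bigr => I _; rewrite mulr_sumr -big_split.
by apply: eq_bigr => J _; rewrite /excess /=; ring.
Qed.

Let form_ge : c * dlt p a K L ^+ 2 <= \sum_(K in T) \sum_(L in T) lam T K L * dlt p a K L ^+ 2.
Proof. exact: (coercive (fun K => p a (vpos K)) Tm KT LT). Qed.

Let excess_sum_ge0 : 0 <= \sum_(K in T) \sum_(L in T) excess K L.
Proof. by apply: sumr_ge0 => I IT; apply: sumr_ge0 => J JT; exact: excess_ge0. Qed.

Lemma dissipation_ge_low : low * (c * dlt p a K L ^+ 2) <= phase_dissipation d hat eps p a T.
Proof. by rewrite dissipation_split; apply: ler_wpDr => //; exact: ler_wpM2l. Qed.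

Lemma dissipation_ge0 : 0 <= phase_dissipation d hat eps p a T.
Proof.
apply: le_trans dissipation_ge_low; apply: mulr_ge0 => //.
by apply: mulr_ge0; [exact: ltW|exact: sqr_ge0].
Qed.

Lemma dissipation_ge_eps : eps * (c * dlt p a K L ^+ 2) <= phase_dissipation d hat eps p a T.
Proof.
apply: le_trans dissipation_ge_low; rewrite ler_wpM2r //; first by rewrite mulr_ge0 ?sqr_ge0 ?ltW.
by rewrite lerDl mob_ge0.
Qed.

(** The mobility is [low], paid for by the coercive form with [c], plus a rest, paid for by the
    excess of this edge with [l]. Each part costs at most the dissipation, hence the factor 2. *)
Lemma dissipation_ge_edge : 0 < lam T K L ->
  mob d a (sat_edge d hat p a T K L) * (Num.min c l * dlt p a K L ^+ 2)
  <= phase_dissipation d hat eps p a T *+ 2.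
Proof.
move=> pos; have d2 := sqr_ge0 (dlt p a K L).
have h1 : excess K L <= \sum_(K in T) \sum_(L in T) excess K L.
  apply: (@le_trans _ _ (\sum_(L in T) excess K L)).
    by apply: (@ler_term_sum _ _ _ (excess K)) => // J JT; exact: excess_ge0.
  apply: (@ler_term_sum _ _ _ (fun K => \sum_(L in T) excess K L)) => // I IT.
  by apply: sumr_ge0 => J JT; exact: excess_ge0.
have form0 : 0 <= \sum_(K in T) \sum_(L in T) lam T K L * dlt p a K L ^+ 2.
  by apply: le_trans form_ge; rewrite mulr_ge0 // ltW.
have h2 : excess K L <= phase_dissipation d hat eps p a T.
  by rewrite dissipation_split; apply: (le_trans h1); rewrite lerDr mulr_ge0.
have h3 := dissipation_ge_low.
have mn0 : 0 <= Num.min c l by rewrite le_min !ltW.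
have up := low_le KT LT.
apply: (@le_trans _ _ (edge_mob d hat eps p a T K L * (Num.min c l * dlt p a K L ^+ 2))).
  by apply: ler_wpM2r; [exact: mulr_ge0|rewrite /edge_mob lerDr].
have -> : edge_mob d hat eps p a T K L * (Num.min c l * dlt p a K L ^+ 2) =
  low * (Num.min c l * dlt p a K L ^+ 2)
  + (edge_mob d hat eps p a T K L - low) * Num.min c l * dlt p a K L ^+ 2 by ring.
rewrite mulr2n; apply: lerD.
  by apply: le_trans h3; apply: ler_wpM2l => //; apply: ler_wpM2r; rewrite // ge_min lexx.
apply: le_trans h2; apply: ler_wpM2r => //; apply: ler_wpM2l; first by rewrite subr_ge0.
by rewrite ge_min (lam_ge pos) orbT.
Qed.

End Dissipation.

Lemma phase_dissipation_ge0 eps p a T : 0 <= eps -> T \in triangles m ->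
  0 <= phase_dissipation d hat eps p a T.
Proof.
move=> e0 Tm; have [->|[K KT]] := set_0Vmem T.
  by rewrite /phase_dissipation big1 // => K; rewrite inE.
exact: (dissipation_ge0 p a e0 Tm KT KT).
Qed.

Lemma capillary_dissipation_ge0 p T : 0 <= capillary_dissipation d hat p T.
Proof. by apply: sumr_ge0 => I _; apply: sumr_ge0 => J _; rewrite mulr_ge0 // sqr_ge0. Qed.

Definition stored_power_bound : R := `|\sum_(K : vertex m) weight K * (cap d 1 + \sum_(a <- [:: gas; water])
  sat d pn a K * (rho d a (pn a (vpos K)) * g a (pn a (vpos K)) - pn a (vpos K)))|.

Local Notation C0 := stored_power_bound.
Local Notation C1 := (C0 *+ 2 / dt).

Local Notation power eps eta p :=
  (\sum_K residual d Omega hat eps eta dt p pn gas K * g gas (p gas (vpos K)) +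
   \sum_K residual d Omega hat eps eta dt p pn water K * g water (p water (vpos K))).

(** [E] makes room for the Dirichlet unknowns of [regularized_existence]; for solutions of the
    scheme it is 0. *)
Lemma energy_bounds eps eta p (E : R) : 0 <= eps -> 0 <= eta -> 0 <= E -> power eps eta p + E <= 0 ->
  [/\ E <= C0,
      forall a T, T \in triangles m -> phase_dissipation d hat eps p a T <= C1
    & forall T, T \in triangles m -> eta * capillary_dissipation d hat p T <= C1].
Proof.
move=> e0 h0 E0; rewrite (power_balance Omega hcap hrho0 hrho lam_sym).
have stor : - C0 <= \sum_(K : vertex m) weight K * (storage_power d pn p gas K + storage_power d pn p water K).
  rewrite lerNl -sumrN; apply: le_trans (ler_norm _); apply: ler_sum => K _.
  rewrite -mulrN; apply: ler_wpM2l => //; rewrite lerNl.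
  by apply: (storage_power_ge hcap hrho0 hrho) => a; exact: sat_pn.
have sD a : 0 <= \sum_(T in triangles m) phase_dissipation d hat eps p a T.
  by apply: sumr_ge0 => T Tm; exact: phase_dissipation_ge0.
have sE : 0 <= \sum_(T in triangles m) capillary_dissipation d hat p T.
  by apply: sumr_ge0 => T Tm; exact: capillary_dissipation_ge0.
have sg := sD gas; have sw := sD water.
move: stor; set S := \sum_K _; set Dg := \sum_(T in _) phase_dissipation d hat eps p gas T.
set Dw := \sum_(T in _) phase_dissipation d hat eps p water T.
set De := \sum_(T in _) capillary_dissipation _ _ _ _ => stor tot.
have d1 : 0 <= dt / 2 * Dg by rewrite mulr_ge0 // divr_ge0 // ltW.
have d2 : 0 <= dt / 2 * Dw by rewrite mulr_ge0 // divr_ge0 // ltW.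
have d3 : 0 <= dt * eta / 2 * De by rewrite mulr_ge0 // divr_ge0 // mulr_ge0 // ltW.
rewrite mulrDr in tot.
split; first lra.
- move=> a T Tm; have le : phase_dissipation d hat eps p a T <= Num.max Dg Dw.
    rewrite le_max; case: a; apply/orP; [left|right];
      by apply: (@ler_term_sum _ _ _ (fun T => phase_dissipation d hat eps p _ T)) => // T' Tm';
         exact: phase_dissipation_ge0.
  apply: (le_trans le); rewrite ler_pdivlMr // mulrC.
  by rewrite /Num.max; case: ifP => _; lra.
- move=> T Tm; have le : eta * capillary_dissipation d hat p T <= eta * De.
    apply: ler_wpM2l => //; apply: (@ler_term_sum _ _ _ (fun T => capillary_dissipation d hat p T)) => //.
    by move=> *; exact: capillary_dissipation_ge0.
  by apply: (le_trans le); rewrite ler_pdivlMr //; lra.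
Qed.


Lemma C1_ge0 : 0 <= C1.
Proof. by apply: divr_ge0; [rewrite mulrn_wge0 // normr_ge0|exact: ltW]. Qed.

Lemma regularized_bound eps p a K : 0 < eps -> p a (vpos K0) = 0 ->
  (forall T, T \in triangles m -> phase_dissipation d hat eps p a T <= C1) ->
  `|p a (vpos K)| <= (1 + C1 / (eps * c)) * #|vertex m|%:R.
Proof.
move=> e0 p0 bd; apply: (edge_jump_bound (f := fun K => p a (vpos K))) => //.
  by rewrite addr_ge0 // divr_ge0 ?C1_ge0 // mulr_ge0 // ltW.
move=> I J /edgeP[T [Tm IT JT _]]; apply: abs_le_of_sqr.
rewrite ler_pdivlMr ?mulr_gt0 // mulrC -mulrA.
by apply: le_trans (bd T Tm); exact: (dissipation_ge_eps p a (ltW e0) Tm IT JT).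
Qed.

(** The 4 is the factor 2 of [dissipation_ge_edge] times the 2 from a mobility of at least [m0 / 2].
    The summand [cap d 1] is for edges where water is mobile but gas has the larger pressure. *)
Local Notation jump := (1 + C1 *+ 4 / (m0 * Num.min c l) + cap d 1).

(* Of the two phases, at least one is mobile downstream of the edge; when it is
   gas, s_g > 0 there, and when it is water, s_g < 1, so that in both cases the
   larger pressure is controlled by the pressure of the mobile phase. *)
Lemma max_pressure_jump eps p : 0 <= eps ->
  (forall a T, T \in triangles m -> phase_dissipation d hat eps p a T <= C1) ->
  forall K L, edge K L ->
  Num.max (p gas (vpos L)) (p water (vpos L)) - Num.max (p gas (vpos K)) (p water (vpos K)) <= jump.
Proof.
move=> e0 bd K L /edgeP[T [Tm KT LT pos]].
have mn0 : 0 < Num.min c l by rewrite lt_min c_gt0.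
have step a : m0 / 2 <= mob d a (sat d p a L) -> 0 <= dlt p a K L ->
    p a (vpos L) - p a (vpos K) <= 1 + C1 *+ 4 / (m0 * Num.min c l).
  move=> mb up; apply: (le_trans (ler_norm _)); apply: abs_le_of_sqr.
  rewrite -/(dlt p a K L) ler_pdivlMr ?mulr_gt0 //.
  have := dissipation_ge_edge p a e0 Tm KT LT pos.
  rewrite /sat_edge (ltW pos) up => h1; have h2 := bd a T Tm.
  have h3 : m0 / 2 * (Num.min c l * dlt p a K L ^+ 2) <=
      mob d a (sat d p a L) * (Num.min c l * dlt p a K L ^+ 2).
    by rewrite ler_wpM2r // mulr_ge0 ?sqr_ge0 // ltW.
  have -> : dlt p a K L ^+ 2 * (m0 * Num.min c l) = (m0 / 2 * (Num.min c l * dlt p a K L ^+ 2)) *+ 2.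
    by field.
  have -> : C1 *+ 4 = (C1 *+ 2) *+ 2 by rewrite -mulrnA.
  rewrite ler_pMn2r //.
  by apply: (le_trans h3); apply: (le_trans h1); rewrite ler_pMn2r.
have B0 : 0 <= C1 *+ 4 / (m0 * Num.min c l).
  by rewrite divr_ge0 ?mulrn_wge0 ?C1_ge0 // mulr_ge0 // ltW.
have cs := cap_sat hcap p L; have c1 := cap1_gt0 hcap.
set MK := Num.max (p gas (vpos K)) _.
have gK : p gas (vpos K) <= MK by rewrite le_max lexx.
have wK : p water (vpos K) <= MK by rewrite le_max lexx orbT.
have phase_le a : m0 / 2 <= mob d a (sat d p a L) -> p a (vpos L) <= MK + (1 + C1 *+ 4 / (m0 * Num.min c l)).
  move=> mb; have aK : p a (vpos K) <= MK by case: a {mb}.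
  case: (leP 0 (dlt p a K L)) => s; first by have := step a mb s; lra.
  by move: s; rewrite /dlt; lra.
have half : m0 / 2 <= mob d gas (sat d p gas L) \/ m0 / 2 <= mob d water (sat d p water L).
  have := mob_sum (sat d p gas L); rewrite -sat_water => h.
  by case: (leP (m0 / 2) (mob d gas (sat d p gas L))) => h1; [left|right; lra].
have pos_sat a : m0 / 2 <= mob d a (sat d p a L) -> 0 < sat d p a L.
  move=> mb; rewrite ltNge; apply/negP => s0; move: mb.
  have [_ _ _ M0 _] := hmob a; rewrite M0 // leNgt => /negP; apply; exact: divr_gt0.
rewrite lerBlDr ge_max; case: half => mb.
  have := pos_sat _ mb; rewrite -(cap_lt hcap) cs (cap0 hcap) => q0.
  have := phase_le _ mb => h; apply/andP; split; lra.
have := pos_sat _ mb; rewrite sat_water subr_gt0 -(cap_lt hcap) cs => q1.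
have := phase_le _ mb => h; apply/andP; split; lra.
Qed.

Lemma max_pressure_bound eps p K : 0 <= eps -> (forall a, p a (vpos K0) = 0) ->
  (forall a T, T \in triangles m -> phase_dissipation d hat eps p a T <= C1) ->
  `|Num.max (p gas (vpos K)) (p water (vpos K))| <= jump * #|vertex m|%:R.
Proof.
move=> e0 p0 bd.
apply: (edge_jump_bound (f := fun K => Num.max (p gas (vpos K)) (p water (vpos K)))).
- have c1 := cap1_gt0 hcap; have : 0 <= C1 *+ 4 / (m0 * Num.min c l); last by lra.
  have mn0 : 0 < Num.min c l by rewrite lt_min c_gt0.
  by apply: divr_ge0; [rewrite mulrn_wge0 // C1_ge0|apply: mulr_ge0; exact: ltW].
- by rewrite !p0 maxxx.
- by apply: edge_jump_sym => I J IJ; exact: (max_pressure_jump e0 bd IJ).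
Qed.

Lemma capillary_bound eta p K : 0 < eta -> (forall a, p a (vpos K0) = 0) ->
  (forall T, T \in triangles m -> eta * capillary_dissipation d hat p T <= C1) ->
  `|p gas (vpos K) - p water (vpos K)| <= (1 + C1 / (eta * l)) * #|vertex m|%:R.
Proof.
move=> h0 p0 bd; apply: (edge_jump_bound (f := fun K => p gas (vpos K) - p water (vpos K))).
- by rewrite addr_ge0 // divr_ge0 ?C1_ge0 // mulr_ge0 // ltW.
- by rewrite !p0 subrr.
move=> I J /edgeP[T [Tm IT JT pos]]; apply: abs_le_of_sqr.
have -> : p gas (vpos J) - p water (vpos J) - (p gas (vpos I) - p water (vpos I)) = dlt_cap d p I J.
  by rewrite (dlt_capE hcap) /dlt; ring.
rewrite ler_pdivlMr ?mulr_gt0 // mulrC -mulrA; apply: le_trans (bd T Tm).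
rewrite ler_pM2l //.
apply: (@le_trans _ _ (`|lam T I J| * dlt_cap d p I J ^+ 2)).
  by rewrite ler_wpM2r ?sqr_ge0 // gtr0_norm // lam_ge.
apply: (@le_trans _ _ (\sum_(J in T | 0 <= lam T I J) `|lam T I J| * dlt_cap d p I J ^+ 2)).
  apply: (@ler_term_sum _ _ (fun J => (J \in T) && (0 <= lam T I J))
    (fun J => `|lam T I J| * dlt_cap d p I J ^+ 2)) => [i _|].
    by rewrite mulr_ge0 // sqr_ge0.
  by rewrite JT ltW.
apply: (@ler_term_sum _ _ _ (fun I => \sum_(J in T | 0 <= lam T I J) `|lam T I J| * dlt_cap d p I J ^+ 2)) => //.
by move=> i _; apply: sumr_ge0 => j _; rewrite mulr_ge0 // sqr_ge0.
Qed.

Lemma phase_bound (P Q : R) p a K :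
  `|Num.max (p gas (vpos K)) (p water (vpos K))| <= P ->
  `|p gas (vpos K) - p water (vpos K)| <= Q -> `|p a (vpos K)| <= P + Q.
Proof.
rewrite !ler_norml => /andP[h1 h2] /andP[h3 h4].
move: h1 h2; case: a; rewrite /Num.max; case: ifP => _ h1 h2; apply/andP; split; lra.
Qed.

End Bounds.

(** * Maximum principle *)

Section Residual.
Variables (R : realType) (d : model R) (Omega GammaD : set (R * R)) (m : mesh R).
Variables (hat : vertex m -> R * R -> R) (rho0 rho1 : R).
Hypotheses (hcap : is_capillary (cap d) (cap_inv d)) (hmob : forall a, is_mobility (mob d a)).
Hypotheses (hrho0 : 0 < rho0) (hrho : forall a, is_density rho0 rho1 (rho d a)).
Implicit Types (T : {set vertex m}) (I J K L : vertex m) (a : phase).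
Implicit Types (p pn : phase -> R * R -> R).

Local Notation lam := (transmissibility (perm d) hat).
Local Notation weight K := (area (control_volume K) * poro_mean Omega (poro d) K).
Local Notation residual := (residual d Omega hat).

Lemma residual_nodal eps eta dt p p' pn a K :
  (forall b L, p b (vpos L) = p' b (vpos L)) ->
  residual eps eta dt p pn a K = residual eps eta dt p' pn a K.
Proof.
move=> pp; have satE b L : sat d p b L = sat d p' b L by rewrite /sat !pp.
have dltE b (I J : vertex m) : dlt p b I J = dlt p' b I J by rewrite /dlt !pp.
have edgeE b T (I J : vertex m) : sat_edge d hat p b T I J = sat_edge d hat p' b T I J.
  rewrite /sat_edge dltE !satE; case: ifP => // _.
  by apply: eq_bigr => L _; rewrite satE.
rewrite /Defs.residual satE pp; congr (_ - _ * _ - _ * _).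
  apply: eq_bigr => T _; apply: eq_bigr => L _.
  by rewrite dltE edgeE /rho_edge !pp.
apply: eq_bigr => T _; apply: eq_bigr => L _.
by rewrite /dlt_cap !satE /rho_edge !pp.
Qed.

Section Continuity.
Variables (X : topologicalType) (p : X -> phase -> R * R -> R).
Hypothesis cp : forall a K, continuous (fun x => p x a (vpos K)).

Let comp (f : R -> R) (h : X -> R) : continuous f -> continuous h -> continuous (f \o h).
Proof. by move=> cf ch x; apply: continuous_comp; [exact: ch|exact: cf]. Qed.

Let cB (f h : X -> R) : continuous f -> continuous h -> continuous (fun x => f x - h x).
Proof. by move=> cf ch; apply: continuous_funD => //; exact: continuous_funN. Qed.

Lemma sat_continuous a K : continuous (fun x => sat d (p x) a K).
Proof.
have [[_ _ _ ci] _] := hcap.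
have cg : continuous (fun x => sat d (p x) gas K).
  by apply: (comp (f := cap_inv d)) => //; apply: cB; exact: cp.
by case: a => //; apply: cB => //; exact: continuous_funcst.
Qed.

Lemma dlt_continuous a K L : continuous (fun x => dlt (p x) a K L).
Proof. by apply: cB; exact: cp. Qed.

(** The upwind mobility jumps only where the pressure drop vanishes. Splitting the drop into
    positive and negative parts writes the product with continuous factors. *)
Lemma mobile_drop_continuous eps a T K L :
  continuous (fun x => (eps + mob d a (sat_edge d hat (p x) a T K L)) * dlt (p x) a K L).
Proof.
have [cM _ _ _ _] := hmob a.
have cms J : continuous (fun x => eps + mob d a (sat d (p x) a J)).
  apply: continuous_funD; first exact: continuous_funcst.
  by apply: (comp cM); exact: sat_continuous.
have cd : continuous (fun x => dlt (p x) a K L) by exact: dlt_continuous.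
have c0 := @continuous_funcst R X 0.
rewrite /sat_edge; case: (leP 0 (lam T K L)) => h; last first.
  apply: continuous_funM => //; apply: continuous_funD; first exact: continuous_funcst.
  by apply: (comp cM); apply: continuous_bigmin => [|J]; exact: sat_continuous.
have -> : (fun x => (eps + mob d a (if 0 <= dlt (p x) a K L then sat d (p x) a L
      else sat d (p x) a K)) * dlt (p x) a K L) =
    (fun x => (eps + mob d a (sat d (p x) a L)) * Num.max (dlt (p x) a K L) 0
      + (eps + mob d a (sat d (p x) a K)) * Num.min (dlt (p x) a K L) 0).
  apply/funext => x; case: (leP 0 (dlt (p x) a K L)) => s.
    by rewrite mulr0 addr0.
  by rewrite mulr0 add0r.
apply: continuous_funD; apply: continuous_funM => //.
  exact: continuous_funmax.
exact: continuous_funmin.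
Qed.

Lemma residual_continuous eps eta dt pn a K :
  continuous (fun x => residual eps eta dt (p x) pn a K).
Proof.
have cc := @continuous_funcst R X.
have cedge T L : continuous (fun x => rho_edge d (p x) a K L).
  by apply: (continuous_rho_mean hrho0 (hrho a)); exact: cp.
apply: cB.
  apply: cB; apply: continuous_funM => //.
    apply: cB => //; apply: continuous_funM.
      by apply: (comp (density_continuous (hrho a))).
    by apply: continuous_funmin => //; apply: continuous_funmax => //; exact: sat_continuous.
  apply: continuous_sum => T _; apply: continuous_sum => L _.
  have -> : (fun x => rho_edge d (p x) a K L * (eps + mob d a (sat_edge d hat (p x) a T K L)) *
      lam T K L * dlt (p x) a K L) = (fun x => rho_edge d (p x) a K L * lam T K L *
      ((eps + mob d a (sat_edge d hat (p x) a T K L)) * dlt (p x) a K L)).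
    by apply/funext => x; ring.
  apply: continuous_funM; last exact: mobile_drop_continuous.
  by apply: continuous_funM => //; exact: cedge.
apply: continuous_funM => //; apply: continuous_sum => T _; apply: continuous_sum => L _.
apply: continuous_funM; first by apply: continuous_funM => //; exact: cedge.
have [[_ _ cc' _] _] := hcap.
by apply: cB; apply: (comp cc'); exact: sat_continuous.
Qed.

End Continuity.

Section MaximumPrinciple.
Variable K0 : vertex m.
Hypothesis weight_ge0 : forall K, 0 <= weight K.
Hypothesis edge_total : forall (S : {set vertex m}) K1, K1 \in S ->
  (forall K L, edge d hat K L -> K \in S -> L \in S) -> forall K, K \in S.
Variables (dt : R) (pn : phase -> R * R -> R).
Hypotheses (dt_gt0 : 0 < dt) (sat_pn : forall a K, 0 <= sat d pn a K <= 1).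
Hypothesis K0_dir : dirichlet GammaD K0.

Lemma dirichlet_sat_ge0 p a K : (forall b, p b (vpos K) = 0) -> 0 <= sat d p a K.
Proof.
move=> p0; have [[cK _ _ _] _] := hcap.
have s0 : sat d p gas K = 0.
  by rewrite -[RHS]cK (cap0 hcap) /sat !p0 subrr.
by case: a; [rewrite s0|rewrite sat_water s0 subr0 ler01].
Qed.

(* At a vertex where s_a is minimal and negative, the content and the upwind
   fluxes vanish or have a sign, so the eta-term must vanish: the minimum
   spreads along the positive edges up to the Dirichlet boundary. *)
Lemma sat_ge0 eta p a K : 0 < eta ->
  (forall b L, dirichlet GammaD L -> p b (vpos L) = 0) ->
  (forall b L, ~ dirichlet GammaD L -> residual 0 eta dt p pn b L = 0) ->
  0 <= sat d p a K.
Proof.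
move=> eta0 pdir res0; rewrite leNgt; apply/negP => sK.
pose K1 := [arg min_(J < K) sat d p a J]%O.
have [min1 s1] : (forall J, sat d p a K1 <= sat d p a J) /\ sat d p a K1 < 0.
  rewrite /K1; case: (@Order.TotalTheory.arg_minP) => // J _ h; split=> [I|]; first exact: h.
  exact: le_lt_trans (h K isT) sK.
pose S := finset (fun J => sat d p a J == sat d p a K1).
suff : K0 \in S.
  rewrite inE => /eqP e; have : 0 <= sat d p a K0 by apply: dirichlet_sat_ge0 => b; exact: pdir.
  by rewrite e leNgt s1.
apply: (@edge_total S K1); first by rewrite inE eqxx.
move=> I J /edgeP[T [Tm IT JT pos]]; rewrite !inE => /eqP sI.
have sI0 : sat d p a I < 0 by rewrite sI.
have minI L : sat d p a I <= sat d p a L by rewrite sI.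
have Idir : ~ dirichlet GammaD I.
  move=> dI; have : 0 <= sat d p a I by apply: dirichlet_sat_ge0 => b; exact: pdir.
  by rewrite leNgt sI0.
have mob0 s : s <= 0 -> mob d a s = 0 by have [_ _ _ h _] := hmob a; exact: h.
(* The gas saturation is minimal where [p_c] is, the water saturation where [p_c] is maximal; the
   sign of the [eta]-term compensates this, so one argument serves both phases. *)
have cap_sgn L : 0 <= (-1) ^+ phase_idx a * dlt_cap d p I L.
  rewrite /dlt_cap; have := minI L; case: (a) => /= h.
    by rewrite expr0 mul1r subr_ge0 (cap_le hcap).
  rewrite expr1 mulN1r opprB subr_ge0 (cap_le hcap).
  by move: h; rewrite lerD2l lerN2.
have flux0 T' L : T' \in triangles m -> I \in T' ->
    0 <= rho_edge d p a I L * (0 + mob d a (sat_edge d hat p a T' I L)) * lam T' I L * dlt p a I L.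
  move=> Tm' IT'; rewrite add0r /sat_edge; case: ifP => lm.
    case: ifP => dl; last by rewrite mob0 ?(ltW sI0) // mulr0 !mul0r.
    rewrite !mulr_ge0 ?mob_ge0 //; exact/ltW/(rho_edge_gt0 hrho0 hrho).
  rewrite mob0 ?mulr0 ?mul0r //; apply: le_trans (ltW sI0).
  exact: bigmin_le_cond.
pose q T' L := rho_edge d p a I L * `|lam T' I L| * ((-1) ^+ phase_idx a * dlt_cap d p I L).
have q0 T' L : 0 <= q T' L.
  by rewrite mulr_ge0 // mulr_ge0 //; exact/ltW/(rho_edge_gt0 hrho0 hrho).
have D0 : \sum_(T in triangles m | I \in T) \sum_(L in T :\ I | 0 <= lam T I L) q T L = 0.
  apply/eqP; rewrite eq_le; apply/andP; split; last by apply: sumr_ge0 => T' _; exact: sumr_ge0.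
  have := res0 a I Idir; rewrite /Defs.residual (clip_le0 (ltW sI0)) mulr0 sub0r mulrN.
  set F := \sum_(_ in _ | _) _; set E := \sum_(_ in _ | _) _.
  have F0 : 0 <= F.
    by apply: sumr_ge0 => T' /andP[Tm' IT']; apply: sumr_ge0 => L _; exact: flux0.
  have c0 : 0 <= weight I * (rho d a (pn a (vpos I)) * sat d pn a I).
    have /andP[s0 _] := sat_pn a I.
    by rewrite mulr_ge0 // mulr_ge0 //; exact/ltW/(density_gt0 hrho0 (hrho a)).
  have -> : \sum_(T in triangles m | I \in T) \sum_(L in T :\ I | 0 <= lam T I L) q T L =
      (-1) ^+ phase_idx a * E.
    rewrite /E mulr_sumr; apply: eq_bigr => T' _; rewrite mulr_sumr; apply: eq_bigr => L _.
    by rewrite /q; ring.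
  move=> h; rewrite -(pmulr_rle0 _ (mulr_gt0 dt_gt0 eta0)) mulrA.
  have := mulr_ge0 (ltW dt_gt0) F0; lra.
have [->//|IJ] := eqVneq J I; first by rewrite sI.
have qJ : q T J = 0.
  apply/eqP; rewrite eq_le q0 andbT -D0.
  apply: (@le_trans _ _ (\sum_(L in T :\ I | 0 <= lam T I L) q T L)).
    apply: (@ler_term_sum _ _ (fun L => (L \in T :\ I) && (0 <= lam T I L)) (q T)) => //.
    by rewrite !inE IJ JT ltW.
  apply: (@ler_term_sum _ _ (fun T => (T \in triangles m) && (I \in T))
    (fun T => \sum_(L in T :\ I | 0 <= lam T I L) q T L)) => [T' _|]; first exact: sumr_ge0.
  by rewrite Tm.
move/eqP: qJ; rewrite /q !mulf_eq0 signr_eq0 normr_eq0 (gt_eqF pos) (gt_eqF (rho_edge_gt0 hrho0 hrho _ _ _ _)) /=.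
rewrite /dlt_cap subr_eq0 => /eqP e.
have [[cK _ _ _] _] := hcap.
have e' : sat d p gas J = sat d p gas I by rewrite -[LHS]cK e cK.
by rewrite -sI; case: (a); rewrite ?sat_water e'.
Qed.

End MaximumPrinciple.
End Residual.

(** * Existence *)

Section Existence.
Variables (R : realType) (d : model R) (Omega GammaD : set (R * R)) (m : mesh R).
Variables (hat : vertex m -> R * R -> R) (rho0 rho1 : R).
Hypotheses (hcap : is_capillary (cap d) (cap_inv d)) (hmob : forall a, is_mobility (mob d a)).
Hypotheses (hrho0 : 0 < rho0) (hrho : forall a, is_density rho0 rho1 (rho d a)).
Hypothesis hhat : nodal_basis Omega hat.
Implicit Types (T : {set vertex m}) (I J K L : vertex m) (a : phase).
Implicit Types (p pn : phase -> R * R -> R).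

Local Notation lam := (transmissibility (perm d) hat).
Local Notation weight K := (area (control_volume K) * poro_mean Omega (poro d) K).
Local Notation residual := (residual d Omega hat).
Local Notation g := (fun a => pressure_transform (rho d a)).
Local Notation nodes := (bool * vertex m)%type.
Local Notation dir K := (`[< dirichlet GammaD K >]).

(** Coding phases as booleans gives a finite type of unknowns, as [coercive_zero] requires. *)
Definition phase_bool a := if a is gas then false else true.
Definition bool_phase (b : bool) := if b then water else gas.

Lemma phase_boolK : cancel phase_bool bool_phase. Proof. by case. Qed.
Lemma bool_phaseK : cancel bool_phase phase_bool. Proof. by case. Qed.

Definition lift (x : {ptws nodes -> R}) : phase -> R * R -> R :=
  fun a => interpolant hat (fun K => x (phase_bool a, K)).

Lemma lift_node x a K : lift x a (vpos K) = x (phase_bool a, K).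
Proof. exact: (interpolant_node hhat). Qed.

Lemma lift_solution eps eta dt pn x :
  (forall b K, dirichlet GammaD K -> x (b, K) = 0) ->
  (forall b K, ~ dirichlet GammaD K -> residual eps eta dt (lift x) pn (bool_phase b) K = 0) ->
  scheme_solution d Omega hat GammaD eps eta dt pn (lift x).
Proof.
move=> x0 res; split=> [a|a K /(res (phase_bool a) K)]; last by rewrite phase_boolK.
split; first exact: (interpolant_P1 hhat).
by move=> K Kd; rewrite lift_node x0.
Qed.

Variables (dt : R) (pn : phase -> R * R -> R).
Hypothesis dt_gt0 : 0 < dt.

Local Notation solution eps eta p := (scheme_solution d Omega hat GammaD eps eta dt pn p).

(** For fixed [p] the residual is affine in [eps] and [eta], with slopes bounded by the nodal
    values; pressure drops are at most [2 B], capillary drops at most [4 B]. *)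
Lemma residual_perturbation eps eta eta' p (B : R) a K :
  (forall b L, `|p b (vpos L)| <= B) ->
  `|residual 0 eta dt p pn a K - residual eps eta' dt p pn a K| <=
  dt * (`|eps| + `|eta' - eta|) *
    \sum_(T in triangles m | K \in T) \sum_(L in T :\ K) rho1 * `|lam T K L| * (B *+ 4).
Proof.
move=> pB; set Z := \sum_(_ in _ | _) _.
pose X := \sum_(T in triangles m | K \in T) \sum_(L in T :\ K)
  rho_edge d p a K L * lam T K L * dlt p a K L.
pose Y := \sum_(T in triangles m | K \in T) \sum_(L in T :\ K | 0 <= lam T K L)
  rho_edge d p a K L * `|lam T K L| * dlt_cap d p K L.
have -> : residual 0 eta dt p pn a K - residual eps eta' dt p pn a K =
    dt * (eps * X + (eta' - eta) * (-1) ^+ phase_idx a * Y).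
  rewrite /Defs.residual -/Y.
  have -> : \sum_(T in triangles m | K \in T) \sum_(L in T :\ K)
      rho_edge d p a K L * (eps + mob d a (sat_edge d hat p a T K L)) * lam T K L * dlt p a K L =
    \sum_(T in triangles m | K \in T) \sum_(L in T :\ K)
      rho_edge d p a K L * (0 + mob d a (sat_edge d hat p a T K L)) * lam T K L * dlt p a K L
    + eps * X.
    rewrite mulr_sumr -big_split; apply: eq_bigr => T _; rewrite mulr_sumr -big_split.
    by apply: eq_bigr => L _ /=; ring.
  ring.
have rho_le L : `|rho_edge d p a K L| <= rho1.
  by rewrite gtr0_norm ?(rho_edge_gt0 hrho0 hrho) //; exact: (rho_mean_le hrho0 (hrho a)).
have dlt_le b L : `|dlt p b K L| <= B *+ 2.
  by apply: le_trans (ler_normB _ _) _; rewrite mulr2n lerD.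
have B0 : 0 <= B by apply: le_trans (pB gas K).
have rho1_ge0 : 0 <= rho1 by apply: le_trans (rho_le K).
have X_le : `|X| <= Z.
  apply: le_trans (ler_norm_sum _ _ _) _; apply: ler_sum => T _.
  apply: le_trans (ler_norm_sum _ _ _) _; apply: ler_sum => L _.
  rewrite !normrM ler_pM ?mulr_ge0 //; first by rewrite ler_wpM2r.
  by apply: (le_trans (dlt_le a L)); rewrite ler_wpMn2l.
have Y_le : `|Y| <= Z.
  apply: le_trans (ler_norm_sum _ _ _) _; apply: ler_sum => T _.
  apply: le_trans (ler_norm_sum _ _ _) _.
  rewrite [leLHS]big_mkcondr /=; apply: ler_sum => L _; case: ifP => _; last first.
    by rewrite !mulr_ge0 ?mulrn_wge0.
  rewrite !normrM normr_id ler_pM ?mulr_ge0 //; first by rewrite ler_wpM2r.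
  rewrite (dlt_capE hcap); apply: le_trans (ler_normB _ _) _.
  have := dlt_le gas L; have := dlt_le water L; move=> h1 h2.
  by have := lerD h2 h1; rewrite -mulrnDr.
rewrite normrM (gtr0_norm dt_gt0) -[leRHS]mulrA ler_pM2l // [leRHS]mulrDl.
apply: le_trans (ler_normD _ _) _; apply: lerD.
  by rewrite normrM ler_wpM2l.
by rewrite !normrM normrX normrN1 expr1n mulr1 ler_wpM2l.
Qed.

(** Bounded solutions for nearby parameters are approximate zeros of the limit residual on a compact
    box of nodal values, so [compact_common_zero] yields an exact one. The Dirichlet conditions are
    among the equations [h]. *)
Lemma limit_solution eta (B : R) :
  (forall e, 0 < e -> exists eps eta' p,
    [/\ 0 <= eps <= e, `|eta' - eta| <= e, solution eps eta' p
      & forall a K, `|p a (vpos K)| <= B]) ->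
  exists p, solution 0 eta p.
Proof.
move=> seq.
pose h (i : nodes) (x : {ptws nodes -> R}) : R :=
  if dir i.2 then x i else residual 0 eta dt (lift x) pn (bool_phase i.1) i.2.
have ch i : continuous (h i).
  rewrite /h; case: (dir i.2); first exact: continuous_coord.
  apply: (residual_continuous hcap hmob hrho0 hrho) => a K.
  have -> : (fun x => lift x a (vpos K)) = (fun x : {ptws nodes -> R} => x (phase_bool a, K)).
    by apply/funext => x; rewrite lift_node.
  exact: continuous_coord.
pose Z K := \sum_(T in triangles m | K \in T) \sum_(L in T :\ K) rho1 * `|lam T K L| * (B *+ 4).
have [|x xB hx] := compact_common_zero (@box_compact R _ B) ch.
  move=> e e0; pose Zm := 1 + \sum_K `|Z K|.
  have Zm0 : 0 < Zm by rewrite ltr_wpDr // sumr_ge0.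
  (* The perturbations of [eps] and of [eta] may each use half of [e]. *)
  have [|eps [eta' [p [/andP[eps0 epse] etae [pP pres] pB]]]] := seq (e / (dt * 2 * Zm)).
    by rewrite divr_gt0 // !mulr_gt0.
  pose x : {ptws nodes -> R} := fun i => p (bool_phase i.1) (vpos i.2).
  exists x => [i|[b K]]; first exact: pB.
  rewrite /h /=; case: asboolP => Kd.
    by have [_ /(_ K Kd)] := pP (bool_phase b); rewrite /x /= => ->; rewrite normr0 ltW.
  have nod c L : p c (vpos L) = lift x c (vpos L) by rewrite lift_node /x /= phase_boolK.
  rewrite -(residual_nodal _ _ _ _ _ _ _ _ _ nod).
  have per := residual_perturbation eps eta eta' (bool_phase b) K pB.
  rewrite (pres _ K Kd) subr0 in per; apply: (le_trans per).
  have ZK : Z K <= Zm.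
    apply: le_trans (ler_norm _) _; rewrite /Zm (bigD1 K) //= addrCA lerDl addr_ge0 //.
    exact: sumr_ge0.
  apply: (@le_trans _ _ (dt * (`|eps| + `|eta' - eta|) * Zm)).
    by apply: ler_wpM2l => //; rewrite mulr_ge0 ?addr_ge0 // ltW.
  apply: (@le_trans _ _ (dt * (e / (dt * 2 * Zm) + e / (dt * 2 * Zm)) * Zm)).
    apply: ler_wpM2r; first exact: ltW.
    by apply: ler_wpM2l; [exact: ltW|rewrite lerD // ger0_norm].
  rewrite le_eqVlt; apply/orP; left; apply/eqP; field.
  by rewrite !gt_eqF.
exists (lift x); apply: lift_solution => b K Kd; have := hx (b, K); rewrite /h /=.
  by rewrite asboolT.
by rewrite asboolF.
Qed.

Variables (c l m0 : R) (K0 : vertex m).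
Hypothesis lam_sym : forall T K L, T \in triangles m -> lam T K L = lam T L K.
Hypotheses (c_gt0 : 0 < c) (l_gt0 : 0 < l).
Hypothesis coercive : forall T (u : vertex m -> R) K L, T \in triangles m -> K \in T -> L \in T ->
  c * (u L - u K) ^+ 2 <= \sum_(K in T) \sum_(L in T) lam T K L * (u L - u K) ^+ 2.
Hypothesis lam_ge : forall T K L, 0 < lam T K L -> l <= lam T K L.
Hypothesis weight_ge0 : forall K, 0 <= weight K.
Hypothesis connected_mesh : forall (S : {set vertex m}) K0, K0 \in S ->
  (forall T K L, T \in triangles m -> K \in T -> L \in T -> K \in S -> L \in S) ->
  forall K, K \in S.
Hypotheses (m0_gt0 : 0 < m0).
Hypothesis mob_sum : forall u : R, m0 <= mob d water (1 - u) + mob d gas u.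
Hypothesis sat_pn : forall a K, 0 <= sat d pn a K <= 1.
Hypothesis K0_dir : dirichlet GammaD K0.

Local Notation C0 := (@stored_power_bound R d Omega m pn).
Local Notation C1 := (C0 *+ 2 / dt).

Let energy := energy_bounds hcap hmob hrho0 hrho lam_sym c_gt0 coercive weight_ge0 dt_gt0 sat_pn.

Theorem regularized_existence eps eta : 0 < eps -> 0 <= eta -> exists p, solution eps eta p.
Proof.
move=> eps0 eta0.
(* Dirichlet values stay among the unknowns with equation [x i = 0], but are replaced by 0 before
   lifting. In the other equations, dividing by [rho_mean] from 0 to [x i] turns the pairing with
   [x i] into the test with [g], since [g x = x / rho_mean r 0 x]. *)
pose mask (x : {ptws nodes -> R}) : {ptws nodes -> R} := fun i => if dir i.2 then 0 else x i.
pose F (i : nodes) (x : {ptws nodes -> R}) : R :=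
  if dir i.2 then x i
  else residual eps eta dt (lift (mask x)) pn (bool_phase i.1) i.2
       / rho_mean (rho d (bool_phase i.1)) 0 (x i).
have cF i : continuous (F i).
  rewrite /F; case: (dir i.2); first exact: continuous_coord.
  apply: continuous_funM.
    apply: (residual_continuous hcap hmob hrho0 hrho) => a K.
    have -> : (fun x => lift (mask x) a (vpos K)) =
        (fun x : {ptws nodes -> R} => if dir K then 0 else x (phase_bool a, K)).
      by apply/funext => x; rewrite lift_node.
    by case: (dir K); [exact: continuous_funcst|exact: continuous_coord].
  apply: continuous_funV.
    apply: (continuous_rho_mean hrho0 (hrho _)); first exact: continuous_funcst.
    exact: continuous_coord.
  by move=> x; rewrite gt_eqF // (rho_mean_gt0 hrho0 (hrho _)).
(* Exceeds both the bound [1 + C0] for Dirichlet unknowns and the pressure bound for the others,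
   strictly as [coercive_zero] asks. *)
pose B := 2 + C0 + (1 + C1 / (eps * c)) * #|vertex m|%:R.
have C00 : 0 <= C0 by exact: normr_ge0.
have C10 : 0 <= C1 by rewrite divr_ge0 ?mulrn_wge0 // ltW.
have B1_ge0 : 0 <= (1 + C1 / (eps * c)) * #|vertex m|%:R.
  by apply: mulr_ge0 => //; apply: addr_ge0 => //; apply: divr_ge0 => //; apply: mulr_ge0; exact: ltW.
have [||x Fx] := @coercive_zero R nodes F B _ cF.
- by rewrite /B; lra.
- move=> x; set p := lift (mask x).
  pose E := \sum_(i : nodes) (if dir i.2 then x i ^+ 2 else 0).
  have E0 : 0 <= E by apply: sumr_ge0 => i _; case: ifP => // _; exact: sqr_ge0.
  have FE : \sum_i F i x * x i =
     \sum_K residual eps eta dt p pn gas K * g gas (p gas (vpos K)) +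
     \sum_K residual eps eta dt p pn water K * g water (p water (vpos K)) + E.
    have term i : F i x * x i = residual eps eta dt p pn (bool_phase i.1) i.2 *
        g (bool_phase i.1) (p (bool_phase i.1) (vpos i.2)) + (if dir i.2 then x i ^+ 2 else 0).
      have pE : p (bool_phase i.1) (vpos i.2) = mask x i.
        by rewrite /p lift_node bool_phaseK -surjective_pairing.
      rewrite pE /F /mask; case: ifP => _.
        by rewrite pressure_transform0 mulr0 add0r expr2.
      by rewrite addr0 (pressure_transformE hrho0 (hrho _)); ring.
    under eq_bigr => i _ do rewrite term.
    rewrite big_split /=; congr (_ + _).
    rewrite -(pair_bigA _ (fun b K => residual eps eta dt p pn (bool_phase b) K *
      g (bool_phase b) (p (bool_phase b) (vpos K)))) /=.
    by rewrite big_bool addrC.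
  rewrite FE => neg [b K]; have [Ele dis _] := energy (ltW eps0) eta0 E0 neg.
  case: (asboolP (dirichlet GammaD K)) => Kd.
    have : x (b, K) ^+ 2 <= C0.
      apply: le_trans Ele; rewrite /E (bigD1 (b, K)) //= asboolT // lerDl.
      by apply: sumr_ge0 => i _; case: ifP => // _; exact: sqr_ge0.
    by move=> /abs_le_of_sqr; rewrite /B; lra.
  have -> : x (b, K) = p (bool_phase b) (vpos K).
    by rewrite /p lift_node bool_phaseK /mask /= asboolF.
  have p0 : p (bool_phase b) (vpos K0) = 0 by rewrite /p lift_node /mask /= asboolT.
  have := regularized_bound hmob lam_sym c_gt0 coercive connected_mesh dt_gt0 K eps0 p0 (dis _).
  by rewrite /B; lra.
exists (lift (mask x)); apply: lift_solution => b K Kd; first by rewrite /mask /= asboolT.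
have := Fx (b, K); rewrite /F /= asboolF // => /eqP.
by rewrite mulf_eq0 invr_eq0 (gt_eqF (rho_mean_gt0 hrho0 (hrho _) _ _)) orbF => /eqP.
Qed.

(** The residual may be nonzero at Dirichlet vertices, but there the test value [g 0] is 0, so the
    total power of a solution vanishes. *)
Lemma solution_bounds eps eta p : 0 <= eps -> 0 <= eta -> solution eps eta p ->
  (forall a T, T \in triangles m -> phase_dissipation d hat eps p a T <= C1) /\
  (forall T, T \in triangles m -> eta * capillary_dissipation d hat p T <= C1).
Proof.
move=> eps0 eta0 [pP res].
have z a K : residual eps eta dt p pn a K * g a (p a (vpos K)) = 0.
  case: (asboolP (dirichlet GammaD K)) => Kd; last by rewrite res // mul0r.
  by have [_ ->] := pP a; rewrite // pressure_transform0 mulr0.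
have [|_] := @energy eps eta p 0 eps0 eta0 (lexx 0); last by [].
by rewrite !big1 ?addr0.
Qed.

Lemma solution_root eps eta p : solution eps eta p -> forall a, p a (vpos K0) = 0.
Proof. by move=> [pP _] a; have [_ ->] := pP a. Qed.

Theorem degenerate_existence : exists p, solution 0 0 p.
Proof.
pose P := (1 + C1 *+ 4 / (m0 * Num.min c l) + cap d 1) * #|vertex m|%:R.
have maxP eps eta p K : 0 <= eps -> 0 <= eta -> solution eps eta p ->
    `|Num.max (p gas (vpos K)) (p water (vpos K))| <= P.
  move=> eps0 eta0 sol; have [dis _] := solution_bounds eps0 eta0 sol.
  have p0 := solution_root sol.
  exact: (max_pressure_bound hcap hmob lam_sym c_gt0 l_gt0 coercive lam_ge connected_mesh
    m0_gt0 dt_gt0 mob_sum K eps0 p0 dis).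
have nondegenerate eta : 0 < eta -> exists p, solution 0 eta p.
  move=> eta0; pose Q := (1 + C1 / (eta * l)) * #|vertex m|%:R.
  apply: (@limit_solution eta (P + Q)) => e e0.
  have [p sol] := regularized_existence e0 (ltW eta0).
  exists e, eta, p; split=> //; first by rewrite ltW //= lexx.
    by rewrite subrr normr0 ltW.
  move=> a K; apply: phase_bound; first by apply: (maxP e eta) => //; exact: ltW.
  have [_ dis] := solution_bounds (ltW e0) (ltW eta0) sol.
  exact: (capillary_bound hcap lam_sym c_gt0 l_gt0 coercive lam_ge connected_mesh
    dt_gt0 K eta0 (solution_root sol) dis).
apply: (@limit_solution 0 (P + cap d 1)) => e e0.
have [p sol] := nondegenerate e e0; have [pP res] := sol.
exists 0, e, p; split=> //; first by rewrite lexx ltW.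
  by rewrite subr0 ger0_norm // ltW.
move=> a K; apply: phase_bound; first by apply: (maxP 0 e) => //; exact: ltW.
have s_ge0 b : 0 <= sat d p b K.
  apply: (sat_ge0 hcap hmob hrho0 hrho weight_ge0 _ dt_gt0 sat_pn K0_dir b K e0 _ res).
    exact: (edge_closed_total lam_sym c_gt0 coercive connected_mesh).
  by move=> b' L Ld; have [_ ->] := pP b'.
have sg0 := s_ge0 gas; have := s_ge0 water; rewrite sat_water subr_ge0 => sg1.
rewrite -(cap_sat hcap) ger0_norm ?(cap_le hcap) //.
by rewrite -(cap0 hcap) (cap_le hcap).
Qed.

End Existence.

Theorem mainTheorem3 (R : realType)
    (Omega GammaD GammaN : set (R * R)) (sides : seq ((R * R) * (R * R)))
    (hOmega : polygonal_domain Omega sides)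
    (hGamma : closure Omega `\` Omega = GammaD `|` GammaN)
    (hGammaD : (0 < boundary_length sides GammaD)%E)
    (d : model R)
    (m0 phi0 phi1 lam0 lam1 rho0 rho1 : R)
    (hcap : is_capillary (cap d) (cap_inv d))
    (hmob : forall a, is_mobility (mob d a))
    (hm0 : 0 < m0)
    (hmobs : forall u : R, m0 <= mob d water (1 - u) + mob d gas u)
    (hphi0 : 0 < phi0)
    (hporo : is_porosity Omega phi0 phi1 (poro d))
    (hlam0 : 0 < lam0) (hlam1 : lam0 <= lam1)
    (hperm : is_permeability Omega lam0 lam1 (perm d))
    (hrho0 : 0 < rho0)
    (hrho : forall a, is_density rho0 rho1 (rho d a))
    (m : mesh R)
    (hmesh : conforming_triangulation Omega m)
    (hdir : exists K : vertex m, dirichlet GammaD K)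
    (hat : vertex m -> R * R -> R)
    (hhat : nodal_basis Omega hat)
    (dt : R) (hdt : 0 < dt)
    (pn : phase -> R * R -> R)
    (hpn : forall a, P1_0 Omega GammaD m (pn a))
    (hsn : forall a (K : vertex m), 0 <= sat d pn a K <= 1) :
  (forall eps eta : R, 0 < eps -> 0 < eta ->
     exists p : phase -> R * R -> R,
       scheme_solution d Omega hat GammaD eps eta dt pn p) /\
  (exists p : phase -> R * R -> R,
     scheme_solution d Omega hat GammaD 0 0 dt pn p).
Proof.
have [[oO bO cO] _] := hOmega.
have [K0 K0d] := hdir.
have spec := transmissibility_spec hmesh oO bO hhat hlam0 hperm.
have sym T (K L : vertex m) : T \in triangles m ->
    transmissibility (perm d) hat T K L = transmissibility (perm d) hat T L K.
  by move=> /spec[h _].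
have [c c0 coer] : exists2 c, 0 < c & forall T, T \in triangles m ->
    forall (u : vertex m -> R) K L, K \in T -> L \in T ->
    c * (u L - u K) ^+ 2 <=
      \sum_(K in T) \sum_(L in T) transmissibility (perm d) hat T K L * (u L - u K) ^+ 2.
  apply: (@uniform_positive R {set vertex m} (mem (triangles m)) (fun T c =>
    forall (u : vertex m -> R) K L, K \in T -> L \in T -> c * (u L - u K) ^+ 2 <=
      \sum_(K in T) \sum_(L in T) transmissibility (perm d) hat T K L * (u L - u K) ^+ 2)).
    move=> T c c' cc' h u K L KT LT; apply: le_trans (h u K L KT LT).
    by rewrite ler_wpM2r // sqr_ge0.
  by move=> T /spec[_].
(* The smallest positive transmissibility of the finite mesh, capped at 1; edges of the relation
   [edge] have at least this weight. *)
have [l l0 lge] : exists2 l, 0 < l & forall i : {set vertex m} * (vertex m * vertex m),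
    0 < transmissibility (perm d) hat i.1 i.2.1 i.2.2 ->
    l <= transmissibility (perm d) hat i.1 i.2.1 i.2.2.
  apply: (@uniform_positive R ({set vertex m} * (vertex m * vertex m))%type
    (fun i => 0 < transmissibility (perm d) hat i.1 i.2.1 i.2.2)
    (fun i l => l <= transmissibility (perm d) hat i.1 i.2.1 i.2.2)).
    by move=> i e e' le; exact: le_trans.
  by move=> i h; exists (transmissibility (perm d) hat i.1 i.2.1 i.2.2).
have w0 (K : vertex m) : 0 <= area (control_volume K) * poro_mean Omega (poro d) K.
  exact: (time_weight_ge0 _ hphi0 hporo).
have conn := mesh_connected hmesh hhat cO.
have coer' T u (K L : vertex m) (Tm : T \in triangles m) := coer T Tm u K L.
have lge' T (K L : vertex m) := lge (T, (K, L)).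
split=> [eps eta eps0 eta0|].
  exact: (regularized_existence hcap hmob hrho0 hrho hhat hdt sym c0 coer' w0 conn
    hsn K0d eps0 (ltW eta0)).
exact: (degenerate_existence hcap hmob hrho0 hrho hhat hdt sym c0 l0 coer' lge' w0 conn
    hm0 hmobs hsn K0d).
Qed.
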